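(* Let $N\ge3$, $V:\mathbb R^N\to\mathbb R$ and $f:\mathbb R^N\times\mathbb R\to\mathbb R$ satisfy: (SW1) $V$ is continuous, $1$-periodic in $x_1,\dots,x_N$, and $0\notin\sigma(-\Delta+V)$, the spectrum of $-\Delta+V$; (SW2) $f$ is continuous in $x$ and of class $C^1$ in $s$, and there exist $C>0$ and $p\in(2,2^* )$, $2^*=\frac{2N}{N-2}$, such that $|\partial_sf(x,s)|\le C(1+|s|^{p-2})$ for all $(x,s)\in\mathbb R^N\times\mathbb R$; (SW3) $f(x,u)=o(u)$ as $|u|\to0$, uniformly in $x\in\mathbb R^N$; (SW4) $F(x,u)/u^2\to+\infty$ as $|u|\to+\infty$, uniformly in $x\in\mathbb R^N$, where $F(x,s)=\int_0^sf(x,\tau)\,d\tau$; (SW5) for every $x\in\mathbb R^N$ the map $u\mapsto f(x,u)/|u|$ is strictly increasing on $(-\infty,0)$ and on $(0,+\infty)$. Let $I(u)=\frac12\int_{\mathbb R^N}(|\nabla u|^2+V(x)u^2)\,dx-\int_{\mathbb R^N}F(x,u)\,dx$ for $u\in H^1(\mathbb R^N)$ and let $$\mathcal N=\left\{u\in H^1(\mathbb R^N)\setminus\{0\}:\int_{\mathbb R^N}(|\nabla u|^2+V(x)u^2)\,dx=\int_{\mathbb R^N}f(x,u)u\,dx\ \text{ and }\ I'(u)|_{E^-}=0\right\}$$ be the Nehari–Pankov manifold. Then any $u_0\in\mathcal N$ satisfying $I(u_0)=\inf_{u\in\mathcal N}I(u)$ is a weak solution of $$-\Delta u+V(x)u=f(x,u)\quad\text{in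 }\mathbb R^N.$$
   Context: Let $Q(u)=\int_{\mathbb R^N}(|\nabla u|^2+V(x)|u|^2)\,dx$ on $H^1(\mathbb R^N)$. By (SW1) there are closed subspaces $E^+,E^-$ (corresponding to the positive and negative parts of the spectrum of $-\Delta+V$) with $H^1(\mathbb R^N)=E^+\oplus E^-$, $Q$ positive definite on $E^+$ and negative definite on $E^-$, and $Q(u)=\|u^+\|^2-\|u^-\|^2$ for $u=u^++u^-$, $u^\pm\in E^\pm$, where $\|\cdot\|$ is an equivalent norm on $H^1(\mathbb R^N)$. The functional $I$ is of class $C^1$ on $H^1(\mathbb R^N)$. A weak solution is $u\in H^1(\mathbb R^N)$ with $I'(u)=0$. *)

(* Defs.v *)
From HB Require Import structures.
From mathcomp Require Import all_boot all_order all_algebra.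
From mathcomp Require Import all_classical all_reals all_analysis.

Set Implicit Arguments.
Unset Strict Implicit.
Unset Printing Implicit Defensive.

Import Order.TTheory GRing.Theory Num.Theory.
Import numFieldNormedType.Exports.

Local Open Scope classical_set_scope.
Local Open Scope ring_scope.

Definition rV_display : measure_display -> measure_display.
Proof. exact. Qed.

(* The sigma-algebra generated by the coordinates, i.e. the Borel
   sigma-algebra of R^n. *)
Section measurable_rV.
Context (R : realType) (n : nat).

Definition rV_coord (i : 'I_n) (x : 'rV[R]_n) : measurableTypeR R := x ord0 i.

Let rV_set0 : g_sigma_preimage rV_coord set0.
Proof. exact: sigma_algebra0. Qed.

Let rV_setC A : g_sigma_preimage rV_coord A -> g_sigma_preimage rV_coord (~` A).
Proof. exact: sigma_algebraC. Qed.

Let rV_bigcup (F : (set 'rV[R]_n)^nat) :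
  (forall i, g_sigma_preimage rV_coord (F i)) ->
  g_sigma_preimage rV_coord (\bigcup_i (F i)).
Proof. exact: sigma_algebra_bigcup. Qed.

HB.instance Definition _ := @isMeasurable.Build (rV_display default_measure_display)
  'rV[R]_n (g_sigma_preimage rV_coord) rV_set0 rV_setC rV_bigcup.

Lemma measurable_rV_coord (i : 'I_n) : measurable_fun [set: 'rV[R]_n] (rV_coord i).
Proof.
move=> _ Y mY; rewrite setTI; apply: sub_sigma_algebra => /=.
rewrite -bigcup_seq/=; exists i => /=; first by rewrite mem_index_enum.
by exists Y => //; rewrite setTI.
Qed.

Lemma measurable_fun_rV d (T : measurableType d) (f : T -> 'rV[R]_n) :
  (forall i, measurable_fun [set: T] (rV_coord i \o f)) -> measurable_fun [set: T] f.
Proof.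
move=> mf _ Y mY; rewrite setTI.
suff: g_sigma_preimage rV_coord `<=` [set B | measurable (f @^-1` B)].
  by move=> /(_ _ mY).
apply: smallest_sub.
  split => /=; first by rewrite preimage_set0.
    by move=> A mA; rewrite setTD preimage_setC; exact: measurableC.
  by move=> F mF; rewrite preimage_bigcup; exact: bigcup_measurable.
rewrite -bigcup_seq => A [i _ [B mB <-]] /=.
by rewrite setTI -comp_preimage -[X in measurable X]setTI; exact: mf.
Qed.

End measurable_rV.

Section lebesgue_rV.
Context (R : realType).

Definition rV_cons n (z : measurableTypeR R * 'rV[R]_n) : 'rV[R]_n.+1 :=
  \row_i (if unlift ord0 i is Some j then z.2 ord0 j else z.1).

Lemma measurable_rV_cons n : measurable_fun setT (@rV_cons n).
Proof.
apply: measurable_fun_rV => i; rewrite /rV_coord /rV_cons /comp.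
case: (unliftP ord0 i) => [j ->|->].
  rewrite (_ : (fun _ => _) = (@rV_coord R n j \o snd)).
    exact: measurableT_comp (measurable_rV_coord j) measurable_snd.
  by apply/funext => z; rewrite mxE liftK.
rewrite (_ : (fun _ => _) = fst); first exact: measurable_fst.
by apply/funext => z; rewrite mxE unlift_none.
Qed.


Section step.
Variables (n : nat) (mu : {sigma_finite_measure set 'rV[R]_n -> \bar R}).

Definition lebesgue_rV_step : set 'rV[R]_n.+1 -> \bar R :=
  pushforward (@lebesgue_measure R \x mu)%E (@rV_cons n).

Let step0 : lebesgue_rV_step set0 = 0%E.
Proof. by rewrite /lebesgue_rV_step /pushforward preimage_set0 measure0. Qed.

Let step_ge0 A : (0 <= lebesgue_rV_step A)%E.
Proof. by rewrite /lebesgue_rV_step /pushforward; exact: measure_ge0. Qed.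

Let step_sigma_additive : semi_sigma_additive lebesgue_rV_step.
Proof.
move=> F mF tF mUF; rewrite /lebesgue_rV_step /pushforward preimage_bigcup.
have mcons := @measurable_rV_cons n.
apply: measure_semi_sigma_additive.
- by move=> k; rewrite -[X in measurable X]setTI; exact: mcons.
- apply/trivIsetP => /= i j _ _ ij; rewrite -preimage_setI.
  by move/trivIsetP : tF => /(_ _ _ _ _ ij) ->//; rewrite preimage_set0.
- by rewrite -preimage_bigcup -[X in measurable X]setTI; exact: mcons.
Qed.

HB.instance Definition _ := isMeasure.Build _ _ _
  lebesgue_rV_step step0 step_ge0 step_sigma_additive.

Let step_sigma_finite : sigma_finite setT lebesgue_rV_step.
Proof.
have /sigma_finiteP[F [TF ndF Foo]] := sigma_finiteT (@lebesgue_measure R).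
have /sigma_finiteP[G [TG ndG Goo]] := sigma_finiteT mu.
have mtail : measurable_fun setT
    (fun x : 'rV[R]_n.+1 => \row_j x ord0 (lift ord0 j) : 'rV[R]_n).
  apply: measurable_fun_rV => j.
  rewrite (_ : _ \o _ = rV_coord (lift ord0 j)); first exact: measurable_rV_coord.
  by apply/funext => x; rewrite /= /rV_coord mxE.
have pre k : @rV_cons n @^-1` (rV_coord ord0 @^-1` F k `&`
    (fun x : 'rV[R]_n.+1 => \row_j x ord0 (lift ord0 j)) @^-1` G k) = F k `*` G k.
  apply/seteqP; split => -[a x] /=.
    rewrite /rV_coord /rV_cons mxE unlift_none /= => -[Fa Gx]; split => //=.
    by move: Gx; congr (G k _); apply/rowP => j; rewrite !mxE liftK.
  move=> -[/= Fa Gx]; rewrite /rV_coord /rV_cons mxE unlift_none /=; split => //.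
  by move: Gx; congr (G k _); apply/rowP => j; rewrite !mxE liftK.
exists (fun k => rV_coord ord0 @^-1` F k `&`
    (fun x : 'rV[R]_n.+1 => \row_j x ord0 (lift ord0 j)) @^-1` G k).
  apply/seteqP; split => // x _.
  have : (\bigcup_i F i) (rV_coord ord0 x) by rewrite -TF.
  have : (\bigcup_i G i) (\row_j x ord0 (lift ord0 j)) by rewrite -TG.
  move=> [k _ Gk] [l _ Fl]; exists (maxn l k) => //; split.
    by have /subsetPset := ndF _ _ (leq_maxl l k); exact.
  by have /subsetPset := ndG _ _ (leq_maxr l k); exact.
move=> k; have [mF Fk] := Foo k; have [mG Gk] := Goo k; split.
  apply: measurableI; rewrite -[X in measurable X]setTI.
    exact: measurable_rV_coord.
  exact: mtail.
rewrite /lebesgue_rV_step /pushforward pre product_measure1E//.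
by rewrite lte_mul_pinfty// ge0_fin_numE.
Qed.

HB.instance Definition _ := Measure_isSigmaFinite.Build _ _ _
  lebesgue_rV_step step_sigma_finite.

End step.

(* Lebesgue measure on R^n = R x (R x ( ... x R^0)), the unit mass on R^0. *)
Fixpoint lebesgue_rV (n : nat) : {sigma_finite_measure set 'rV[R]_n -> \bar R} :=
  match n with
  | 0 => \d_(0 : 'rV[R]_0)
  | m.+1 => lebesgue_rV_step (lebesgue_rV m)
  end.

Lemma lebesgue_rV_box n (A : 'I_n -> set (measurableTypeR R)) :
  (forall i, measurable (A i)) ->
  lebesgue_rV n [set x | forall i, A i (x ord0 i)] =
  (\prod_(i < n) lebesgue_measure (A i))%E.
Proof.
elim: n A => [|n IHn] A mA.
  rewrite big_ord0 (_ : [set x | _] = setT); first exact: diracT.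
  by apply/seteqP; split => // x _ [].
rewrite big_ord_recl -IHn//= /lebesgue_rV_step /pushforward.
rewrite -product_measure1E//; last first.
  have -> : (fun x : 'rV[R]_n => forall i, A (lift ord0 i) (x ord0 i)) =
      \bigcap_(i in [set: 'I_n]) rV_coord i @^-1` A (lift ord0 i).
    by apply/seteqP; split => x /= h i; [move=> _; exact: h|exact: h].
  apply: fin_bigcap_measurable => // i _.
  by rewrite -[X in measurable X]setTI; exact: measurable_rV_coord.
congr (product_measure1 _ _ _); apply/seteqP; split => -[a x] /=.
  move=> h; split => /=.
    by have := h ord0; rewrite mxE unlift_none.
  by move=> i; have := h (lift ord0 i); rewrite mxE liftK.
move=> [/= Aa Ax] i; rewrite mxE.
by case: (unliftP ord0 i) => [j ->|->] /=.
Qed.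

End lebesgue_rV.

Local Notation leb := (lebesgue_rV _ _).

(* Functions on R^N are not quotiented: elements of L^2, H^1 and H^2 are
   representatives, and equality of elements is equality almost everywhere. *)
Section sobolev.
Context (R : realType) (N : nat).
Implicit Types (u v g phi : 'rV[R]_N -> R) (i : 'I_N).

Definition L2 : set ('rV[R]_N -> R) := [set u | u \in Lfun leb 2%:E].

Definition L2dot u v : R := \int[leb]_x (u x * v x).

Definition L2norm u : R := Num.sqrt (L2dot u u).

Definition partial i phi : 'rV[R]_N -> R := fun x => 'D_(delta_mx 0 i) phi x.

Definition smooth phi :=
  forall (s : seq 'I_N) x, differentiable (foldr partial phi s) x.

Definition test_function phi :=
  smooth phi /\ compact (closure [set x | phi x != 0]).

Definition weak_partial i u g :=
  forall phi, test_function phi -> L2dot u (partial i phi) = - L2dot g phi.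

Definition H1 : set ('rV[R]_N -> R) :=
  [set u | L2 u /\ forall i, exists2 g, L2 g & weak_partial i u g].

(* The i-th weak derivative in L^2, unique almost everywhere if it exists. *)
Definition wpartial i u : 'rV[R]_N -> R :=
  xget (cst 0) [set g | L2 g /\ weak_partial i u g].

Definition H2 : set ('rV[R]_N -> R) :=
  [set u | H1 u /\ forall i, H1 (wpartial i u)].

Definition sqgrad u : 'rV[R]_N -> R := fun x => \sum_(i < N) wpartial i u x ^+ 2.

Definition laplacian u : 'rV[R]_N -> R :=
  fun x => \sum_(i < N) wpartial i (wpartial i u) x.

Definition H1norm u : R := Num.sqrt (\int[leb]_x (sqgrad u x + u x ^+ 2)).

Definition H1_closed_subspace (E : set ('rV[R]_N -> R)) :=
  [/\ E `<=` H1,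
      E (cst 0),
      forall a u v, E u -> E v -> E (fun x => a * u x + v x) &
      forall (w : ('rV[R]_N -> R)^nat) u, (forall k, E (w k)) -> H1 u ->
        (fun k => H1norm (w k - u)) @ \oo --> (0 : R) -> E u].

Definition H1_equivalent_norm (nrm : ('rV[R]_N -> R) -> R) :=
  [/\ forall u v, H1 u -> H1 v -> nrm (u + v) <= nrm u + nrm v,
      forall a u, H1 u -> nrm (fun x => a * u x) = `|a| * nrm u &
      exists c C : R, [/\ 0 < c, 0 < C &
        forall u, H1 u -> c * H1norm u <= nrm u <= C * H1norm u]].

(* L is the Frechet derivative at u of the functional J on H^1. *)
Definition H1_derivative (J : ('rV[R]_N -> R) -> R) u
    (L : ('rV[R]_N -> R) -> R) :=
  [/\ forall a v w, H1 v -> H1 w -> L (fun x => a * v x + w x) = a * L v + L w,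
      exists C : R, forall v, H1 v -> `|L v| <= C * H1norm v &
      forall e : R, 0 < e -> exists2 d : R, 0 < d &
        forall v, H1 v -> H1norm v < d ->
          `|J (u + v) - J u - L v| <= e * H1norm v].

End sobolev.

Section schrodinger.
Context (R : realType) (N : nat).
Variable V : 'rV[R]_N -> R.
Implicit Types (u v : 'rV[R]_N -> R) (l : R).

(* The operator -Delta + V on L^2, with domain H^2. *)
Definition schrodinger u : 'rV[R]_N -> R := fun x => - laplacian u x + V x * u x.

(* -Delta + V - l is a bijection from H^2 onto L^2 with bounded inverse; the
   bound contains injectivity.  For a bounded real V the operator is
   self-adjoint, so its spectrum is real, and as it commutes with complex
   conjugation a real l can be tested on real-valued functions. *)
Definition resolvent_set : set R := [set l |
  (exists C : R, forall u, H2 u ->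
     L2norm u <= C * L2norm (fun x => schrodinger u x - l * u x)) /\
  (forall g, L2 g -> exists2 u, H2 u &
     (fun x => schrodinger u x - l * u x) = g %[ae leb])].

Definition spectrum : set R := ~` resolvent_set.

Definition Q u : R := \int[leb]_x (sqgrad u x + V x * u x ^+ 2).

(* P is the projection-valued spectral measure of -Delta + V: the P B are
   commuting orthogonal projections of L^2, m is the measure B |-> <P B u, u>,
   and the operator is the integral of l against P, domain included.  By
   polarization the identity of quadratic forms determines the operator. *)
Definition spectral_measure (P : set R -> ('rV[R]_N -> R) -> 'rV[R]_N -> R) :=
  [/\ forall B u, measurable (B : set (measurableTypeR R)) -> L2 u -> L2 (P B u),
      forall B u v, measurable (B : set (measurableTypeR R)) -> L2 u -> L2 v ->
        L2dot (P B u) v = L2dot u (P B v),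
      forall B C u, measurable (B : set (measurableTypeR R)) ->
        measurable (C : set (measurableTypeR R)) -> L2 u ->
        P (B `&` C) u = P B (P C u) %[ae leb],
      forall u, L2 u -> P setT u = u %[ae leb] &
      forall u, L2 u ->
        exists m : {measure set (measurableTypeR R) -> \bar R},
        [/\ forall B, measurable B -> m B = (L2dot (P B u) u)%:E,
            H2 u <-> (\int[m]_l (l ^+ 2)%:E < +oo)%E &
            H2 u -> L2dot (schrodinger u) u = \int[m]_l l]].

(* The splitting of H^1 along the positive and the negative part of the
   spectrum of -Delta + V.  splitting_spectral determines Ep and Em; the other
   fields are the classical properties of this splitting when 0 is not in the
   spectrum. *)
Record spectral_splitting (Ep Em : set ('rV[R]_N -> R)) : Prop := {
  splitting_spectral : exists P, [/\ spectral_measure P,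
    Ep = [set u | H1 u /\ P `]0, +oo[%classic u = u %[ae leb]] &
    Em = [set u | H1 u /\ P `]-oo, 0[%classic u = u %[ae leb]]];
  splitting_closedp : H1_closed_subspace Ep;
  splitting_closedm : H1_closed_subspace Em;
  splitting_sum : forall u, H1 u ->
    exists up um, [/\ Ep up, Em um & u = up + um %[ae leb]];
  splitting_direct : forall u, Ep u -> Em u -> u = cst 0 %[ae leb];
  splitting_pos : forall u, Ep u -> ~ (u = cst 0 %[ae leb]) -> 0 < Q u;
  splitting_neg : forall u, Em u -> ~ (u = cst 0 %[ae leb]) -> Q u < 0;
  splitting_norm : exists2 nrm, H1_equivalent_norm nrm &
    forall up um, Ep up -> Em um -> Q (up + um) = nrm up ^+ 2 - nrm um ^+ 2
}.

End schrodinger.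

Section functional.
Context (R : realType) (N : nat).
Variables (V : 'rV[R]_N -> R) (f : 'rV[R]_N -> R -> R).
Implicit Types (u : 'rV[R]_N -> R).

Definition SW1 :=
  [/\ continuous V,
      forall i x, V (x + delta_mx 0 i) = V x &
      ~ spectrum V 0].

Definition critical_exponent : R := 2 * N%:R / (N%:R - 2).

Definition SW2 :=
  [/\ forall s, continuous (f ^~ s),
      forall x s, derivable (f x) s 1,
      forall x, continuous (derive1 (f x)) &
      exists C p : R, [/\ 0 < C, 2 < p < critical_exponent &
        forall x s, `|derive1 (f x) s| <= C * (1 + `|s| `^ (p - 2))]].

Definition SW3 := forall e : R, 0 < e -> exists2 d : R, 0 < d &
  forall x s, `|s| < d -> `|f x s| <= e * `|s|.

Definition primitive x (s : R) : R :=
  if 0 <= s then \int[lebesgue_measure]_(t in `[0, s]) f x t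
  else - \int[lebesgue_measure]_(t in `[s, 0]) f x t.

Definition SW4 := forall M : R, exists r : R,
  forall x s, r < `|s| -> M <= primitive x s / s ^+ 2.

Definition SW5 := forall x s t, s < t -> t < 0 \/ 0 < s ->
  f x s / `|s| < f x t / `|t|.

Definition energy u : R :=
  2^-1 * Q V u - \int[leb]_x primitive x (u x).

Definition nehari_pankov (Em : set ('rV[R]_N -> R)) : set ('rV[R]_N -> R) :=
  [set u | [/\ H1 u, ~ (u = cst 0 %[ae leb]),
    Q V u = \int[leb]_x (f x (u x) * u x) &
    exists2 L, H1_derivative energy u L & forall v, Em v -> L v = 0]].

Definition weak_solution u := H1 u /\ H1_derivative energy u (cst 0).

End functional.

(* Main.v *)
Require Import Defs.
From HB Require Import structures.
From mathcomp Require Import all_boot all_order all_algebra.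
From mathcomp Require Import all_classical all_reals all_analysis.
From mathcomp Require Import measurable_realfun ring lra.

Set Implicit Arguments.
Unset Strict Implicit.
Unset Printing Implicit Defensive.

Import Order.TTheory GRing.Theory Num.Theory.
Import numFieldNormedType.Exports.

Local Open Scope classical_set_scope.
Local Open Scope ring_scope.

(** Write I = Q / 2 - Psi for the energy, Psi(u) being the integral of the primitive of
    f at u.  Suppose that u0 minimises I on the manifold and that I'(u0) v < 0 for some
    v in H^1.

    Since f(x, s) / |s| increases on each half-line, a pointwise inequality of Szulkin and
    Weth (fibre_lt) integrates to I(t u0 + w) <= I(u0) for t > 0 and w in E^-, strictly
    if t <> 1 (energy_fibre_le, energy_fibre_lt).  Move u0 a little to u = u0 + e v, and
    maximise I over the t u + w with t near 1 and w in a small ball of E^-.  As Q is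
    coercively negative on E^- (splitting_coercive) and Psi is convex, I is uniformly
    concave along E^- (energy_midpoint), so the maximum is attained although nothing is
    compact.  It is attained at an interior point m: on the boundary of the box I stays
    below I(u0) by a margin independent of e.  Hence I' vanishes at m on m and on E^-,
    that is, m is on the manifold; and I(m) < I(u0), because I' v is still negative at
    m, while I is at most I(u0) at the point m - t e v, which belongs to t u0 + E^-.
    This contradicts minimality.  The argument is carried out for a functional on an
    abstract space in natural_constraint; it bypasses both the projection onto the
    manifold and a second derivative of I.

    Its hypotheses are the completeness of H^1 (H1_complete) and second order estimates
    of I on bounded sets (energy_taylor, denergy_bound).  The latter rest on the
    boundedness of V, by periodicity, and on the embedding of H^1 into L^p for
    2 <= p < 2 N / (N - 2) (sobolev).  To prove this embedding, mollify u at the scales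
    2^-k by products of one-dimensional kernels.  The difference of two successive
    kernels is a divergence (mker_diff), so an increment is an integral of the weak
    gradient against kernels supported in cubes of side 2^-k (mollify_diff), and its
    L^p norm decreases geometrically exactly when p is subcritical
    (lacunary_ratio_lt1).  Summing up bounds the limit, which is u (mollify_limit).  The
    test functions obtained by integrating the kernels over boxes also show that weak
    derivatives are unique almost everywhere (weak_eq0). *)

(** * Maximisation over a box around the fibre *)

Lemma near0_small (R : realType) (b c : R) : 0 < b ->
  \forall e \near 0^'+, e * c < b.
Proof.
move=> b0; have d0 : 0 < b / (`|c| + 1) by rewrite divr_gt0// ltr_wpDl.
near=> e.
have e0 : 0 < e by near: e; exact: nbhs_right_gt.
have : e < b / (`|c| + 1) by near: e; exact: nbhs_right_lt.
rewrite ltr_pdivlMr ?ltr_wpDl//; apply: le_lt_trans.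
by rewrite ler_pM2l// (le_trans (ler_norm _))// lerDl.
Unshelve. all: by end_near. Qed.

Lemma distr1_bounds (R : realType) (t tau : R) : `|t - 1| <= tau -> tau * 2 < 1 ->
  0 < t /\ t <= 2.
Proof. by rewrite ler_distl => /andP[? ?] ?; split; lra. Qed.

Section natural_constraint.
Variables (R : realType) (X : lmodType R) (H Em : set X) (nm : X -> R).
Variables (I : X -> R) (dI : X -> X -> R).
Hypothesis H_lin : forall a u v, H u -> H v -> H (a *: u + v).
Hypothesis Em_sub : Em `<=` H.
Hypothesis Em0 : Em 0.
Hypothesis Em_lin : forall a u v, Em u -> Em v -> Em (a *: u + v).
Hypothesis nm_ge0 : forall u, 0 <= nm u.
Hypothesis nmZ : forall a u, H u -> nm (a *: u) = `|a| * nm u.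
Hypothesis nmD : forall u v, H u -> H v -> nm (u + v) <= nm u + nm v.
Hypothesis Em_complete : forall (w : nat -> X) (C : R), (forall n, Em (w n)) ->
  (forall n, nm (w n.+1 - w n) <= C / 2 ^+ n) ->
  exists2 z, Em z & (fun n => nm (w n - z)) @ \oo --> (0 : R).
Hypothesis dI_lin : forall u, H u -> forall a v w, H v -> H w ->
  dI u (a *: v + w) = a * dI u v + dI u w.
Hypothesis I_taylor : forall r, exists2 K, 0 < K & forall u v, H u -> H v ->
  nm u <= r -> nm v <= r -> `|I (u + v) - I u - dI u v| <= K * nm v ^+ 2.
Hypothesis dI_bound : forall r, exists2 K, 0 < K & forall u v, H u -> H v ->
  nm u <= r -> `|dI u v| <= K * nm v.
Hypothesis I_concave : exists2 k, 0 < k & forall y w1 w2, H y -> Em w1 -> Em w2 ->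
  2^-1 * (I (y + w1) + I (y + w2)) + k * nm (w1 - w2) ^+ 2
  <= I (y + 2^-1 *: (w1 + w2)).

Let H0 : H 0. Proof. exact: Em_sub. Qed.
Let HZ a u : H u -> H (a *: u).
Proof. by move=> Hu; rewrite -[_ *: _]addr0; exact: H_lin. Qed.
Let HD u v : H u -> H v -> H (u + v).
Proof. by move=> Hu Hv; rewrite -[u]scale1r; exact: H_lin. Qed.
Let HN u : H u -> H (- u).
Proof. by move=> Hu; rewrite -scaleN1r; exact: HZ. Qed.
Let HB u v : H u -> H v -> H (u - v).
Proof. by move=> Hu Hv; apply: HD => //; exact: HN. Qed.
Let EmZ a u : Em u -> Em (a *: u).
Proof. by move=> Hu; rewrite -[_ *: _]addr0; exact: Em_lin. Qed.
Let EmD u v : Em u -> Em v -> Em (u + v).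
Proof. by move=> Hu Hv; rewrite -[u]scale1r; exact: Em_lin. Qed.
Let nm0 : nm 0 = 0. Proof. by rewrite -(scale0r 0) nmZ// normr0 mul0r. Qed.
Let nmN u : H u -> nm (- u) = nm u.
Proof. by move=> Hu; rewrite -scaleN1r nmZ// normrN1 mul1r. Qed.
Let nmB u v : H u -> H v -> nm (u - v) <= nm u + nm v.
Proof. by move=> Hu Hv; rewrite -(nmN Hv); apply: nmD => //; exact: HN. Qed.
Let dIZ u a v : H u -> H v -> dI u (a *: v) = a * dI u v.
Proof.
move=> Hu Hv; have := dI_lin Hu a Hv H0; rewrite addr0 => ->.
have := dI_lin Hu 1 H0 H0.
by rewrite scale1r addr0 mul1r => /eqP; rewrite -subr_eq0 opprD addrA subrr sub0r oppr_eq0 => /eqP ->; rewrite addr0.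
Qed.
Let dID u v w : H u -> H v -> H w -> dI u (v + w) = dI u v + dI u w.
Proof. by move=> Hu Hv Hw; rewrite -[v in LHS]scale1r dI_lin// mul1r. Qed.

Lemma I_lipschitz r : exists2 K, 0 < K & forall u v, H u -> H v ->
  nm u <= r -> nm v <= r -> `|I v - I u| <= K * nm (v - u).
Proof.
have [K K0 hK] := I_taylor (`|r| + `|r|); have [K' K'0 hK'] := dI_bound r.
exists (K * (`|r| + `|r|) + K').
  by rewrite ltr_wpDl// mulr_ge0// ?addr_ge0// ltW.
move=> u v Hu Hv ur vr.
have rr : r <= `|r| by exact: ler_norm.
have h : nm (v - u) <= `|r| + `|r|.
  by rewrite (le_trans (nmB Hv Hu))// lerD// (le_trans _ rr).
have := hK u (v - u) Hu (HB Hv Hu).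
rewrite (addrC u) subrK => /(_ _ h)/= /(_ _)/le_trans - A.
have {A}A : `|I v - I u - dI u (v - u)| <= K * nm (v - u) ^+ 2.
  by apply: A => //; rewrite (le_trans ur)// (le_trans rr)// lerDl.
rewrite -[I v - I u](subrK (dI u (v - u))) (le_trans (ler_normD _ _))//.
rewrite mulrDl lerD//; last exact: hK' (HB _ _) _.
rewrite (le_trans A)// expr2 mulrA ler_wpM2r// ler_wpM2l//; exact: ltW.
Qed.

(** The midpoint of two nearly maximal points of the ball of Em beats their mean value
    by a multiple of the square of their distance, so a maximising sequence is
    Cauchy. *)
Lemma slice_max y d : H y -> 0 <= d ->
  exists z, [/\ Em z, nm z <= d &
    forall w, Em w -> nm w <= d -> I (y + w) <= I (y + z)].
Proof.
move=> Hy d0; have [k k0 conc] := I_concave.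
have [K K0 lip] := I_lipschitz (nm y + d).
have yw w : Em w -> nm w <= d -> nm (y + w) <= nm y + d.
  by move=> Ew wd; rewrite (le_trans (nmD Hy (Em_sub Ew)))// lerD.
pose S := [set I (y + w) | w in [set w | Em w /\ nm w <= d]].
have S0 : S !=set0 by exists (I (y + 0)); exists 0 => //; split => //; rewrite nm0.
have Sub : has_ubound S.
  exists (I y + K * d) => _ [w [Ew wd] <-].
  rewrite -lerBlDl (le_trans (ler_norm _))//.
  rewrite (le_trans (lip _ _ _ _ _ _))//.
  - by apply: HD => //; exact: Em_sub.
  - by rewrite lerDl.
  - exact: yw.
  - by rewrite addrC addKr ler_pM2l.
have Ssup : has_sup S by [].
pose M := sup S.
have MS w : Em w -> nm w <= d -> I (y + w) <= M.
  by move=> Ew wd; apply: ub_le_sup => //; exists w.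
have /choice[w hw] : forall n : nat, exists w, [/\ Em w, nm w <= d &
    M - k / 4 ^+ n <= I (y + w)].
  move=> n; have e0 : 0 < k / 4 ^+ n by rewrite divr_gt0// exprn_gt0.
  have [_ [w [Ew wd] <-] /ltW h] := sup_adherent e0 Ssup.
  by exists w.
have Ew n : Em (w n) by case: (hw n).
have wd n : nm (w n) <= d by case: (hw n).
have wM n : M - k / 4 ^+ n <= I (y + w n) by case: (hw n).
have cau n : nm (w n.+1 - w n) <= 1 / 2 ^+ n.
  have := conc y _ _ Hy (Ew n.+1) (Ew n).
  have mid : Em (2^-1 *: (w n.+1 + w n)) by apply: EmZ; exact: EmD.
  have midd : nm (2^-1 *: (w n.+1 + w n)) <= d.
    have Hs := HD (Em_sub (Ew n.+1)) (Em_sub (Ew n)).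
    have := nmD (Em_sub (Ew n.+1)) (Em_sub (Ew n)).
    rewrite nmZ//; have := wd n; have := wd n.+1.
    by rewrite ger0_norm ?invr_ge0//; lra.
  have := MS _ mid midd; have := wM n; have := wM n.+1.
  have -> : 4 ^+ n.+1 = 4 * 4 ^+ n :> R by rewrite exprS.
  rewrite invfM => h1 h2 h3 h4.
  have {h4}h : k * nm (w n.+1 - w n) ^+ 2 <= k / 4 ^+ n.
    have : 0 <= k / 4 ^+ n by rewrite divr_ge0// ?exprn_ge0// ltW.
    lra.
  rewrite div1r -[leLHS]ger0_norm// -[leRHS]ger0_norm ?invr_ge0 ?exprn_ge0//.
  rewrite -ler_sqr// ?nnegrE//.
  rewrite !real_normK ?num_real//; move: h; rewrite ler_pM2l// => h.
  rewrite (le_trans h)// exprVn lef_pV2 ?posrE ?exprn_gt0//.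
  by rewrite -exprM mulnC exprM lerXn2r ?nnegrE ?exprn_ge0// -natrX.
have [z Ez wz] := Em_complete Ew cau.
have zd : nm z <= d.
  apply/ler_addgt0Pl => e e0.
  have [n _ /(_ n (leqnn n))] : \forall n \near \oo, nm (w n - z) < e.
    have /cvgrPdist_lt/(_ e e0) := wz.
    by apply: filterS => n; rewrite sub0r normrN ger0_norm.
  move=> /ltW h; rewrite -[z](subKr (w n)) (le_trans (nmB _ _))//.
  - exact: Em_sub.
  - by apply: HB; exact: Em_sub.
  - by rewrite addrC lerD.
exists z; split => // v Ev vd; apply: (le_trans (MS _ Ev vd)).
apply/ler_addgt0Pl => e e0.
have : \forall n \near \oo, nm (w n - z) < e / 2 / K.
  have /cvgrPdist_lt/(_ (e / 2 / K) _) := wz.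
  have -> : 0 < e / 2 / K by rewrite !divr_gt0.
  move=> /(_ isT).
  by apply: filterS => n; rewrite sub0r normrN ger0_norm.
have : \forall n \near \oo, k / 4 ^+ n < e / 2.
  have : geometric k 4^-1 @ \oo --> (0:R).
    by apply: cvg_geometric; rewrite ger0_norm ?invr_ge0// invf_lt1// ltr1n.
  move=> /cvgrPdist_lt/(_ (e / 2) _); rewrite divr_gt0// => /(_ isT).
  apply: filterS => n; rewrite sub0r normrN /= exprVn; apply: le_lt_trans.
  exact: ler_norm.
move=> A B; near \oo => n.
have h1 : k / 4 ^+ n < e / 2 by near: n.
have : nm (w n - z) < e / 2 / K by near: n.
rewrite ltr_pdivlMr// => h2.
have := lip (y + z) (y + w n) (HD Hy (Em_sub Ez)) (HD Hy (Em_sub (Ew n)))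
  (yw _ Ez zd) (yw _ (Ew n) (wd n)).
rewrite opprD addrACA subrr add0r => h3.
have := le_trans (ler_norm _) h3; have := wM n; lra.
Unshelve. all: by end_near. Qed.

(** The maximum over a slice is a Lipschitz function of t, because the maximiser
    for one value of t competes in the slice of any other value. *)
Lemma box_max u tau d : H u -> 0 <= d -> 0 <= tau <= 1 ->
  exists t z, [/\ `|t - 1| <= tau, Em z, nm z <= d &
    forall s w, `|s - 1| <= tau -> Em w -> nm w <= d ->
      I (s *: u + w) <= I (t *: u + z)].
Proof.
move=> Hu d0 /andP[tau0 tau1].
have /choice[z hz] := fun t => slice_max (HZ t Hu) d0.
pose G t := I (t *: u + z t).
have Ez t : Em (z t) by case: (hz t).
have zd t : nm (z t) <= d by case: (hz t).
have zmax t w : Em w -> nm w <= d -> I (t *: u + w) <= G t.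
  by case: (hz t) => _ _; exact.
have [K K0 lip] := I_lipschitz (2 * nm u + d).
have bd t w : `|t - 1| <= tau -> Em w -> nm w <= d ->
    nm (t *: u + w) <= 2 * nm u + d.
  move=> /(fun h => le_trans h tau1); rewrite ler_distl => /andP[t0 t2] Ew wd.
  rewrite (le_trans (nmD (HZ _ Hu) (Em_sub Ew)))// lerD// nmZ//.
  by rewrite ler_wpM2r// ler_norml; apply/andP; split; lra.
have HtE t w : Em w -> H (t *: u + w) by move=> Ew; apply: H_lin => //; exact: Em_sub.
have Glip s t : `|s - 1| <= tau -> `|t - 1| <= tau ->
    G s <= G t + K * nm u * `|s - t|.
  move=> s1 t1; have := zmax t _ (Ez s) (zd s).
  have := lip (t *: u + z s) (s *: u + z s) (HtE _ _ (Ez s)) (HtE _ _ (Ez s))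
     (bd _ _ t1 (Ez s) (zd s)) (bd _ _ s1 (Ez s) (zd s)).
  rewrite opprD addrACA subrr addr0 -scalerBl nmZ// => h1 h2.
  have := le_trans (ler_norm _) h1; rewrite /G in h2 *.
  by move: h2; rewrite -/(G t) (mulrC `|_|) mulrA; lra.
have inI t : (t \in `[1 - tau, 1 + tau]) = (`|t - 1| <= tau).
  by rewrite in_itv/= ler_distl.
have Gc : {within `[1 - tau, 1 + tau], continuous G}.
  apply/subspace_continuousP => x /=; rewrite inI => x1.
  apply/cvgrPdist_lt => e e0.
  have K'0 : 0 < K * nm u + 1 by rewrite ltr_wpDl// mulr_ge0// ltW.
  near=> t.
  have t1 : `|t - 1| <= tau.
    by rewrite -inI; near: t; exact: withinT.
  have : `|x - t| < e / (K * nm u + 1).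
    near: t; apply: cvg_within.
    have /cvgrPdist_lt := @cvg_id _ (nbhs x); apply; exact: divr_gt0.
  rewrite ltr_pdivlMr// => h.
  have := Glip _ _ x1 t1; have := Glip _ _ t1 x1.
  rewrite (distrC t x) => h1 h2.
  apply: le_lt_trans h; rewrite mulrC.
  have := normr_ge0 (x - t).
  rewrite ler_norml mulrDl mul1r => h3.
  apply/andP; rewrite /from_subspace /=; split; lra.
have [|t] := EVT_max _ Gc; first by lra.
rewrite inI => t1 tmax; exists t, (z t); split => // s w s1 Ew wd.
by rewrite (le_trans (zmax _ _ Ew wd))// tmax// inI.
Unshelve. all: by end_near. Qed.

Lemma dI_eq0 m h s0 : H m -> H h -> 0 < s0 ->
  (forall s, `|s| <= s0 -> I (m + s *: h) <= I m) -> dI m h = 0.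
Proof.
move=> Hm Hh s00 hmax.
have [K K0 hK] := I_taylor (nm m + nm h).
have key s : `|s| <= s0 -> `|s| <= 1 -> s * dI m h <= `|s| * (`|s| * (K * nm h ^+ 2)).
  move=> ss0 s1.
  have : - (I (m + s *: h) - I m - dI m (s *: h)) <= K * (`|s| * nm h) ^+ 2.
    apply: le_trans (ler_norm _) _; rewrite normrN.
    have := hK m (s *: h) Hm (HZ _ Hh); rewrite lerDl nm_ge0 => /(_ isT).
    rewrite nmZ//; apply; rewrite (@le_trans _ _ (nm h))//.
      by rewrite ler_piMl.
    by rewrite lerDr.
  rewrite dIZ//; have := hmax _ ss0 => h1 h2.
  have -> : `|s| * (`|s| * (K * nm h ^+ 2)) = K * (`|s| * nm h) ^+ 2 by ring.
  lra.
apply/eqP; rewrite eq_le; apply/andP; split; apply/ler_addgt0Pl => e e0.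
  near (0 : R)^'+ => s.
  have s0' : 0 < s by near: s; exact: nbhs_right_gt.
  have ss0 : s <= s0 by near: s; exact: nbhs_right_le.
  have s1 : s <= 1 by near: s; exact: nbhs_right_le.
  have se : s * (K * nm h ^+ 2) < e by near: s; exact: near0_small.
  have := key s; rewrite gtr0_norm// => /(_ ss0 s1).
  by rewrite ler_pM2l// => h1; lra.
near (0 : R)^'+ => s.
have s0' : 0 < s by near: s; exact: nbhs_right_gt.
have ss0 : s <= s0 by near: s; exact: nbhs_right_le.
have s1 : s <= 1 by near: s; exact: nbhs_right_le.
have se : s * (K * nm h ^+ 2) < e by near: s; exact: near0_small.
have := key (- s); rewrite normrN gtr0_norm// => /(_ ss0 s1).
by rewrite mulNr -mulrN ler_pM2l// => h1; lra.
Unshelve. all: by end_near. Qed.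

(** Continuity of u |-> dI u v follows from the second order estimate alone: expand
    I at z and at u0, with increments h, w and w + h where w = z - u0 and h is a
    multiple of v of the size of w. *)
Lemma dI_lt0_near u0 v : H u0 -> H v -> dI u0 v < 0 ->
  exists2 d, 0 < d & forall z, H z -> nm (z - u0) <= d -> dI z v <= dI u0 v / 2.
Proof.
move=> Hu Hv v0; pose r := nm u0 + nm v + 2.
have [K K0 hK] := I_taylor r.
near (0 : R)^'+ => d.
have d0 : 0 < d by near: d; exact: nbhs_right_gt.
have d1 : d <= 1 by near: d; exact: nbhs_right_le.
have dK : d * (6 * K * (nm v + 1)) < - dI u0 v / 2.
  by near: d; apply: near0_small; lra.
exists d => // z Hz zd.
pose s := d / (nm v + 1).
have nv1 : 0 < nm v + 1 by rewrite ltr_wpDl.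
have s0 : 0 < s by rewrite divr_gt0.
have sv : s * nm v <= d.
  by rewrite /s mulrAC ler_pdivrMr// ler_pM2l// lerDl.
have Hw : H (z - u0) by exact: HB.
have Hh : H (s *: v) by exact: HZ.
have nh : nm (s *: v) <= d by rewrite nmZ// gtr0_norm.
have nwh : nm (z - u0 + s *: v) <= 2 * d.
  by rewrite (le_trans (nmD Hw Hh))// mulr_natl mulr2n lerD.
have nv0 : 0 <= nm v by [].
have nu0 : 0 <= nm u0 by [].
have nz : nm z <= r.
  rewrite -[z](subrK u0) (le_trans (nmD Hw Hu))// /r; lra.
have sq x y : 0 <= x -> x <= y -> K * x ^+ 2 <= K * y ^+ 2.
  by move=> x0 xy; rewrite ler_pM2l// ler_sqr ?nnegrE// (le_trans x0).
have e1 := le_trans (hK _ _ Hz Hh nz _) (sq _ _ (nm_ge0 _) nh).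
have e2 := le_trans (hK _ _ Hu (HD Hw Hh) _ _) (sq _ _ (nm_ge0 _) nwh).
have e3 := le_trans (hK _ _ Hu Hw _ _) (sq _ _ (nm_ge0 _) zd).
have {}e1 : `|I (z + s *: v) - I z - dI z (s *: v)| <= K * d ^+ 2.
  by apply: e1; rewrite /r; lra.
have {}e2 : `|I (u0 + (z - u0 + s *: v)) - I u0 - dI u0 (z - u0 + s *: v)|
    <= K * (2 * d) ^+ 2 by apply: e2; rewrite /r; lra.
have {}e3 : `|I (u0 + (z - u0)) - I u0 - dI u0 (z - u0)| <= K * d ^+ 2.
  by apply: e3; rewrite /r; lra.
move: e2 e3; rewrite addrA !(addrC u0) !subrK dID// !dIZ// => e2 e3.
move: e1; rewrite dIZ// => e1.
have {e1 e2 e3} : s * dI z v <= s * dI u0 v + 6 * K * d ^+ 2.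
  move: e1 e2 e3; rewrite !ler_norml => /andP[? ?] /andP[? ?] /andP[? ?].
  have -> : 6 * K * d ^+ 2 = K * d ^+ 2 + K * (2 * d) ^+ 2 + K * d ^+ 2 by ring.
  lra.
have -> : 6 * K * d ^+ 2 = s * (d * (6 * K * (nm v + 1))).
  by rewrite /s; field; rewrite gt_eqF.
by rewrite -mulrDr ler_pM2l//; lra.
Unshelve. all: by end_near. Qed.

(** Perturb u0 to u = u0 + e v and maximise I over the box of the points t u + w with
    |t - 1| <= tau, w in Em and nm w <= d.  On the sphere nm w = d, concavity puts I
    below I u0 by k d^2, up to a term of order tau; on the two faces |t - 1| = tau it
    is below I u0 by some eta.  These margins do not depend on e, and passing from u0
    to u changes I by O(e), so the maximum m is in the interior and I is critical at
    m along u and along Em, hence along m.  Finally m differs from t u0 + z, where I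
    is at most I u0, by t e v, and dI m v < 0 makes I m smaller. *)
Lemma natural_constraint u0 v rho : H u0 -> H v -> 0 < rho ->
  (forall t w, 0 < t -> Em w -> I (t *: u0 + w) <= I u0) ->
  (forall t w, 0 < t -> t != 1 -> Em w -> I (t *: u0 + w) < I u0) ->
  dI u0 v < 0 ->
  exists m, [/\ H m, nm (m - u0) <= rho, dI m m = 0,
    forall w, Em w -> dI m w = 0 & I m < I u0].
Proof.
move=> Hu Hv rho0 u0max u0smax v0.
have [k k0 conc] := I_concave.
have [d1 d10 dneg] := dI_lt0_near Hu Hv v0.
have nv0 := nm_ge0 v; have nu0 := nm_ge0 u0.
pose r := 2 * (nm u0 + nm v) + 1.
have [L L0 lip] := I_lipschitz r.
have [K K0 tay] := I_taylor r.
have nuv_r : nm u0 + nm v <= r by rewrite /r; lra.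
have nu0_r : nm u0 <= r by rewrite /r; lra.
have ar_ball (U A B C M b x y e : R) : A <= U ->
    2^-1 * (U + B) + b <= A -> C - B <= x -> x <= y * L -> y * L < b ->
    M <= C + L * (2 * e) -> U - L * e <= M -> L * e * 3 < b -> False.
  by move=> *; lra.
have ar_side (U C M e eta : R) : C <= U - eta -> M <= C + L * (2 * e) ->
    U - L * e <= M -> L * e * 3 < eta -> False.
  by move=> *; lra.
have ar_end (A B D x y a : R) : - (A - B - - x) <= y -> x <= a * (D / 2) ->
    y < a * (- D / 2) -> B < A.
  by move=> *; lra.
have ar_near (d x y : R) : x < d -> y * 2 < d -> x + d + 2 * y <= d * 3.
  by move=> *; lra.
have ar_t (a b c : R) : c <= b - a -> a + c <= b by move=> *; lra.
(* The constants are chosen in the order d, tau, eta, e, each small with respect to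
   the previous ones. *)
near (0 : R)^'+ => d.
have d0 : 0 < d by near: d; exact: nbhs_right_gt.
have d_1 : d <= 1 by near: d; exact: nbhs_right_le.
have dd1 : d * 3 < d1 by near: d; exact: near0_small.
have drho : d * 3 < rho by near: d; exact: near0_small.
have kd0 : 0 < k * d ^+ 2 by rewrite mulr_gt0// exprn_gt0.
near (0 : R)^'+ => tau.
have tau0 : 0 < tau by near: tau; exact: nbhs_right_gt.
have tau1 : tau * 2 < 1 by near: tau; exact: near0_small.
have taud : tau * nm u0 < d by near: tau; exact: near0_small.
have tauL : tau * (L * nm u0) < k * d ^+ 2 by near: tau; exact: near0_small.
have tau01 : 0 <= tau <= 1 by apply/andP; split; lra.
have [eta eta0 heta] : exists2 eta, 0 < eta & forall t w, `|t - 1| = tau ->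
    Em w -> nm w <= d -> I (t *: u0 + w) <= I u0 - eta.
  have [z1 [Ez1 z1d z1max]] := slice_max (HZ (1 + tau) Hu) (ltW d0).
  have [z2 [Ez2 z2d z2max]] := slice_max (HZ (1 - tau) Hu) (ltW d0).
  have A1 := u0smax (1 + tau) z1.
  have A2 := u0smax (1 - tau) z2.
  have {}A1 : I ((1 + tau) *: u0 + z1) < I u0.
    by apply: A1 => //; [lra|rewrite gt_eqF//; lra].
  have {}A2 : I ((1 - tau) *: u0 + z2) < I u0.
    by apply: A2 => //; [lra|rewrite lt_eqF//; lra].
  exists (Num.min (I u0 - I ((1 + tau) *: u0 + z1))
                  (I u0 - I ((1 - tau) *: u0 + z2))).
    by rewrite lt_min !subr_gt0 A1.
  move=> t w t1 Ew wd.
  have /orP[/eqP tE|/eqP tE] : (t == 1 + tau) || (t == 1 - tau).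
    have [h|h] := leP 0 (t - 1).
      by move: t1; rewrite ger0_norm// => t1; apply/orP; left; apply/eqP; lra.
    by move: t1; rewrite ltr0_norm// => t1; apply/orP; right; apply/eqP; lra.
  - have := z1max _ Ew wd; rewrite -tE => h; rewrite lerBrDl.
    have : Num.min (I u0 - I (t *: u0 + z1)) (I u0 - I ((1 - tau) *: u0 + z2))
      <= I u0 - I (t *: u0 + z1) by rewrite ge_min lexx.
    lra.
  - have := z2max _ Ew wd; rewrite -tE => h; rewrite lerBrDl.
    have : Num.min (I u0 - I ((1 + tau) *: u0 + z1)) (I u0 - I (t *: u0 + z2))
      <= I u0 - I (t *: u0 + z2) by rewrite ge_min lexx orbT.
    lra.
near (0 : R)^'+ => e.
have e0 : 0 < e by near: e; exact: nbhs_right_gt.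
have e1 : e <= 1 by near: e; exact: nbhs_right_le.
have ed : e * (2 * nm v) < d by near: e; exact: near0_small.
have ekd : e * (3 * L * nm v) < k * d ^+ 2 by near: e; exact: near0_small.
have eeta : e * (3 * L * nm v) < eta by near: e; exact: near0_small.
have eK : e * (2 * K * nm v ^+ 2) < - dI u0 v / 2.
  by near: e; apply: near0_small; lra.
pose u := u0 + e *: v.
have Hev : H (e *: v) by exact: HZ.
have Hu' : H u by exact: HD.
have nev : nm (e *: v) = e * nm v by rewrite nmZ// gtr0_norm.
have env : e * nm v <= nm v by rewrite ler_piMl.
have nu : nm u <= nm u0 + nm v.
  by rewrite (le_trans (nmD Hu Hev))// lerD2l nev.
have [t [z [t1 Ez zd tzmax]]] := box_max Hu' (ltW d0) tau01.
have Hz := Em_sub Ez.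
have [t_gt0 t_le2] : 0 < t /\ t <= 2.
  exact: distr1_bounds t1 tau1.
pose m := t *: u + z.
have mE : m = t *: u0 + z + (t * e) *: v.
  by rewrite /m /u scalerDr scalerA addrAC.
have Htz : H (t *: u0 + z) by exact: H_lin.
have Hm : H m by exact: H_lin.
have ntz : nm (t *: u0 + z) <= r.
  rewrite (le_trans (nmD (HZ _ Hu) Hz))// nmZ// gtr0_norm//.
  apply: lerD; last exact: le_trans zd d_1.
  by apply: ler_pM => //; [exact: ltW|rewrite lerDl].
have nmm : nm m <= r.
  rewrite (le_trans (nmD (HZ _ Hu') Hz))// nmZ// gtr0_norm//.
  apply: lerD; last exact: le_trans zd d_1.
  by apply: ler_pM => //; exact: ltW.
have nte : nm ((t * e) *: v) = t * (e * nm v).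
  by rewrite nmZ// gtr0_norm ?mulr_gt0// mulrA.
have te2 : t * (e * nm v) <= 2 * (e * nm v).
  by rewrite ler_wpM2r// mulr_ge0// ltW.
have Im_u0 : I m <= I (t *: u0 + z) + L * (2 * (e * nm v)).
  have := lip _ _ Htz Hm ntz nmm; rewrite {2}mE [_ + _ *: v]addrC addrK nte.
  move=> /(le_trans (ler_norm _)); rewrite lerBlDl => h.
  by rewrite (le_trans h)// lerD2l ler_pM2l.
have Im_ge : I u0 - L * (e * nm v) <= I m.
  have := tzmax 1 0; rewrite subrr normr0 nm0 scale1r addr0.
  move=> /(_ (ltW tau0) Em0 (ltW d0)); rewrite -/m => h.
  have := lip _ _ Hu' Hu (le_trans nu nuv_r) nu0_r.
  rewrite opprD addrA subrr add0r nmN// nev => /(le_trans (ler_norm _)) h2.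
  by rewrite (le_trans _ h)// lerBlDr -lerBlDl.
(* Otherwise concavity between 0 and z, with I at most I u0 at the midpoint, makes I
   too small at u0 + z, hence at m. *)
have znd : nm z < d.
  rewrite lt_neqAle zd andbT; apply/eqP => zdE.
  have := conc u0 0 z Hu Em0 Ez.
  rewrite sub0r nmN// zdE addr0 add0r.
  have := u0max 1 (2^-1 *: z) ltr01 (EmZ _ Ez).
  rewrite scale1r => h1 h2.
  have nuz : nm (u0 + z) <= r.
    rewrite (le_trans (nmD Hu Hz))//; apply: lerD; last exact: le_trans zd d_1.
    by rewrite mulr_natl mulr2n -addrA lerDl !addr_ge0.
  have := lip _ _ (HD Hu Hz) Htz nuz ntz.
  have -> : t *: u0 + z - (u0 + z) = (t - 1) *: u0.
    by rewrite opprD addrACA subrr addr0 scalerBl scale1r.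
  rewrite nmZ// => /(le_trans (ler_norm _)) h3.
  apply: (ar_ball _ _ _ _ _ _ _ (tau * nm u0) _ h1 h2 h3 _ _ Im_u0 Im_ge).
  - by rewrite (mulrC _ L) ler_pM2l// ler_wpM2r.
  - by rewrite -mulrA (mulrC _ L).
  - by apply: le_lt_trans ekd; rewrite le_eqVlt; apply/orP; left; apply/eqP; ring.
have tnd : `|t - 1| < tau.
  rewrite lt_neqAle t1 andbT; apply/eqP => tE.
  apply: (ar_side _ _ _ _ _ (heta _ _ tE Ez zd) Im_u0 Im_ge).
  by apply: le_lt_trans eeta; rewrite le_eqVlt; apply/orP; left; apply/eqP; ring.
have mu0 : nm (m - u0) <= d * 3.
  have -> : m - u0 = (t - 1) *: u0 + z + (t * e) *: v.
    by rewrite mE scalerBl scale1r addrAC; congr (_ + _); rewrite addrAC.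
  rewrite (le_trans (nmD (H_lin _ Hu Hz) (HZ _ Hv)))// nte.
  rewrite (@le_trans _ _ (tau * nm u0 + d + 2 * (e * nm v)))//.
    rewrite lerD// (le_trans (nmD (HZ _ Hu) Hz))// lerD// nmZ//.
    by rewrite ler_wpM2r.
  by apply: ar_near => //; rewrite -mulrA (mulrC (nm v)).
have dm_u : dI m u = 0.
  have s0 : 0 < tau - `|t - 1| by rewrite subr_gt0.
  apply: (dI_eq0 Hm Hu' s0) => s ss0.
  have -> : m + s *: u = (t + s) *: u + z by rewrite /m scalerDl addrAC.
  apply: tzmax => //; rewrite addrAC (le_trans (ler_normD _ _))//; exact: ar_t.
have dm_w w : Em w -> dI m w = 0.
  move=> Ew; have s0 : 0 < (d - nm z) / (nm w + 1).
    by rewrite divr_gt0 ?subr_gt0// ltr_wpDl.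
  apply: (dI_eq0 Hm (Em_sub Ew) s0) => s; rewrite ler_pdivlMr ?ltr_wpDl// => ss0.
  rewrite /m -addrA; apply: tzmax => //; first exact: EmD (EmZ _ _).
  rewrite (le_trans (nmD Hz (HZ _ (Em_sub Ew))))// nmZ; last exact: Em_sub.
  by apply: ar_t; rewrite (le_trans _ ss0)// ler_wpM2l// lerDl.
exists m; split => //.
- by rewrite (le_trans mu0)// ltW.
- by rewrite {2}/m dI_lin// dm_u dm_w// mulr0 addr0.
have dmv : dI m v <= dI u0 v / 2 by apply: dneg => //; rewrite (le_trans mu0)// ltW.
apply: lt_le_trans (u0max t z t_gt0 Ez).
have te0 : 0 < t * e by rewrite mulr_gt0.
have nte_r : nm (- (t * e) *: v) <= r.
  rewrite scaleNr nmN; last exact: HZ.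
  rewrite nte (le_trans te2)// /r -[leLHS]addr0 lerD// ler_wpM2l//.
  by rewrite (le_trans env)// lerDr.
have := tay _ _ Hm (HZ _ Hv) nmm nte_r.
rewrite {1}mE scaleNr addrK -scaleNr dIZ// mulNr -normrN => /(le_trans (ler_norm _)) h.
apply: (ar_end _ _ (dI u0 v) _ _ (t * e) h); first by rewrite ler_pM2l.
rewrite scaleNr nmN; last exact: HZ.
have -> : K * nm ((t * e) *: v) ^+ 2 = (t * e) * (t * (e * (K * nm v ^+ 2))).
  by rewrite nte; ring.
rewrite ltr_pM2l//; apply: le_lt_trans eK.
have -> : e * (2 * K * nm v ^+ 2) = 2 * (e * (K * nm v ^+ 2)) by ring.
by rewrite ler_wpM2r// !mulr_ge0// ?exprn_ge0// ltW.
Unshelve. all: by end_near. Qed.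

End natural_constraint.

(** * The nonlinearity at a fixed point *)

Section real_functions.
Variable R : realType.
Implicit Types (f df : R -> R).

Lemma mean_value f df : (forall x : R, is_derive x 1 f (df x)) ->
  forall a b, exists2 t, 0 < t < 1 & f b - f a = df (a + t * (b - a)) * (b - a).
Proof.
move=> dfE a b.
have cf (I : interval R) : {within [set` I], continuous f}.
  by apply: derivable_within_continuous => x _; case: (dfE x).
have half : (0 < 2^-1 :> R) && (2^-1 < 1 :> R) by apply/andP; split; lra.
have [ab|ba|->] := ltgtP a b; last by exists 2^-1 => //; rewrite !subrr !mulr0.
- have [c] := MVT ab (fun x _ => dfE x) (cf _); rewrite in_itv/= => /andP[ac cb] E.
  exists ((c - a) / (b - a)); last by rewrite divfK ?subr_eq0 ?gt_eqF// (addrC a) subrK.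
  by rewrite divr_gt0 ?subr_gt0//= ltr_pdivrMr ?subr_gt0// mul1r ltrD2r.
- have [c] := MVT ba (fun x _ => dfE x) (cf _); rewrite in_itv/= => /andP[bc ca] E.
  exists ((a - c) / (a - b)).
    by rewrite divr_gt0 ?subr_gt0//= ltr_pdivrMr ?subr_gt0// mul1r ltrD2l ltrN2.
  have -> : a + (a - c) / (a - b) * (b - a) = c.
    by field; rewrite subr_eq0 gt_eqF.
  by rewrite -[LHS]opprB E -mulrN opprB.
Qed.

(** Near s the oriented integral differs from the integral over [a, x], with a fixed
    below s and 0, by a constant. *)
Lemma is_derive_oriented_integral (g : R -> R) (s : R) : continuous g ->
  is_derive s 1 (fun s => if 0 <= s then \int[lebesgue_measure]_(t in `[0, s]) g t
    else - \int[lebesgue_measure]_(t in `[s, 0]) g t) (g s).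
Proof.
move=> cg.
have ig (a b : R) : (@lebesgue_measure R).-integrable `[a, b] (EFin \o g).
  apply: continuous_compact_integrable; first exact: segment_compact.
  exact: continuous_subspaceT.
pose a : R := - `|s| - 1.
have a0 : a < 0 by rewrite /a; have := normr_ge0 s; lra.
have as_ : a < s by rewrite /a; have := ler_norm (- s); rewrite normrN; lra.
pose F (x : R) : R := \int[lebesgue_measure]_(t in `[a, x]) g t.
have [dF F's] : derivable F s 1 /\ derive1 F s = g s.
  by apply: (@continuous_FTC1_closed _ g a s (s + 1)); [rewrite ltrDl|exact: ig| |exact: cg].
have H : is_derive s 1 (F \- cst (F 0)) (g s).
  have hF : is_derive s 1 F (g s) by rewrite -F's derive1E; exact: derivableP.
  by apply: is_derive_eq; rewrite subr0.
apply: near_eq_is_derive H.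
have : \forall x \near s, a < x by exact: lt_nbhsr.
apply: filterS => x ax /=; rewrite /F.
case: ifPn => x0.
  have [->|xN0] := eqVneq x 0; first by rewrite subrr set_itv1 Rintegral_set1.
  have xp : 0 < x by rewrite lt_neqAle eq_sym xN0.
  rewrite (@Rintegral_itvB _ g (BLeft a) (BRight x) 0)//; last first.
  - by rewrite ?bnd_simp ltW.
  rewrite Rintegral_itv_obnd_cbnd//.
  by apply: integrableS (ig 0 x) => //; exact: subset_itv_oc_cc.
move: x0; rewrite -ltNge => x0.
rewrite -opprB (@Rintegral_itvB _ g (BLeft a) (BRight 0) x)//; last 2 first.
- by rewrite bnd_simp ltW.
- by rewrite bnd_simp ltW.
rewrite Rintegral_itv_obnd_cbnd//.
by apply: integrableS (ig x 0) => //; exact: subset_itv_oc_cc.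
Qed.

End real_functions.

Section superlinear.
Variables (R : realType) (g : R -> R).
Hypothesis g_derivable : forall s : R, derivable g s 1.
Variables (C q : R).
Hypothesis C0 : 0 < C.
Hypothesis q0 : 0 <= q.
Hypothesis dg_growth : forall s, `|derive1 g s| <= C * (1 + `|s| `^ q).
Hypothesis g_small : forall e : R, 0 < e -> exists2 d : R, 0 < d &
  forall s, `|s| < d -> `|g s| <= e * `|s|.
Hypothesis g_ratio : forall s t : R, s < t -> t < 0 \/ 0 < s ->
  g s / `|s| < g t / `|t|.

Variable G : R -> R.
Hypothesis G_derive : forall s : R, is_derive s 1 G (g s).
Hypothesis G0 : G 0 = 0.

Let dg (s : R) : is_derive s 1 g (derive1 g s).
Proof. by rewrite derive1E; exact: derivableP. Qed.

Lemma nonlin0 : g 0 = 0.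
Proof.
have [d d0 h] := g_small ltr01.
by have := h 0; rewrite normr0 mulr0 normr_le0 => /(_ d0)/eqP.
Qed.

Lemma nonlin_ratio_gt0 (s : R) : 0 < s -> 0 < g s / `|s|.
Proof.
move=> s0; apply: (@le_lt_trans _ _ (g (s / 2) / `|s / 2|)); last first.
  by apply: g_ratio; [lra|right; lra].
apply/ler_addgt0Pl => e e0; have [d d0 h] := g_small e0.
pose t := Num.min (d / 2) (s / 4).
have t0 : 0 < t by rewrite lt_min; apply/andP; split; lra.
have td : t < d by rewrite gt_min; apply/orP; left; lra.
have ts : t < s / 2 by rewrite gt_min; apply/orP; right; lra.
have := h t; rewrite gtr0_norm// => /(_ td); rewrite ler_norml => /andP[h1 _].
have := g_ratio ts (or_intror t0); rewrite [`|t|]gtr0_norm// => h2.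
rewrite -lerBlDl sub0r; apply: le_trans (ltW h2).
by rewrite ler_pdivlMr// mulNr.
Qed.

Lemma nonlin_ratio_lt0 (s : R) : s < 0 -> g s / `|s| < 0.
Proof.
move=> s0; apply: (@lt_le_trans _ _ (g (s / 2) / `|s / 2|)).
  by apply: g_ratio; [lra|left; lra].
apply/ler_addgt0Pl => e e0; have [d d0 h] := g_small e0.
pose t := Num.max (- (d / 2)) (s / 4).
have t0 : t < 0 by rewrite gt_max; apply/andP; split; lra.
have td : - d < t by rewrite lt_max; apply/orP; left; lra.
have ts : s / 2 < t by rewrite lt_max; apply/orP; right; lra.
have := h t; rewrite ltr0_norm// ltrNl => /(_ td); rewrite ler_norml => /andP[_ h1].
have := g_ratio ts (or_introl t0); rewrite [`|t|]ltr0_norm// => h2.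
by rewrite addr0; apply: le_trans (ltW h2) _; rewrite ler_pdivrMr ?oppr_gt0.
Qed.

Lemma nonlin_sign (s : R) : s != 0 -> 0 < g s * s.
Proof.
move=> s0; have gE : g s = g s / `|s| * `|s| by rewrite divfK// normr_eq0.
have [sl|sg|/eqP] := ltgtP s 0; last by rewrite (negbTE s0).
- rewrite nmulr_lgt0// gE pmulr_llt0 ?normr_gt0//; exact: nonlin_ratio_lt0.
- rewrite pmulr_lgt0// gE mulr_gt0 ?normr_gt0//; exact: nonlin_ratio_gt0.
Qed.

Lemma nonlin_incr (s t : R) : s < t -> g s < g t.
Proof.
move=> st.
have gE (u : R) : u != 0 -> g u = g u / `|u| * `|u| by move=> u0; rewrite divfK// normr_eq0.
have pos (u : R) : 0 < u -> 0 < g u.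
  by move=> u0; have := @nonlin_sign u; rewrite gt_eqF// pmulr_lgt0// => /(_ isT).
have neg (u : R) : u < 0 -> g u < 0.
  by move=> u0; have := @nonlin_sign u; rewrite lt_eqF// nmulr_lgt0// => /(_ isT).
have [s0|s0|s0] := ltgtP s 0.
- have [t0|t0|t0] := ltgtP t 0.
  + rewrite (gE s) ?lt_eqF// (gE t) ?lt_eqF//.
    have rs := nonlin_ratio_lt0 s0; have rt := nonlin_ratio_lt0 t0.
    have rst := g_ratio st (or_introl t0).
    apply: (@lt_le_trans _ _ (g t / `|t| * `|s|)).
      by rewrite ltr_pM2r// normr_gt0 lt_eqF.
    by rewrite ler_nM2l// !ltr0_norm// lerN2 ltW.
  + exact: lt_trans (neg _ s0) (pos _ t0).
  + by rewrite t0 nonlin0; exact: neg.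
- have t0 : 0 < t by exact: lt_trans st.
  rewrite (gE s) ?gt_eqF// (gE t) ?gt_eqF//.
  have rs := nonlin_ratio_gt0 s0; have rt := nonlin_ratio_gt0 t0.
  have rst := g_ratio st (or_intror s0).
  apply: (@lt_le_trans _ _ (g t / `|t| * `|s|)).
    by rewrite ltr_pM2r// normr_gt0 gt_eqF.
  by rewrite ler_pM2l// !gtr0_norm// ltW.
- by rewrite s0 nonlin0; apply: pos; rewrite -s0.
Qed.

Lemma nonlin_mono (s t : R) : s <= t -> g s <= g t.
Proof. by rewrite le_eqVlt => /predU1P[->//|/nonlin_incr/ltW]. Qed.

Lemma nonlin_monoM (s t : R) : 0 <= (g t - g s) * (t - s).
Proof.
have [st|/ltW ts] := leP s t.
  by rewrite mulr_ge0// subr_ge0// nonlin_mono.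
by rewrite mulr_le0// subr_le0// nonlin_mono.
Qed.

Lemma nonlin_lipschitz (s r : R) : `|g (s + r) - g s| <= C * (1 + (`|s| + `|r|) `^ q) * `|r|.
Proof.
have [t /andP[t0 t1] ->] := mean_value dg s (s + r).
rewrite normrM [s + r]addrC addrK ler_wpM2r//.
rewrite (le_trans (dg_growth _))// ler_pM2l// lerD2l.
rewrite ge0_ler_powR ?nnegrE ?addr_ge0//.
rewrite (le_trans (ler_normD _ _))// lerD2l normrM ler_piMl// gtr0_norm//; exact: ltW.
Qed.

Lemma nonlin_growth (s : R) : `|g s| <= C * (1 + `|s| `^ q) * `|s|.
Proof. by have := nonlin_lipschitz 0 s; rewrite add0r nonlin0 subr0 normr0 add0r. Qed.

(** By the mean value theorem the remainder is an increment of g times r: monotonicity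
    of g gives its sign, the growth of g' its size. *)
Lemma primitive_taylor (s r : R) :
  0 <= G (s + r) - G s - g s * r <= C * (1 + (`|s| + `|r|) `^ q) * r ^+ 2.
Proof.
have [t /andP[t0 t1]] := mean_value G_derive s (s + r).
rewrite [s + r - s]addrC addKr => ->; rewrite -mulrBl.
have tr : `|t * r| <= `|r| by rewrite normrM ler_piMl// gtr0_norm// ltW.
apply/andP; split.
  have := nonlin_monoM s (s + t * r); rewrite addrAC subrr add0r mulrCA.
  by rewrite pmulr_rge0.
rewrite (le_trans (ler_norm _))// normrM expr2 -[r * r]ger0_norm; last first.
  by rewrite -expr2 sqr_ge0.
rewrite normrM mulrA ler_wpM2r// (le_trans (nonlin_lipschitz _ _))// ler_pM//.
- by rewrite mulr_ge0 ?ltW// addr_ge0 ?powR_ge0.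
- rewrite ler_pM2l// lerD2l ge0_ler_powR ?nnegrE ?addr_ge0//.
  by rewrite lerD2l.
Qed.

Lemma primitive_convex (a b : R) : G (2^-1 * (a + b)) <= 2^-1 * (G a + G b).
Proof.
have /andP[h1 _] := primitive_taylor (2^-1 * (a + b)) (2^-1 * (a - b)).
have /andP[h2 _] := primitive_taylor (2^-1 * (a + b)) (2^-1 * (b - a)).
move: h1 h2.
have -> : 2^-1 * (a + b) + 2^-1 * (a - b) = a by field.
have -> : 2^-1 * (a + b) + 2^-1 * (b - a) = b by field.
set A := g _; set B := G _; lra.
Qed.

Lemma primitive_bounds (s : R) : 0 <= G s <= C * (1 + `|s| `^ q) * s ^+ 2.
Proof.
by have := primitive_taylor 0 s; rewrite add0r nonlin0 G0 mul0r !subr0 normr0 add0r.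
Qed.

(** On the half-line of the numbers with the sign of u, the derivative of
    x |-> (g u / u) x^2 / 2 - G x is |x| (g u / |u| - g x / |x|), which changes sign
    exactly at u because g x / |x| increases. *)
Lemma fibre_primitive_lt (u z : R) : u != 0 -> 0 <= u * z -> z != u ->
  g u / u * z ^+ 2 / 2 - G z < g u / u * u ^+ 2 / 2 - G u.
Proof.
move=> u0 uz zu.
pose k (x : R) : R := g u / u * x ^+ 2 / 2 - G x.
have dk (x : R) : is_derive x 1 k (g u / u * x - g x).
  suff : is_derive x 1 ((g u / u / 2) \*: (@id R ^+ 2) - G) (g u / u * x - g x).
    rewrite (_ : _ - _ = k)//; apply/funext => y.
    by transitivity (g u / u / 2 * y ^+ 2 - G y) => //; rewrite /k; field.
  apply: is_derive_eq.
  by rewrite /GRing.scale/= expr1 mulr1; field.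
have [t /andP[t0 t1] kE] := mean_value dk u z.
pose c := u + t * (z - u).
rewrite -subr_lt0 -/(k z) -/(k u) kE -/c -(pmulr_rlt0 _ t0) mulrCA.
have -> : t * (z - u) = c - u by rewrite /c addrAC subrr add0r.
have uc : 0 < u * c.
  have -> : u * c = (1 - t) * u ^+ 2 + t * (u * z) by rewrite /c; ring.
  apply: ltr_wpDr; first by rewrite mulr_ge0// ltW.
  by rewrite mulr_gt0 ?subr_gt0// exprn_even_gt0.
have c0 : c != 0 by apply: contraTneq uc => ->; rewrite mulr0 ltxx.
have cu : c != u.
  rewrite -subr_eq0 /c addrAC subrr add0r mulf_neq0//; first by rewrite gt_eqF.
  by rewrite subr_eq0.
have -> : g u / u * c - g c = `|c| * (g u / `|u| - g c / `|c|).
  have cE : `|c| * (g c / `|c|) = g c by rewrite mulrC divfK ?normr_eq0.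
  rewrite mulrBr cE; congr (_ - _).
  have [up|un] := ltP 0 u.
    have cp : 0 < c by rewrite -(pmulr_rgt0 _ up).
    by rewrite (gtr0_norm cp) (gtr0_norm up) mulrC.
  have {}un : u < 0 by rewrite lt_neqAle u0.
  have cn : c < 0 by rewrite -(nmulr_rgt0 _ un).
  by rewrite (ltr0_norm cn) (ltr0_norm un) invrN mulrN mulNr mulrN opprK mulrC.
rewrite -mulrA pmulr_rlt0 ?normr_gt0//.
have sgn : c < 0 /\ u < 0 \/ 0 < c /\ 0 < u.
  have [up|un] := ltP 0 u; [right|left].
    by split => //; rewrite -(pmulr_rgt0 _ up).
  have {}un : u < 0 by rewrite lt_neqAle u0.
  by split => //; rewrite -(nmulr_rgt0 _ un).
have [cu'|uc'|/eqP] := ltgtP c u; last by rewrite (negbTE cu).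
- rewrite nmulr_llt0 ?subr_lt0// subr_gt0; apply: g_ratio => //.
  by case: sgn => -[]; [left|right].
- rewrite pmulr_llt0 ?subr_gt0// subr_lt0; apply: g_ratio => //.
  by case: sgn => -[]; [left|right].
Qed.

Lemma primitive_le_half (s : R) : 2 * G s <= g s * s.
Proof.
have [->|s0] := eqVneq s 0; first by rewrite G0 !mulr0.
have := @fibre_primitive_lt s 0 s0; rewrite mulr0 lexx eq_sym s0 G0.
move=> /(_ isT isT); rewrite expr0n/= mulr0 mul0r subrr.
have -> : g s / s * s ^+ 2 / 2 = g s * s / 2 by field.
lra.
Qed.

(** The pointwise inequality of Szulkin and Weth.  If s z >= 0, the left hand side is
    the difference estimated in fibre_primitive_lt minus (g s / s) (z - t s)^2 / 2, and
    the two terms do not vanish together since t <> 1.  If s z < 0, then g s * z < 0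
    and primitive_le_half concludes. *)
Lemma fibre_lt (s t z : R) : s != 0 -> 0 < t -> t != 1 ->
  g s * (t * z - (t ^+ 2 + 1) / 2 * s) + G s - G z < 0.
Proof.
move=> s0 t0 t1.
have gs := nonlin_sign s0.
have [sz|zs] := leP 0 (s * z); last first.
  have : g s * z * t < 0.
    rewrite pmulr_llt0// -(pmulr_rlt0 _ gs).
    have -> : g s * s * (g s * z) = g s ^+ 2 * (s * z) by ring.
    rewrite pmulr_rlt0// exprn_even_gt0//=.
    by apply: contraTneq gs => ->; rewrite mul0r ltxx.
  have := primitive_le_half s; have /andP[Gz _] := primitive_bounds z.
  have : 0 < t ^+ 2 * (g s * s) by rewrite mulr_gt0// exprn_gt0.
  have -> : g s * (t * z - (t ^+ 2 + 1) / 2 * s) =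
    g s * z * t - 2^-1 * (t ^+ 2 * (g s * s)) - 2^-1 * (g s * s) by field.
  lra.
have r0 : 0 < g s / s.
  by rewrite -(pmulr_lgt0 _ (_ : 0 < s ^+ 2)) ?exprn_even_gt0// expr2 mulrA divfK.
have -> : g s * (t * z - (t ^+ 2 + 1) / 2 * s) =
    g s / s * z ^+ 2 / 2 - g s / s * s ^+ 2 / 2 - (g s / s) * (z - t * s) ^+ 2 / 2.
  by field.
have sq : 0 <= (g s / s) * (z - t * s) ^+ 2 by rewrite mulr_ge0 ?sqr_ge0// ltW.
have [zsE|zs] := eqVneq z s; last first.
  by have := fibre_primitive_lt s0 sz zs; lra.
have : 0 < (g s / s) * (z - t * s) ^+ 2.
  rewrite mulr_gt0// exprn_even_gt0//= zsE -{1}[s]mul1r -mulrBl mulf_neq0//.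
  by rewrite subr_eq0 eq_sym.
by rewrite zsE; lra.
Qed.

Lemma fibre_le (s t z : R) : 0 < t ->
  g s * (t * z - (t ^+ 2 + 1) / 2 * s) + G s - G z <= 0.
Proof.
move=> t0.
have [->|s0] := eqVneq s 0.
  by rewrite nonlin0 G0 mul0r !add0r oppr_le0; case/andP: (primitive_bounds z).
have [->|t1] := eqVneq t 1; last exact/ltW/fibre_lt.
have -> : g s * (1 * z - (1 ^+ 2 + 1) / 2 * s) = g s * (z - s) by field.
have /andP[h _] := primitive_taylor s (z - s).
by move: h; rewrite (addrC s) subrK; lra.
Qed.

End superlinear.

(** * Square integrable functions *)

Section square_integrable.
Context d (T : measurableType d) (R : realType) (mu : {measure set T -> \bar R}).
Implicit Types (f g h : T -> R).

Definition intg f := mu.-integrable setT (EFin \o f).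
Definition sqint f := f \in Lfun mu 2%:E.

Lemma eq_intg f g : f =1 g -> intg f -> intg g.
Proof. by move=> /funext ->. Qed.

Lemma eq_sqint f g : f =1 g -> sqint f -> sqint g.
Proof. by move=> /funext ->. Qed.

Lemma intg_measurable f : intg f -> measurable_fun setT f.
Proof. by move=> /(measurable_int mu)/measurable_EFinP. Qed.

Lemma intgD f g : intg f -> intg g -> intg (fun x => f x + g x).
Proof. by move=> If Ig; exact: (integrableD measurableT If Ig). Qed.

Lemma intgZ a f : intg f -> intg (fun x => a * f x).
Proof. by move=> If; exact: (integrableZl measurableT a If). Qed.

Lemma intgB f g : intg f -> intg g -> intg (fun x => f x - g x).
Proof. by move=> If Ig; exact: (integrableB measurableT If Ig). Qed.

Lemma intg_norm f : intg f -> intg (fun x => `|f x|).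
Proof. by move=> If; exact: (integrable_abse If). Qed.

Lemma intg_le f g : measurable_fun setT f -> intg g ->
  (forall x, `|f x| <= g x) -> intg f.
Proof.
move=> mf Ig fg; apply: (le_integrable measurableT _ _ Ig) => //; first exact/measurable_EFinP.
by move=> x _ /=; rewrite lee_fin (le_trans (fg x))// ler_norm.
Qed.

Lemma intg_sum (I : Type) (s : seq I) (F : I -> T -> R) :
  (forall i, intg (F i)) -> intg (fun x => \sum_(i <- s) F i x).
Proof.
move=> IF; elim: s => [|i s IHs].
  by under eq_fun do rewrite big_nil; exact: integrable0.
by under eq_fun do rewrite big_cons; exact: intgD.
Qed.

Lemma RintgD f g : intg f -> intg g ->
  \int[mu]_x (f x + g x) = \int[mu]_x f x + \int[mu]_x g x.
Proof. exact: RintegralD. Qed.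

Lemma RintgB f g : intg f -> intg g ->
  \int[mu]_x (f x - g x) = \int[mu]_x f x - \int[mu]_x g x.
Proof. exact: RintegralB. Qed.

Lemma RintgZ a f : intg f -> \int[mu]_x (a * f x) = a * \int[mu]_x f x.
Proof. exact: RintegralZl. Qed.

Lemma Rintg_le f g : intg f -> intg g -> (forall x, f x <= g x) ->
  \int[mu]_x f x <= \int[mu]_x g x.
Proof. by move=> If Ig fg; apply: le_Rintegral. Qed.

Lemma Rintg_norm f : intg f -> `|\int[mu]_x f x| <= \int[mu]_x `|f x|.
Proof. exact: le_normr_Rintegral. Qed.

Lemma intgE f : intg f -> (\int[mu]_x (f x)%:E)%E = (\int[mu]_x f x)%:E.
Proof. by move=> If; rewrite /Rintegral fineK//; exact: integrable_fin_num. Qed.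

Lemma Rintg_sum (I : Type) (s : seq I) (F : I -> T -> R) :
  (forall i, intg (F i)) ->
  \int[mu]_x (\sum_(i <- s) F i x) = \sum_(i <- s) \int[mu]_x F i x.
Proof.
move=> IF; elim: s => [|i s IHs].
  rewrite big_nil; under eq_Rintegral do rewrite big_nil.
  by rewrite /Rintegral integral0.
rewrite big_cons -IHs -RintgD//; last exact: intg_sum.
by under eq_Rintegral do rewrite big_cons.
Qed.

Lemma Rintg_ae f g : measurable_fun setT f -> measurable_fun setT g ->
  f = g %[ae mu] -> \int[mu]_x f x = \int[mu]_x g x.
Proof.
move=> mf mg fg; rewrite /Rintegral; congr fine.
apply: ae_eq_integral => //; [exact/measurable_EFinP|exact/measurable_EFinP|].
by apply: filterS fg => x /= h /h ->.
Qed.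

Lemma Rintg_eq0_ae f : intg f -> (forall x, 0 <= f x) -> \int[mu]_x f x = 0 ->
  f = cst 0 %[ae mu].
Proof.
move=> If f0 If0.
have : (\int[mu]_x `|(EFin \o f) x|)%E = 0%E.
  by under eq_integral do rewrite gee0_abs ?lee_fin//; rewrite intgE// If0.
move/(ae_eq_integral_abs _ measurableT (measurable_int _ If)).
by apply: filterS => x /= /(_ I)[->].
Qed.

Lemma sqintP f : sqint f <-> measurable_fun setT f /\ intg (fun x => f x ^+ 2).
Proof.
split=> [sf|[mf If]].
  split; last exact: Lfun2_integrable_sqr.
  by move: sf; rewrite /sqint inE => /andP[/[!inE]].
rewrite /sqint inE; apply/andP; split; rewrite inE//=.
rewrite /finite_norm unlock; apply: poweR_lty.
move: If => /integrableP[_]; apply: le_lt_trans.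
rewrite le_eqVlt; apply/orP; left; apply/eqP; apply: eq_integral => x _ /=.
by rewrite powR_mulrn// real_normK ?num_real// ger0_norm ?sqr_ge0.
Qed.

Lemma sqint_measurable f : sqint f -> measurable_fun setT f.
Proof. by case/sqintP. Qed.

Lemma sqint_sqr f : sqint f -> intg (fun x => f x ^+ 2).
Proof. by case/sqintP. Qed.

Lemma sqint_mul f g : sqint f -> sqint g -> intg (fun x => f x * g x).
Proof. by move=> sf sg; apply/Lfun1_integrable; exact: Lfun2_mul_Lfun1. Qed.

Lemma sqint_le f g : measurable_fun setT f -> sqint g ->
  (forall x, `|f x| <= `|g x|) -> sqint f.
Proof.
move=> mf /sqint_sqr Ig fg; apply/sqintP; split => //.
apply: intg_le Ig _; first exact: measurable_funX.
by move=> x; rewrite normrX -[leRHS]real_normK ?num_real// lerXn2r ?nnegrE.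
Qed.

Lemma sqint_lin a f g : sqint f -> sqint g -> sqint (fun x => a * f x + g x).
Proof.
move=> sf sg; have [mf If] := (sqintP f).1 sf; have [mg Ig] := (sqintP g).1 sg.
have mh : measurable_fun setT (fun x => a * f x + g x).
  by apply: measurable_funD => //; exact: measurable_funM.
apply/sqintP; split => //.
apply: (@intg_le _ (fun x => 2 * a ^+ 2 * f x ^+ 2 + 2 * g x ^+ 2)).
- exact: measurable_funX.
- by apply: intgD; exact: intgZ.
- move=> x; rewrite ger0_norm ?sqr_ge0// -subr_ge0.
  have -> : 2 * a ^+ 2 * f x ^+ 2 + 2 * g x ^+ 2 - (a * f x + g x) ^+ 2 =
    (a * f x - g x) ^+ 2 by ring.
  exact: sqr_ge0.
Qed.

Lemma sqint0 : sqint (cst 0).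
Proof.
apply/sqintP; split => //; rewrite /intg /=.
by under eq_fun do rewrite expr0n/=; exact: integrable0.
Qed.

Lemma sqintZ a f : sqint f -> sqint (fun x => a * f x).
Proof.
move=> sf; have := sqint_lin a sf sqint0.
by apply: eq_sqint => x /=; rewrite addr0.
Qed.

Lemma sqintB f g : sqint f -> sqint g -> sqint (fun x => f x - g x).
Proof.
move=> sf sg; have := sqint_lin (- 1) sg sf.
by apply: eq_sqint => x /=; rewrite mulN1r addrC.
Qed.

(** The sum of the t_n = 2^n (w_(n+1) - w_n)^2 is integrable, hence finite almost everywhere,
    and where it equals S the sequence satisfies |w_m - w_n|^2 <= 2 S / 2^n for m >= n.
    The limit is taken on that set and extended by 0. *)
Lemma riesz_fischer (w : nat -> T -> R) (C : R) : (forall n, sqint (w n)) ->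
  (forall n, \int[mu]_x ((w n.+1 x - w n x) ^+ 2) <= C / 4 ^+ n) ->
  exists z, [/\ sqint z,
    (fun n => \int[mu]_x ((w n x - z x) ^+ 2)) @ \oo --> (0 : R) &
    {ae mu, forall x, (fun n => w n x) @ \oo --> z x}].
Proof.
move=> sw wC.
have sd n : sqint (fun x => w n.+1 x - w n x) by exact: sqintB.
pose t n x : R := 2 ^+ n * (w n.+1 x - w n x) ^+ 2.
have t0 n x : 0 <= t n x by rewrite /t mulr_ge0 ?sqr_ge0 ?exprn_ge0.
have It n : intg (t n) by apply: intgZ; exact: sqint_sqr (sd n).
pose S x : \bar R := (\sum_(n <oo) (t n x)%:E)%E.
have mS : measurable_fun setT S.
  apply: ge0_emeasurable_sum => n; first by move=> x _ _; rewrite lee_fin.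
  by move=> _; apply/measurable_EFinP; exact: intg_measurable.
have S0 x : (0 <= S x)%E by apply: nneseries_ge0 => n _ _; rewrite lee_fin.
have C0 : 0 <= C.
  rewrite -[C]divr1 -(expr0 4); apply: le_trans (wC 0%N).
  by apply: Rintegral_ge0 => x _; exact: sqr_ge0.
have IS : (\int[mu]_x S x < +oo)%E.
  rewrite integral_nneseries//; last 2 first.
  - by move=> n; apply/measurable_EFinP; exact: intg_measurable.
  - by move=> n x _; rewrite lee_fin.
  apply: (@le_lt_trans _ _ (\sum_(n <oo) ((geometric C 2^-1) n)%:E)%E).
    apply: lee_nneseries => [n _|n _].
      by move=> _; apply: integral_ge0 => x _; rewrite lee_fin.
    rewrite intgE// lee_fin RintgZ; last exact: sqint_sqr (sd n).
    rewrite /geometric/= exprVn.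
    have -> : (2 : R) ^- n = 2 ^+ n / 4 ^+ n.
      have -> : (4 : R) = 2 * 2 by ring.
      by rewrite exprMn; field; rewrite expf_neq0.
    by rewrite mulrCA ler_wpM2l ?exprn_ge0// -mulrA.
  rewrite (_ : (\sum_(_ <oo) _)%E = (C * (1 - 2^-1)^-1)%:E) ?ltry//.
  apply/cvg_lim => //; rewrite -[X in X @ _](_ : EFin \o series (geometric C 2^-1) = _).
    apply: cvg_EFin; first by near=> n.
    by apply: cvg_geometric_series; rewrite ger0_norm ?invr_ge0// invf_lt1// ltr1n.
  by apply/funext => n /=; rewrite sumEFin.
have iS : mu.-integrable setT S.
  apply/integrableP; split => //.
  by under eq_integral do rewrite gee0_abs//.
pose E := [set x | S x \is a fin_num].
have mE : measurable E.
  by rewrite -[E]setTI; exact: emeasurable_fin_num.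
have aeE : {ae mu, forall x, E x}.
  by apply: filterS (integrable_ae measurableT iS) => x /(_ I).
pose Sr x := fine (S x).
have Sr0 x : 0 <= Sr x by rewrite fine_ge0.
have ISr : intg Sr.
  apply: (le_integrable measurableT _ _ iS).
    by apply/measurable_EFinP; exact: measurableT_comp.
  by move=> x _ /=; rewrite /Sr; case: (S x) => [r| |] //=; rewrite normr0 leey.
pose v n := (w n) \_ E.
have vE n x : E x -> v n x = w n x by move=> Ex; rewrite /v patchE mem_set.
have vNE n x : ~ E x -> v n x = 0 by move=> Ex; rewrite /v patchE memNset.
have wbd n k x : (w (n + k)%N x - w n x) ^+ 2 <=
    2 / 2 ^+ n * \sum_(n <= i < n + k) t i x.
  elim: k n => [|k IHk] n.
    by rewrite addn0 subrr expr0n/= big_geq// mulr0.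
  have h2n : (2 : R) ^+ n != 0 by rewrite expf_neq0.
  rewrite addnS -addSn big_ltn; last by rewrite addSn ltnS leq_addr.
  have := IHk n.+1; set D := \sum_(_ <= _ < _) _; rewrite (exprS 2 n) => h.
  have -> : w (n.+1 + k)%N x - w n x =
     (w n.+1 x - w n x) + (w (n.+1 + k)%N x - w n.+1 x) by ring.
  set a := (w n.+1 x - w n x); set b := (_ - w n.+1 x) in h *.
  apply: (@le_trans _ _ (2 * a ^+ 2 + 2 * b ^+ 2)).
    rewrite -subr_ge0; have -> : 2 * a ^+ 2 + 2 * b ^+ 2 - (a + b) ^+ 2 = (a - b) ^+ 2.
      by ring.
    exact: sqr_ge0.
  have -> : 2 / 2 ^+ n * (t n x + D) = 2 * a ^+ 2 + 2 * (2 / (2 * 2 ^+ n) * D).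
    by rewrite /t -/a; field.
  by rewrite lerD2l ler_pM2l.
have vbd n k x : (v (n + k)%N x - v n x) ^+ 2 <= 2 / 2 ^+ n * Sr x.
  have c0 : 0 <= 2 / 2 ^+ n :> R by rewrite divr_ge0// exprn_ge0.
  have [Ex|Ex] := pselect (E x); last first.
    by rewrite !vNE// subrr expr0n/= mulr_ge0.
  rewrite !vE// (le_trans (wbd n k x))// ler_wpM2l// -lee_fin fineK//.
  rewrite -sumEFin; apply: (@le_trans _ _ (\sum_(0 <= i < n + k) (t i x)%:E)%E).
    rewrite [leRHS](@big_cat_nat _ _ _ n)//= ?leq_addr// leeDr//.
    by apply: sume_ge0 => i _; rewrite lee_fin.
  by apply: nneseries_lim_ge => i _; rewrite lee_fin.
have cvgv x : cvgn (v ^~ x).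
  apply/cauchy_cvgP/cauchy_exP => e e0.
  have [n nS] : exists n, 2 / 2 ^+ n * Sr x < e ^+ 2.
    have : (geometric (2 * Sr x) 2^-1) @ \oo --> (0 : R).
      by apply: cvg_geometric; rewrite ger0_norm ?invr_ge0// invf_lt1// ltr1n.
    move=> /cvgrPdist_lt/(_ (e ^+ 2) (exprn_gt0 _ e0))[n _ /(_ n (leqnn n))].
    rewrite sub0r normrN /= exprVn => h; exists n; apply: le_lt_trans h.
    by rewrite mulrAC ler_norm.
  exists (v n x); exists n => // m /= nm.
  rewrite /ball/= distrC -(@ltr_pXn2r _ 2)// ?nnegrE ?ltW//.
  rewrite real_normK ?num_real// (le_lt_trans _ nS)//.
  by rewrite -(subnKC nm).
pose z x := limn (v ^~ x).
have vz x : v ^~ x @ \oo --> z x by exact: cvgv.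
have mv n : measurable_fun setT (v n).
  by apply/(measurable_restrictT _ mE)/measurable_funTS; exact: sqint_measurable.
have mz : measurable_fun setT z.
  exact: (measurable_fun_cvg mv (fun x _ => vz x)).
have zbd n x : (v n x - z x) ^+ 2 <= 2 / 2 ^+ n * Sr x.
  have : (fun k => (v (n + k)%N x - v n x) ^+ 2) @ \oo --> (z x - v n x) ^+ 2.
    rewrite expr2; under eq_fun do rewrite expr2.
    have h : (fun k => v (n + k)%N x - v n x) @ \oo --> (z x - v n x).
      apply: cvgB; last exact: cvg_cst.
      under eq_fun do rewrite addnC.
      by have := vz x; rewrite -(cvg_shiftn n (v ^~ x)).
    exact: cvgM.
  rewrite -sqrrN opprB => h; apply: (closed_cvg (fun y => y <= 2 / 2 ^+ n * Sr x)) h.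
    exact: closed_le.
  by apply: nearW => k; exact: vbd.
have sv n : sqint (v n).
  apply: sqint_le (sw n) _ => // x; rewrite /v patchE; case: ifP => //.
  by rewrite normr0.
have svz n : intg (fun x => (v n x - z x) ^+ 2).
  apply: (@intg_le _ (fun x => 2 / 2 ^+ n * Sr x)); last 2 first.
  - exact: intgZ.
  - by move=> x; rewrite ger0_norm ?sqr_ge0.
  by apply: measurable_funX; exact: measurable_funB.
have sz : sqint z.
  have : sqint (fun x => v 0%N x - z x).
    by apply/sqintP; split => //; exact: measurable_funB.
  move=> /(sqintB (sv 0%N)); apply: eq_sqint => x.
  by rewrite subKr.
exists z; split => //; last first.
  apply: filterS aeE => x Ex; have := vz x.
  by rewrite (_ : v ^~ x = w ^~ x)//; apply/funext => n; rewrite vE.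
have wzE n : \int[mu]_x ((w n x - z x) ^+ 2) = \int[mu]_x ((v n x - z x) ^+ 2).
  apply: Rintg_ae.
  - apply: measurable_funX; apply: measurable_funB => //; exact: sqint_measurable.
  - by apply: measurable_funX; exact: measurable_funB.
  - by apply: filterS aeE => x Ex _; rewrite vE.
apply: (@squeeze_cvgr _ _ _ _ (cst 0) (geometric (2 * \int[mu]_x Sr x) 2^-1)).
- apply: nearW => n; rewrite wzE Rintegral_ge0/=; last first.
    by move=> x _; exact: sqr_ge0.
  rewrite exprVn mulrAC -RintgZ//; apply: Rintg_le => //.
  exact: intgZ.
- exact: cvg_cst.
- by apply: cvg_geometric; rewrite ger0_norm ?invr_ge0// invf_lt1// ltr1n.
Unshelve. all: by end_near. Qed.

End square_integrable.

(** * Measurability and boxes in R^n *)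

Section measurability.
Variable R : realType.

Lemma measurable_countable_pieces d (T : measurableType d) (I : countType)
    (c : T -> I) (h : I -> T -> R) :
  (forall i, measurable [set x | c x = i]) ->
  (forall i, measurable_fun setT (h i)) ->
  measurable_fun setT (fun x => h (c x) x).
Proof.
move=> mc mh _ Y mY; rewrite setTI.
rewrite (_ : _ @^-1` Y = \bigcup_i ([set x | c x = i] `&` h i @^-1` Y)).
  apply: countable_bigcupT_measurable => // i; apply: measurableI => //.
  by rewrite -[X in measurable X]setTI; exact: mh.
apply/seteqP; split => x /=; first by move=> Yx; exists (c x).
by move=> [i _ [/= <-]].
Qed.

Definition grid (k : nat) (s : R) : R :=
  (Num.floor (s * k.+1%:R))%:~R / k.+1%:R.

Lemma grid_close k s : `|grid k s - s| <= k.+1%:R^-1.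
Proof.
have /andP[h1 h2] := floor_itv (s * k.+1%:R).
rewrite intrD in h2.
have -> : grid k s - s = ((Num.floor (s * k.+1%:R))%:~R - s * k.+1%:R) / k.+1%:R.
  by rewrite mulrBl mulfK.
rewrite normrM [`|_^-1|]ger0_norm ?invr_ge0// ler_piMl ?invr_ge0//.
by rewrite ler_norml; apply/andP; split; lra.
Qed.

Lemma near_invS (e : R) : 0 < e -> \forall k \near \oo, k.+1%:R^-1 < e.
Proof. by move=> e0; exact: near_infty_natSinv_lt (PosNum e0). Qed.

Lemma grid_cvg s : (fun k => grid k s) @ \oo --> s.
Proof.
apply/cvgrPdist_lt => e e0; apply: filterS (near_invS e0) => k.
by rewrite distrC; apply: le_lt_trans (grid_close _ _).
Qed.

Lemma measurable_floor_eq d (T : measurableType d) (g : T -> R) k :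
  measurable_fun setT g -> measurable [set x | Num.floor (g x) = k].
Proof.
move=> mg.
rewrite (_ : [set x | _] = g @^-1` `[k%:~R, (k + 1)%:~R[%classic).
  by rewrite -[X in measurable X]setTI; exact: mg.
apply/seteqP; split => x /=; rewrite in_itv/=.
  by move=> <-; exact: floor_itv.
by move=> /floor_def.
Qed.

(** Round the second argument to a grid: for each mesh it takes countably many values,
    and continuity allows the mesh to tend to 0. *)
Lemma measurable_caratheodory d d' (T : measurableType d) (S : measurableType d')
    (phi : T -> R -> R) (X : S -> T) (u : S -> R) :
  (forall s, measurable_fun setT (phi ^~ s)) -> (forall x, continuous (phi x)) ->
  measurable_fun setT X -> measurable_fun setT u ->
  measurable_fun setT (fun z => phi (X z) (u z)).
Proof.
move=> mphi cphi mX mu_.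
apply: (@measurable_fun_cvg _ _ _ setT (fun k z => phi (X z) (grid k (u z)))).
  move=> k; rewrite /grid.
  apply: (@measurable_countable_pieces _ _ _ (fun z => Num.floor (u z * k.+1%:R))
    (fun i z => phi (X z) (i%:~R / k.+1%:R))).
    by move=> i; apply: measurable_floor_eq; exact: measurable_funM.
  by move=> i; apply: (measurableT_comp (mphi _)).
move=> z _; apply: continuous_cvg; first exact: cphi.
exact: grid_cvg.
Qed.

Variable n : nat.
Notation X := 'rV[R]_n.

(** The measurable structure is generated by the coordinates, not by the open sets, so
    the argument is rounded to a grid coordinate by coordinate. *)
Lemma measurable_rV_continuous (f : X -> R) : continuous f -> measurable_fun setT f.
Proof.
move=> cf.
apply: (@measurable_fun_cvg _ X R setT (fun k (x : X) => f (\row_i grid k (x ord0 i)))).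
  move=> k; rewrite /grid.
  pose c (x : X) : {ffun 'I_n -> int} := [ffun i => Num.floor (x ord0 i * k.+1%:R)].
  rewrite (_ : (fun x => _) = (fun x => f (\row_i ((c x i)%:~R / k.+1%:R)))); last first.
    by apply/funext => x; congr f; apply/rowP => i; rewrite !mxE ffunE.
  apply: (@measurable_countable_pieces _ _ _ c
    (fun t x => f (\row_i ((t i)%:~R / k.+1%:R)))) => // t.
  rewrite [Y in measurable Y](_ : _ =
      \bigcap_(i in [set: 'I_n]) [set x : X | Num.floor (x ord0 i * k.+1%:R) = t i]).
    apply: fin_bigcap_measurable => // i _; apply: measurable_floor_eq.
    by apply: measurable_funM => //; exact: measurable_rV_coord.
  apply/seteqP; split => x /=; first by move=> <- i _; rewrite ffunE.
  by move=> h; apply/ffunP => i; rewrite ffunE; exact: h.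
move=> x _.
suff h : (fun k => \row_i grid k (x ord0 i) : X) @ \oo --> x.
  exact: (cvg_comp _ _ h (cf x)).
apply/cvg_ballP => e e0; apply: filterS (near_invS e0) => k ke.
split => // i j; rewrite !ord1 mxE /ball/= distrC.
exact: le_lt_trans (grid_close _ _) ke.
Qed.

Lemma measurable_coord (i : 'I_n) :
  measurable_fun setT (fun x : X => x ord0 i).
Proof. exact: measurable_rV_coord. Qed.

Definition hbox (a b : 'I_n -> R) : set X :=
  [set x | forall i, a i < x ord0 i <= b i].

Lemma measurable_hbox a b : measurable (hbox a b).
Proof.
rewrite (_ : hbox a b = \bigcap_(i in [set: 'I_n])
    rV_coord i @^-1` `]a i, b i]%classic).
  apply: fin_bigcap_measurable => // i _.
  by rewrite -[X in measurable X]setTI; exact: measurable_rV_coord.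
apply/seteqP; split => x /= h i; first by move=> _; rewrite /= in_itv/=; exact: h.
by have := h i I; rewrite /= in_itv/=.
Qed.

Definition cube (k : nat) : set X := hbox (fun=> - k%:R) (fun=> k%:R).

Lemma cube_cover : \bigcup_k cube k = setT.
Proof.
apply/seteqP; split => // x _.
pose M := \sum_i `|x ord0 i|.
have [k _ /(_ k (leqnn k))/= kM] : \forall k \near \oo, M < k%:R := nbhs_infty_gtr M.
exists k => // i; have : `|x ord0 i| < k%:R.
  apply: le_lt_trans kM; rewrite /M (bigD1 i)//= lerDl.
  by apply: sumr_ge0 => j _.
by rewrite ltr_norml => /andP[-> /ltW ->].
Qed.

Lemma setI_closed_hbox : setI_closed [set B | exists a b, B = hbox a b].
Proof.
move=> _ _ [a [b ->]] [a' [b' ->]].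
exists (fun i => Num.max (a i) (a' i)), (fun i => Num.min (b i) (b' i)).
apply/seteqP; split => x /=.
  by move=> [h h'] i; rewrite gt_max le_min; move: (h i) (h' i) => /andP[-> ->] /andP[-> ->].
by move=> h; split => i; move: (h i); rewrite gt_max le_min => /andP[/andP[? ?] /andP[? ?]]; apply/andP.
Qed.

(** A slab in one coordinate is an increasing union of boxes. *)
Lemma measurable_hboxE :
  (measurable : set (set X)) = <<s [set B | exists a b, B = hbox a b] >>.
Proof.
apply/seteqP; split; last first.
  apply: smallest_sub; first exact: sigma_algebra_measurable.
  by move=> _ [a [b ->]]; exact: measurable_hbox.
set G := [set B | _].
apply: smallest_sub; first exact: smallest_sigma_algebra.
rewrite -bigcup_seq => _ [i _ [Y mY <-]]; rewrite setTI.
have : R.-ocitv.-measurable.-sigma.-measurable `<=`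
    [set Y | <<s G >> (rV_coord i @^-1` Y)].
  apply: smallest_sub.
    split => /=.
    - by rewrite preimage_set0; exact: sigma_algebra0.
    - by move=> A sA; rewrite setTD preimage_setC -setTD; exact: sigma_algebraCD.
    - by move=> F sF; rewrite preimage_bigcup; exact: sigma_algebra_bigcup.
  move=> _ [[a b] _ <-] /=.
  rewrite (_ : _ @^-1` _ = \bigcup_k hbox (fun j => if j == i then a else - k%:R)
     (fun j => if j == i then b else k%:R)).
    apply: sigma_algebra_bigcup => k; apply: sub_sigma_algebra.
    by exists (fun j => if j == i then a else - k%:R), (fun j => if j == i then b else k%:R).
  apply/seteqP; split => x /=; rewrite /rV_coord in_itv/=.
    move=> xi; have : [set: X] x by [].
    rewrite -cube_cover => -[k _ h]; exists k => // j.
    by case: eqP => [->//|_]; exact: h.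
  by move=> [k _ /(_ i)]; rewrite eqxx.
by apply.
Qed.

(** On a large cube, the measurable sets over which w has integral 0 form a Dynkin
    class containing the boxes, which are stable under intersection and generate. *)
Lemma ae_eq0_hbox (w : X -> R) : measurable_fun setT w ->
  (forall a b, intg (lebesgue_rV R n) (fun x => w x * \1_(hbox a b) x)) ->
  (forall a b, \int[lebesgue_rV R n]_x (w x * \1_(hbox a b) x) = 0) ->
  w = cst 0 %[ae lebesgue_rV R n].
Proof.
move=> mw Iw w0.
suff h k : {ae lebesgue_rV R n, forall x, w x * \1_(cube k) x = 0}.
  apply: filterS (ae_foralln h) => x hx _.
  have : [set: X] x by [].
  by rewrite -cube_cover => -[k _ xk]; have := hx k; rewrite indicE mem_set// mulr1.
pose wk x := w x * \1_(cube k) x.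
have Iwk : (lebesgue_rV R n).-integrable setT (EFin \o wk) := Iw _ _.
suff : ae_eq (lebesgue_rV R n) setT (EFin \o wk) (cst 0%E).
  by apply: filterS => x /(_ I)[].
apply: integral_ae_eq => // A _ mA; rewrite integral0.
have tot : (\int[lebesgue_rV R n]_x (EFin \o wk) x)%E = 0%E.
  by rewrite /= intgE// w0.
pose D := [set A | measurable A /\ (\int[lebesgue_rV R n]_(x in A) (EFin \o wk) x)%E = 0%E].
have IwkA (B : set X) : measurable B -> (lebesgue_rV R n).-integrable B (EFin \o wk).
  by move=> mB; apply: integrableS Iwk.
have dD : dynkin D.
  split.
  - by split.
  - move=> B [mB B0]; split; first exact: measurableC.
    move: tot; rewrite -(setUv B) integral_setU//; last 3 first.
    + exact: measurableC.
    + by rewrite setUv; exact: (measurable_int _ Iwk).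
    + by apply/disj_setPCl.
    by rewrite B0 add0e.
  - move=> F tF DF; have mF i : measurable (F i) by case: (DF i).
    split; first exact: bigcup_measurable.
    rewrite integral_bigcup//; last by apply: IwkA; exact: bigcup_measurable.
    by rewrite eseries0// => i _ _; case: (DF i).
have : <<d [set B | exists a b, B = hbox a b] >> `<=` D.
  apply: smallest_sub => // _ [a [b ->]]; split; first exact: measurable_hbox.
  rewrite integral_mkcond.
  have [a' [b' E]] : exists a' b', cube k `&` hbox a b = hbox a' b'.
    have := @setI_closed_hbox (cube k) (hbox a b); apply.
      by exists (fun=> - k%:R), (fun=> k%:R).
    by exists a, b.
  transitivity (\int[lebesgue_rV R n]_x (w x * \1_(hbox a' b') x)%:E)%E; last first.
    by rewrite intgE// w0.
  apply: eq_integral => x _; rewrite patchE -E indicI /wk.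
  by case: ifPn => xB; rewrite /= !indicE ?xB ?(negbTE xB)/= ?mulr1 ?mulr0.
rewrite setI_closed_g_dynkin_g_sigma_algebra; last exact: setI_closed_hbox.
by rewrite -measurable_hboxE => /(_ _ mA)[].
Qed.

End measurability.

Lemma integral_tensor (R : realType) n (b : 'I_n -> R -> R) :
  (forall i, measurable_fun setT (b i)) -> (forall i t, 0 <= b i t) ->
  (\int[lebesgue_rV R n]_x (\prod_i b i (x ord0 i))%:E =
   \prod_i \int[lebesgue_measure]_t (b i t)%:E)%E.
Proof.
elim: n b => [|n IHn] b mb b0.
  rewrite big_ord0/= integral_dirac//; last first.
    rewrite (_ : (fun x => _) = cst 1%E)//; apply/funext => x; exact: (congr1 _ (big_ord0 _ _ _ _)).
  by rewrite diracT mul1e big_ord0.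
have mprod m (c : 'I_m -> R -> R) : (forall i, measurable_fun setT (c i)) ->
    measurable_fun setT (fun x : 'rV[R]_m => \prod_i c i (x ord0 i)).
  move=> mc; apply: measurable_prod => i _.
  by apply: (measurableT_comp (mc i)); exact: measurable_coord.
rewrite [lebesgue_rV _ _]/= ge0_integral_pushforward//; last 3 first.
- exact: measurable_rV_cons.
- by apply/measurable_EFinP; exact: mprod.
- by move=> x _; rewrite lee_fin; apply: prodr_ge0.
rewrite preimage_setT fubini_tonelli1//=; last 2 first.
- apply/measurable_EFinP; apply: (measurableT_comp (mprod _ _ mb)).
  exact: measurable_rV_cons.
- by move=> x; rewrite lee_fin; apply: prodr_ge0.
rewrite big_ord_recl -IHn//.
transitivity (\int[lebesgue_measure]_t ((b ord0 t)%:E *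
    \int[lebesgue_rV R n]_x (\prod_i b (lift ord0 i) (x ord0 i))%:E))%E.
  apply: eq_integral => t _; rewrite -ge0_integralZl//.
  - apply: eq_integral => x _; rewrite -EFinM /comp big_ord_recl; congr (_%:E).
    rewrite mxE unlift_none; congr (_ * _); apply: eq_bigr => i _.
    by rewrite mxE liftK.
  - by apply/measurable_EFinP; apply: (mprod n (fun i => b (lift ord0 i))).
  - by move=> x _; rewrite lee_fin; apply: prodr_ge0.
  - by rewrite lee_fin.
rewrite ge0_integralZr//.
- by apply/measurable_EFinP; exact: mb.
- by move=> t _; rewrite lee_fin.
- by apply: integral_ge0 => x _; rewrite lee_fin; apply: prodr_ge0.
Qed.

(** * A smooth step on the line *)

Section smooth_functions.
Variable R : realType.
Implicit Types (f g : R -> R) (k n : nat).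

(** The derivative is quantified existentially so that stability under sums, products
    and inverses is an immediate induction on k. *)
Fixpoint Ck k f : Prop := if k is k'.+1 then
  exists2 f', forall x : R, is_derive x 1 f (f' x) & Ck k' f' else True.

Definition Cinf f := forall k, Ck k f.

Lemma Ck_le k f : Ck k.+1 f -> Ck k f.
Proof.
elim: k f => [//|k IHk] f [f' df Ckf']; exists f' => //; exact: IHk.
Qed.

Lemma Ck_cst k (c : R) : Ck k (cst c).
Proof.
elim: k c => [//|k IHk] c; exists (cst 0); first by move=> x; exact: is_derive_cst.
exact: IHk.
Qed.

Lemma CkD k f g : Ck k f -> Ck k g -> Ck k (fun x => f x + g x).
Proof.
elim: k f g => [//|k IHk] f g [f' df Cf] [g' dg Cg].
by exists (fun x => f' x + g' x); [move=> x; exact: is_deriveD|exact: IHk].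
Qed.

Lemma CkM k f g : Ck k f -> Ck k g -> Ck k (fun x => f x * g x).
Proof.
elim: k f g => [//|k IHk] f g Cf Cg.
have [f' df Cf'] := Cf; have [g' dg Cg'] := Cg.
exists (fun x => f' x * g x + f x * g' x).
  move=> x; apply: (is_derive_eq (is_deriveM (df x) (dg x))).
  by rewrite /GRing.scale/= addrC mulrC.
by apply: CkD; apply: IHk => //; exact: Ck_le.
Qed.

Lemma CkZ k (c : R) f : Ck k f -> Ck k (fun x => c * f x).
Proof. by apply: CkM; exact: Ck_cst. Qed.

Lemma CkB k f g : Ck k f -> Ck k g -> Ck k (fun x => f x - g x).
Proof.
move=> Cf Cg; have := CkD Cf (CkZ (- 1) Cg).
by rewrite (_ : (fun x => _ + _) = (fun x => f x - g x))//; apply/funext => x; rewrite mulN1r.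
Qed.

Lemma is_derive_inv f (f' : R -> R) (x : R) : f x != 0 -> is_derive x 1 f (f' x) ->
  is_derive x 1 (fun x => (f x)^-1) (- (f' x * ((f x)^-1 * (f x)^-1))).
Proof.
move=> fx0 dfx.
apply: (is_derive_eq (is_deriveV fx0 dfx)).
rewrite /GRing.scale/= mulNr; congr (- _); rewrite mulrC; congr (_ * _).
by rewrite expr2 invfM.
Qed.

Lemma CkV k f : (forall x, f x != 0) -> Ck k f -> Ck k (fun x => (f x)^-1).
Proof.
move=> f0; elim: k => [//|k IHk] Cf; have [f' df Cf'] := Cf.
exists (fun x => (- 1) * (f' x * ((f x)^-1 * (f x)^-1))).
  by move=> x; rewrite mulN1r; exact: is_derive_inv.
by have := IHk (Ck_le Cf) => C; apply: CkZ; apply: CkM => //; apply: CkM.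
Qed.

Lemma is_derive_affine f (f' : R -> R) (a b x : R) :
  (forall x : R, is_derive x 1 f (f' x)) ->
  is_derive x 1 (fun x => f (a * x + b)) (a * f' (a * x + b)).
Proof.
move=> df.
have h : is_derive x 1 (fun x => a * x + b) a.
  by apply: (is_derive_eq (is_deriveD (is_deriveZ a (is_derive_id x (1 : R))) (is_derive_cst b x (1 : R)))); rewrite addr0 /GRing.scale/= mulr1.
have H : is_derive x 1 (f \o (fun x => a * x + b)) (f' (a * x + b) * a).
  by apply: (@is_derive1_comp _ f (fun x => a * x + b) x _ a _ h); exact: df.
by rewrite mulrC.
Qed.

Lemma Ck_affine k (a b : R) f : Ck k f -> Ck k (fun x => f (a * x + b)).
Proof.
elim: k f => [//|k IHk] f [f' df Cf'].
exists (fun x => a * f' (a * x + b)); first by move=> x; exact: is_derive_affine.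
by apply: CkZ; exact: IHk.
Qed.

Lemma Cinf_derivable f x : Cinf f -> derivable f x 1.
Proof. by move=> /(_ 1%N)[f' df _]; case: (df x). Qed.

Lemma Cinf_is_derive f (x : R) : Cinf f -> is_derive x 1 f (derive1 f x).
Proof. by move=> Cf; rewrite derive1E; apply/derivableP; exact: Cinf_derivable. Qed.

Lemma is_derive_derive1 f (f' : R -> R) : (forall x : R, is_derive x 1 f (f' x)) -> derive1 f = f'.
Proof. by move=> df; apply/funext => x; rewrite derive1E derive_val. Qed.

Lemma Cinf_derive1 f : Cinf f -> Cinf (derive1 f).
Proof. by move=> Cf k; have [f' /is_derive_derive1 -> ] := Cf k.+1. Qed.

Lemma Cinf_continuous f : Cinf f -> continuous f.
Proof.
by move=> Cf x; apply/differentiable_continuous/derivable1_diffP/Cinf_derivable.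
Qed.

(** The functions x^-n exp(-1/x), extended by 0: each derivative is a combination of two
    of them, so all of them are smooth. *)
Definition flat n (x : R) : R := if 0 < x then x ^- n * expR (- x^-1) else 0.

Lemma flat_ge0 n x : 0 <= flat n x.
Proof.
rewrite /flat; case: ifPn => // x0.
by rewrite mulr_ge0 ?expR_ge0// invr_ge0 exprn_ge0// ltW.
Qed.

Lemma flat_gt0 n x : 0 < x -> 0 < flat n x.
Proof. by move=> x0; rewrite /flat x0 mulr_gt0 ?expR_gt0// invr_gt0 exprn_gt0. Qed.

Lemma flat_eq0 n x : x <= 0 -> flat n x = 0.
Proof. by rewrite /flat leNgt => /negbTE ->. Qed.

(** The exponential of 1/x dominates its Taylor term of order n + 1. *)
Lemma flat_le n x : flat n x <= n.+1`!%:R * `|x|.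
Proof.
rewrite /flat; case: ifPn => x0; last by rewrite mulr_ge0.
rewrite gtr0_norm//.
have y0 : 0 <= x^-1 by rewrite invr_ge0 ltW.
have h : x^-1 ^+ n.+1 / n.+1`!%:R <= expR x^-1.
  by rewrite (le_trans _ (expR_ge1Dxn n y0))// lerDr.
have f0 : 0 < n.+1`!%:R :> R by rewrite ltr0n fact_gt0.
rewrite expRN ler_pdivrMr ?expR_gt0// -ler_pdivrMl ?mulr_gt0//.
apply: le_trans h; rewrite invfM exprVn exprSr invfM.
by rewrite le_eqVlt; apply/orP; left; apply/eqP; rewrite mulrAC -mulrA mulrC.
Qed.

Lemma flat_derive n (x : R) :
  is_derive x 1 (flat n) (flat n.+2 x - n%:R * flat n.+1 x).
Proof.
have [x0|x0|->] := ltgtP x 0.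
- rewrite !flat_eq0 ?ltW// mulr0 subrr.
  have H : is_derive x 1 (cst (0 : R)) 0 := is_derive_cst 0 x 1.
  apply: near_eq_is_derive H.
  have : \forall y \near x, y < 0 by exact: lt_nbhsl.
  by apply: filterS => y y0; rewrite flat_eq0// ltW.
- have xN0 : x != 0 by rewrite gt_eqF.
  have dV : is_derive x 1 (fun y : R => - y^-1) (x ^- 2).
    by apply: (is_derive_eq (is_deriveN (@is_derive_inv id (cst 1) x xN0 (is_derive_id x (1 : R))))); rewrite opprK /cst mul1r expr2 invfM.
  have dE : is_derive x 1 (fun y : R => expR (- y^-1)) (expR (- x^-1) * x ^- 2).
    by apply: (@is_derive1_comp _ expR (fun y => - y^-1) x _ _ _ dV); exact: is_derive_expR.
  have dX' : is_derive x 1 (fun y : R => y ^+ n) (n%:R * x ^+ n.-1).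
    have H := is_deriveX n (is_derive_id x (1 : R)).
    by rewrite exprfctE in H; apply: (is_derive_eq H); rewrite /GRing.scale/= mulr1.
  have dX : is_derive x 1 (fun y : R => (y ^+ n)^-1) (- (n%:R * x ^- n.+1)).
    have xn0 : x ^+ n != 0 by rewrite expf_neq0.
    apply: (is_derive_eq (@is_derive_inv (fun y : R => y ^+ n) (fun y => n%:R * y ^+ n.-1) x xn0 dX')).
    case: (n) => [|m]; first by rewrite !mul0r.
    congr (- _); rewrite -mulrA; congr (_ * _); rewrite !exprS /=; field.
    by rewrite xN0 expf_neq0.
  have H : is_derive x 1 (fun y : R => (y ^+ n)^-1 * expR (- y^-1))
      (flat n.+2 x - n%:R * flat n.+1 x).
    apply: (is_derive_eq (is_deriveM dX dE)).
    rewrite /flat x0 /GRing.scale/= !exprS; field.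
    by rewrite xN0 expf_neq0.
  apply: near_eq_is_derive H.
  have : \forall y \near x, 0 < y by exact: lt_nbhsr.
  by apply: filterS => y y0; rewrite /flat y0.
- rewrite !flat_eq0// mulr0 subrr.
  suff h : h^-1 *: (flat n (h + 0) - flat n 0) @[h --> 0^'] --> (0 : R).
    have h' : h^-1 *: ((flat n \o shift 0) (h *: (1 : R)) - flat n 0) @[h --> 0^'] --> (0 : R).
      by under eq_fun do rewrite /= [_ *: 1]mulr1.
    by apply: DeriveDef; [apply/cvg_ex; exists 0|apply/cvg_lim].
  apply/cvgr0Pnorm_lt => e e0.
  have C0 : 0 < n.+2`!%:R :> R by rewrite ltr0n fact_gt0.
  near=> h.
  have hN0 : h != 0 by near: h; exact: nbhs_dnbhs_neq.
  have : `|h| < e / n.+2`!%:R.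
    near: h; apply: dnbhs0_lt; exact: divr_gt0.
  rewrite ltr_pdivlMr// mulrC; apply: le_lt_trans.
  rewrite (flat_eq0 n (lexx 0)) subr0 addr0.
  have [hp|hn] := ltP 0 h; last by rewrite flat_eq0// scaler0 normr0 mulr_ge0.
  apply: le_trans (flat_le n.+1 h).
  rewrite ger0_norm; last first.
    by rewrite /GRing.scale/= mulr_ge0 ?flat_ge0// invr_ge0 ltW.
  by rewrite /flat hp /GRing.scale/= mulrA exprS invfM.
Unshelve. all: by end_near. Qed.

Lemma Ck_flat k n : Ck k (flat n).
Proof.
elim: k n => [//|k IHk] n; exists (fun x => flat n.+2 x - n%:R * flat n.+1 x).
  by move=> x; exact: flat_derive.
by apply: CkB => //; exact: CkZ.
Qed.

(** A smooth function equal to 0 on x <= 0 and to 1 on x >= 1. *)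
Definition step (x : R) : R := flat 0 x / (flat 0 x + flat 0 (1 - x)).

Let den_gt0 (x : R) : 0 < flat 0 x + flat 0 (1 - x).
Proof.
have [x0|x0] := ltP 0 x.
  by rewrite ltr_wpDr ?flat_ge0 ?flat_gt0.
by rewrite ltr_wpDl ?flat_ge0 ?flat_gt0//; lra.
Qed.

Lemma step_ge0 x : 0 <= step x.
Proof. by rewrite divr_ge0 ?flat_ge0// ltW. Qed.

Lemma step_le1 x : step x <= 1.
Proof. by rewrite ler_pdivrMr// mul1r lerDl flat_ge0. Qed.

Lemma step_eq0 x : x <= 0 -> step x = 0.
Proof. by move=> x0; rewrite /step flat_eq0// mul0r. Qed.

Lemma step_eq1 x : 1 <= x -> step x = 1.
Proof.
move=> x1; rewrite /step [flat 0 (1 - x)]flat_eq0 ?subr_le0// addr0 divff//.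
by rewrite gt_eqF// flat_gt0// (lt_le_trans ltr01).
Qed.

Lemma Cinf_step : Cinf step.
Proof.
move=> k; have C1 : Ck k (fun x => flat 0 (1 - x)).
  have := @Ck_affine k (- 1) 1 _ (Ck_flat k 0).
  by rewrite (_ : (fun x => _) = (fun x => flat 0 (1 - x)))//; apply/funext => x; rewrite mulN1r addrC.
apply: CkM; first exact: Ck_flat.
apply: CkV; first by move=> x; rewrite gt_eqF.
by apply: CkD => //; exact: Ck_flat.
Qed.

(** A nonnegative smooth bump supported in [0, 1], with integral 1. *)
Definition bell : R -> R := derive1 step.

Lemma bell_derive (x : R) : is_derive x 1 step (bell x).
Proof. exact/Cinf_is_derive/Cinf_step. Qed.

Lemma Cinf_bell : Cinf bell.
Proof. exact/Cinf_derive1/Cinf_step. Qed.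

Lemma bellE (x : R) : bell x =
  (flat 2 x * flat 0 (1 - x) + flat 0 x * flat 2 (1 - x)) /
  (flat 0 x + flat 0 (1 - x)) ^+ 2.
Proof.
have d0 (y : R) : is_derive y 1 (flat 0) (flat 2 y).
  by apply: (is_derive_eq (flat_derive 0 y)); rewrite mul0r subr0.
have d1 : is_derive x 1 (fun x => flat 0 (1 - x)) (- flat 2 (1 - x)).
  have H := @is_derive_affine _ _ (- 1) 1 x d0.
  have E : (fun y => flat 0 (- 1 * y + 1)) = (fun y => flat 0 (1 - y)).
    by apply/funext => y; rewrite mulN1r addrC.
  by rewrite E in H; apply: (is_derive_eq H); rewrite !mulN1r addrC.
have dd : is_derive x 1 (fun x => flat 0 x + flat 0 (1 - x)) (flat 2 x - flat 2 (1 - x)).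
  exact: is_deriveD (d0 x) d1.
have nz : flat 0 x + flat 0 (1 - x) != 0 by rewrite gt_eqF.
have dV := @is_derive_inv _ (fun x => flat 2 x - flat 2 (1 - x)) x nz dd.
have := is_deriveM (d0 x) dV => H.
have -> : bell x = 'D_1 step x by rewrite /bell derive1E.
rewrite (@derive_val _ _ _ _ _ _ _ H) /GRing.scale/= /cst.
by field.
Qed.

Lemma bell_ge0 x : 0 <= bell x.
Proof.
by rewrite bellE divr_ge0 ?sqr_ge0// addr_ge0// mulr_ge0// flat_ge0.
Qed.

Lemma bell_eq0 x : ~~ (0 < x < 1) -> bell x = 0.
Proof.
rewrite negb_and -!leNgt bellE => /orP[x0|x1].
  by rewrite !(flat_eq0 _ x0) !mul0r addr0 mul0r.
by rewrite !(@flat_eq0 _ (1 - x)) ?subr_le0// !mulr0 addr0 mul0r.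
Qed.

Lemma bell_bounded : exists2 M : R, 1 <= M & forall x, bell x <= M.
Proof.
have [|c _ cmax] := @EVT_max _ bell 0 1 ler01.
  exact/continuous_subspaceT/Cinf_continuous/Cinf_bell.
exists (Num.max 1 (bell c)); first by rewrite le_max lexx.
move=> x; rewrite le_max; apply/orP.
have [x01|/bell_eq0 ->] := boolP (0 < x < 1); last by left.
by right; apply: cmax; rewrite in_itv/=; case/andP: x01 => /ltW -> /ltW ->.
Qed.

End smooth_functions.

(** * Test functions close to indicators of boxes *)

Lemma Rintg_dominated d (T : measurableType d) (R : realType)
    (mu : {measure set T -> \bar R}) (F : nat -> T -> R) (f h : T -> R) :
  (forall k, measurable_fun setT (F k)) ->
  (forall x, (fun k => F k x) @ \oo --> f x) ->
  intg mu h -> (forall k x, `|F k x| <= h x) ->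
  intg mu f /\ (fun k => \int[mu]_x F k x) @ \oo --> \int[mu]_x f x.
Proof.
move=> mF Ff Ih Fh.
have mf : measurable_fun setT f by exact: (measurable_fun_cvg mF (fun x _ => Ff x)).
have [|||||If _ cv] := @dominated_convergence _ _ _ mu _ measurableT
    (fun k => EFin \o F k) (EFin \o f) (EFin \o h).
- by move=> k; apply/measurable_EFinP.
- exact/measurable_EFinP.
- by apply: nearW => x _; apply: cvg_EFin; [apply: nearW|exact: Ff].
- exact: Ih.
- by apply: nearW => x k _; rewrite /= lee_fin.
split => //.
have IF k : intg mu (F k) by exact: intg_le (mF k) Ih (Fh k).
move: cv; rewrite /= intgE//; under eq_fun do rewrite intgE//.
by move/fine_cvgP => [_].
Qed.

Section ramps.
Variable R : realType.
Implicit Types (a b c t : R).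

Definition up c a t : R := step (c * (t - a)).
(** For a <= b it tends to the indicator of ]a, b] as c tends to infinity. *)
Definition ramp c a b t : R := up c a t - up c b t.

Lemma Cinf_up c a : Cinf (up c a).
Proof.
move=> k; have := @Ck_affine _ k c (- (c * a)) _ (@Cinf_step R k).
by rewrite (_ : (fun x => _) = up c a)//; apply/funext => t; rewrite /up mulrBr.
Qed.

Lemma Cinf_ramp c a b : Cinf (ramp c a b).
Proof. by move=> k; apply: CkB; exact: Cinf_up. Qed.

Lemma measurable_Cinf (f : R -> R) : Cinf f -> measurable_fun setT f.
Proof. by move=> /Cinf_continuous; exact: continuous_measurable_fun. Qed.

Lemma up_eq0 c a t : 0 < c -> t <= a -> up c a t = 0.
Proof. by move=> c0 ta; rewrite /up step_eq0// pmulr_rle0// subr_le0. Qed.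

Lemma up_eq1 c a t : 0 < c -> a + c^-1 <= t -> up c a t = 1.
Proof.
move=> c0 ta; rewrite /up step_eq1// -(mulfV (lt0r_neq0 c0)) ler_pM2l//.
by rewrite lerBrDl.
Qed.

Lemma ramp_eq0 c a b t : 0 < c -> a <= b -> ~~ (a < t < b + c^-1) -> ramp c a b t = 0.
Proof.
move=> c0 ab; rewrite negb_and -!leNgt /ramp => /orP[ta|bt].
  by rewrite !up_eq0// ?subrr// (le_trans ta).
by rewrite !up_eq1// ?subrr// (le_trans _ bt)// lerD2r.
Qed.

Lemma ramp_norm c a b t : `|ramp c a b t| <= 1.
Proof.
rewrite ler_norml /ramp; have := step_ge0 (c * (t - a)).
have := step_ge0 (c * (t - b)); have := step_le1 (c * (t - a)).
have := step_le1 (c * (t - b)); rewrite /up => *; apply/andP; split; lra.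
Qed.

Lemma up_cvg (c : nat -> R) a t : (c @ \oo --> +oo) ->
  (fun k => up (c k) a t) @ \oo --> ((a < t)%R%:R : R).
Proof.
move=> coo; have [at_|ta] := ltP a t.
  apply: cvg_near_cst.
  have ta0 : 0 < t - a by rewrite subr_gt0.
  move/cvgryPge: coo => /(_ (t - a)^-1); apply: filterS => k ck.
  by rewrite /up step_eq1// -(mulVf (lt0r_neq0 ta0)) ler_pM2r.
apply: cvg_near_cst; move/cvgryPgt: coo => /(_ 0); apply: filterS => k ck.
by rewrite up_eq0.
Qed.

Lemma ramp_cvg (c : nat -> R) a b t : (c @ \oo --> +oo) -> a <= b ->
  (fun k => ramp (c k) a b t) @ \oo --> ((a < t <= b)%R%:R : R).
Proof.
move=> coo ab; have -> : (a < t <= b)%R%:R = (a < t)%R%:R - (b < t)%R%:R :> R.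
  have [at_|ta] := ltP a t; have [bt|tb] := ltP b t; rewrite ?subrr ?subr0//.
  by have := lt_le_trans bt ta; rewrite ltNge ab.
by apply: cvgB; exact: up_cvg.
Qed.

Lemma pow2_cvgy : (fun k => 2 ^+ k : R) @ \oo --> +oo.
Proof.
apply/cvgryPge => A; have [m _ h] : \forall k \near \oo, A <= k%:R := nbhs_infty_ger A.
exists m => // k mk; apply: le_trans (h k mk) _.
by rewrite -natrX ler_nat ltnW// ltn_expl.
Qed.

End ramps.

Section tensors.
Variables (R : realType) (n : nat).
Notation X := 'rV[R]_n.
Notation leb := (lebesgue_rV R n).
Implicit Types (x y : X) (k : nat).

Definition tensor (b : 'I_n -> R -> R) (x : X) : R := \prod_i b i (x ord0 i).

Definition upd (b : 'I_n -> R -> R) i (f : R -> R) := fun j => if j == i then f else b j.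

Lemma differentiable_tensor (b : 'I_n -> R -> R) x :
  (forall i (t : R), derivable (b i) t 1) -> differentiable (tensor b) x.
Proof.
move=> db; rewrite /tensor.
elim: (index_enum _) => [|i s IHs].
  by rewrite (_ : (fun x => _) = cst 1)//; apply/funext => y; rewrite big_nil.
rewrite (_ : (fun x => _) = (fun y : X => b i (y ord0 i)) *
    (fun y => \prod_(j <- s) b j (y ord0 j))); last first.
  by apply/funext => y; rewrite big_cons.
apply: differentiableM => //.
apply: (@differentiable_comp _ _ _ _ (fun y : X => y ord0 i) (b i)).
  exact: differentiable_coord.
exact/derivable1_diffP.
Qed.

Lemma partial_tensor (b : 'I_n -> R -> R) i : (forall (t : R), derivable (b i) t 1) ->
  partial i (tensor b) = tensor (upd b i (derive1 (b i))).
Proof.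
move=> db.
apply/funext => x; rewrite /partial /derive.
rewrite [RHS]/tensor (bigD1 i)//= /upd eqxx.
rewrite (eq_bigr (fun j => b j (x ord0 j))); last by move=> j /negbTE ->.
set c := \prod_(j < n | j != i) _.
apply/cvg_lim => //.
have E (h : R) : h^-1 *: ((tensor b \o shift x) (h *: delta_mx 0 i) - tensor b x) =
    h^-1 *: (b i (h + x ord0 i) - b i (x ord0 i)) * c.
  rewrite /= -scalerAl mulrBl; congr (_ *: (_ - _)).
    rewrite /tensor (bigD1 i)//= !mxE !eqxx mulr1; congr (_ * _).
    by apply: eq_bigr => j ji; rewrite !mxE eqxx (negbTE ji) mulr0 add0r.
  by rewrite /tensor (bigD1 i).
under eq_fun do rewrite E.
apply: cvgM; last exact: cvg_cst.
have := db (x ord0 i); rewrite /derivable /derive1 /=.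
by under eq_fun do rewrite [_ *: 1]mulr1.
Qed.

Lemma smooth_tensor (b : 'I_n -> R -> R) : (forall i, Cinf (b i)) -> smooth (tensor b).
Proof.
move=> Cb s.
suff [b' Cb' ->] : exists2 b', forall i, Cinf (b' i) &
    foldr (@partial R n) (tensor b) s = tensor b'.
  by move=> x; apply: differentiable_tensor => i t; exact: Cinf_derivable.
elim: s => [|i s [b' Cb' E]]; first by exists b.
exists (upd b' i (derive1 (b' i))).
  by move=> j; rewrite /upd; case: ifP => // _; exact: Cinf_derive1.
by rewrite /= E partial_tensor// => t; exact: Cinf_derivable.
Qed.

Lemma test_tensor (b : 'I_n -> R -> R) (a c : 'I_n -> R) : (forall i, Cinf (b i)) ->
  (forall i t, ~~ (a i <= t <= c i) -> b i t = 0) -> test_function (tensor b).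
Proof.
move=> Cb sb; split; first exact: smooth_tensor.
pose K := [set x : X | forall i, `[a i, c i]%classic (x ord0 i)].
have cK : compact K.
  by apply: (@rV_compact R n (fun i => `[a i, c i]%classic)) => i; exact: segment_compact.
apply: (subclosed_compact _ cK); first exact: closed_closure.
have clK : closed K by apply: compact_closed => //; exact: norm_hausdorff.
rewrite [Y in _ `<=` Y](closure_id K).1//; apply: closureS => x /= bx i.
rewrite /= in_itv/=; apply: contraNT bx => xi.
by rewrite /tensor (bigD1 i)//= sb// mul0r.
Qed.

Lemma measurable_tensor (b : 'I_n -> R -> R) : (forall i, measurable_fun setT (b i)) ->
  measurable_fun setT (tensor b).
Proof.
move=> mb; apply: measurable_prod => i _.
by apply: (measurableT_comp (mb i)); exact: measurable_coord.
Qed.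

Definition boxramp k (a b : 'I_n -> R) : X -> R :=
  tensor (fun i => ramp (2 ^+ k) (a i) (b i)).

Lemma boxramp_test k (a b : 'I_n -> R) : (forall i, a i <= b i) -> test_function (boxramp k a b).
Proof.
move=> ab; apply: (test_tensor (a := a) (c := fun i => b i + (2 ^+ k)^-1)) => i.
  exact: Cinf_ramp.
move=> t; rewrite negb_and -!ltNge => h.
apply: ramp_eq0; [exact: exprn_gt0|exact: ab|].
by rewrite negb_and -!leNgt; case/orP: h => /ltW ->; rewrite ?orbT.
Qed.

Lemma measurable_boxramp k (a b : 'I_n -> R) : measurable_fun setT (boxramp k a b).
Proof. by apply: measurable_tensor => i; apply: measurable_Cinf; exact: Cinf_ramp. Qed.

Lemma boxramp_cvg (a b : 'I_n -> R) x : (forall i, a i <= b i) ->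
  (fun k => boxramp k a b x) @ \oo --> (\1_(hbox a b) x : R).
Proof.
move=> ab.
have -> : (\1_(hbox a b) x : R) = \prod_i (a i < x ord0 i <= b i)%R%:R.
  rewrite indicE; have [xB|xB] := boolP (x \in hbox a b).
    by rewrite big1// => i _; rewrite (set_mem xB i).
  have [i] : exists i, ~~ (a i < x ord0 i <= b i).
    apply/existsP; rewrite -negb_forall; apply: contra xB => /forallP h.
    exact/mem_set.
  by move=> /negbTE h; rewrite (bigD1 i)//= h mul0r.
apply: (@cvg_big _ _ _ _ _ _ _ _ _ _) => [|i _].
  exact: mul_continuous.
by apply: ramp_cvg => //; exact: pow2_cvgy.
Qed.

Lemma boxramp_bound k (a b : 'I_n -> R) x : (forall i, a i <= b i) ->
  `|boxramp k a b x| <= \1_(hbox a (fun i => b i + 1)) x.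
Proof.
move=> ab; rewrite indicE; have [xB|xB] := boolP (x \in _).
  rewrite /boxramp /tensor normr_prod; apply: prodr_ile1 => i _.
  by rewrite normr_ge0 ramp_norm.
have [i] : exists i, ~~ (a i < x ord0 i <= b i + 1).
  apply/existsP; rewrite -negb_forall; apply: contra xB => /forallP h.
  exact/mem_set.
move=> h; rewrite /boxramp /tensor (bigD1 i)//= ramp_eq0 ?exprn_gt0//.
  by rewrite mul0r normr0.
move: h; rewrite !negb_and -!leNgt -ltNge => /orP[->//|/ltW h].
rewrite (le_trans _ h) ?orbT// lerD2l invf_le1 ?exprn_gt0//.
by rewrite exprn_ege1// ler1n.
Qed.

Lemma lebesgue_hbox_lty (a b : 'I_n -> R) : (leb (hbox a b) < +oo)%E.
Proof.
rewrite (_ : hbox a b = [set x : X | forall i, `]a i, b i]%classic (x ord0 i)]).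
  rewrite (lebesgue_rV_box (A := fun i => `]a i, b i]%classic))//.
  rewrite -ge0_fin_numE; last by apply: prode_ge0 => i _.
  elim/big_ind: _ => [//|x y|i _]; first exact: fin_numM.
  by rewrite lebesgue_measure_itv/=; case: ifP.
apply/seteqP; split => x /= h i; first by rewrite /= in_itv/=; exact: h.
by have := h i; rewrite /= in_itv/=.
Qed.

Lemma intg_indic (A : set X) : measurable A -> (leb A < +oo)%E ->
  intg leb (\1_A : X -> R).
Proof. move=> mA Aoo; apply/integrableP; split.
  by apply/measurable_EFinP; exact: measurable_indic.
under eq_integral do rewrite /= ger0_norm//.
by rewrite integral_indic// setIT. Qed.

Lemma sqint_indic (a b : 'I_n -> R) : sqint leb (\1_(hbox a b)).
Proof.
apply/sqintP; split; first by apply: measurable_indic; exact: measurable_hbox.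
apply: (eq_intg _ (intg_indic (@measurable_hbox R n a b) (lebesgue_hbox_lty a b))).
by move=> x; rewrite indicE; case: (_ \in _); rewrite ?expr1n ?expr0n.
Qed.

Lemma sqint_indic_intg (u : X -> R) (a b : 'I_n -> R) : sqint leb u ->
  intg leb (fun x => `|u x| * \1_(hbox a b) x).
Proof.
move=> su.
have mB := @measurable_hbox R n a b.
apply: (@intg_le _ _ _ _ _ (fun x => u x ^+ 2 + \1_(hbox a b) x)).
- apply: measurable_funM; last exact: measurable_indic.
  by apply: measurableT_comp => //; exact: sqint_measurable su.
- apply: intgD; first exact: sqint_sqr.
  by apply: intg_indic => //; exact: lebesgue_hbox_lty.
move=> x; rewrite indicE; case: (x \in _); last first.
  by rewrite mulr0 normr0 addr0 sqr_ge0.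
rewrite mulr1 normr_id -real_normK ?num_real// -subr_ge0.
have -> : `|u x| ^+ 2 + 1 - `|u x| = (`|u x| - 2^-1) ^+ 2 + 3 / 4 by field.
by rewrite addr_ge0 ?sqr_ge0// divr_ge0.
Qed.

Lemma boxramp_integral_cvg (u : X -> R) (a b : 'I_n -> R) : sqint leb u -> (forall i, a i <= b i) ->
  (fun k => \int[leb]_x (u x * boxramp k a b x)) @ \oo -->
    \int[leb]_x (u x * \1_(hbox a b) x).
Proof.
move=> su ab; have mu_ := sqint_measurable su.
have [||||_] := @Rintg_dominated _ _ _ leb (fun k x => u x * boxramp k a b x)
  (fun x => u x * \1_(hbox a b) x)
  (fun x => `|u x| * \1_(hbox a (fun i => b i + 1)) x) => //.
- by move=> k; apply: measurable_funM => //; exact: measurable_boxramp.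
- by move=> x; apply: cvgM; [exact: cvg_cst|exact: boxramp_cvg].
- exact: sqint_indic_intg.
- by move=> k x; rewrite normrM ler_wpM2l//; exact: boxramp_bound.
Qed.

Lemma hbox_case (a b : 'I_n -> R) : (forall i, a i <= b i) \/ hbox a b = set0.
Proof.
have [h|] := pselect (forall i, a i <= b i); first by left.
move/existsNP => [i /negP]; rewrite -ltNge => ba; right.
apply/seteqP; split => // x /(_ i)/andP[ax xb].
by have := lt_le_trans ax xb; rewrite ltNge (ltW ba).
Qed.

(** The products of ramps are test functions and tend boundedly to indicators of boxes. *)
Lemma weak_eq0 (u : X -> R) : L2 u ->
  (forall phi, test_function phi -> L2dot u phi = 0) -> u = cst 0 %[ae leb].
Proof.
move=> su u0; have mu_ := sqint_measurable su.
apply: ae_eq0_hbox => // a b; first by apply: sqint_mul => //; exact: sqint_indic.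
have [ab|->] := hbox_case a b; last first.
  by under eq_Rintegral do rewrite indic0 mulr0; rewrite /Rintegral integral0.
have h := boxramp_integral_cvg su ab.
have E k : \int[leb]_x (u x * boxramp k a b x) = 0 by exact: u0 (boxramp_test k ab).
rewrite -(cvg_lim _ h)//; under eq_fun do rewrite E.
exact: lim_cst.
Qed.

End tensors.

(** * Integral kernels supported in small cells *)

Lemma discriminant_le (R : realFieldType) (a b c : R) : 0 <= a ->
  (forall t, 0 <= a * t ^+ 2 + 2 * b * t + c) -> b ^+ 2 <= a * c.
Proof.
rewrite le_eqVlt => /predU1P[<-|a0] h.
  have [->|b0] := eqVneq b 0; first by rewrite mul0r expr0n.
  have := h (- (c + 1) / (2 * b)); rewrite mul0r add0r mulrC divfK ?mulf_neq0//.
  by rewrite opprD addrAC addNr add0r oppr_ge0 ler10.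
have := h (- b / a).
have -> : a * (- b / a) ^+ 2 + 2 * b * (- b / a) + c = c - b ^+ 2 / a.
  by field; rewrite gt_eqF.
by rewrite subr_ge0 ler_pdivrMr// mulrC.
Qed.

Lemma cauchy_schwarz d (T : measurableType d) (R : realType)
    (mu : {measure set T -> \bar R}) (f g : T -> R) : sqint mu f -> sqint mu g ->
  (\int[mu]_x (f x * g x)) ^+ 2 <=
  \int[mu]_x (f x ^+ 2) * \int[mu]_x (g x ^+ 2).
Proof.
move=> sf sg; apply: discriminant_le => [|t].
  by apply: Rintegral_ge0 => x _; exact: sqr_ge0.
have If2 := sqint_sqr sf; have Ig2 := sqint_sqr sg; have Ifg := sqint_mul sf sg.
have -> : \int[mu]_x (f x ^+ 2) * t ^+ 2 + 2 * (\int[mu]_x (f x * g x)) * t +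
    \int[mu]_x (g x ^+ 2) = \int[mu]_x ((t * f x + g x) ^+ 2).
  transitivity (\int[mu]_x (t ^+ 2 * f x ^+ 2 + 2 * t * (f x * g x) + g x ^+ 2)).
    rewrite RintgD//; last by apply: intgD; exact: intgZ.
    rewrite RintgD//; [|exact: intgZ|exact: intgZ].
    by rewrite !RintgZ//; ring.
  by apply: eq_Rintegral => x _; ring.
by apply: Rintegral_ge0 => x _; exact: sqr_ge0.
Qed.

Lemma Rintg_mul_cvg d (T : measurableType d) (R : realType)
    (mu : {measure set T -> \bar R}) (w : nat -> T -> R) (z f : T -> R) :
  (forall k, sqint mu (w k)) -> sqint mu z -> sqint mu f ->
  (fun k => \int[mu]_x ((w k x - z x) ^+ 2)) @ \oo --> (0 : R) ->
  (fun k => \int[mu]_x (w k x * f x)) @ \oo --> \int[mu]_x (z x * f x).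
Proof.
move=> sw sz sf wz; pose F := \int[mu]_x (f x ^+ 2).
have F0 : 0 <= F by apply: Rintegral_ge0 => x _; exact: sqr_ge0.
apply/cvgrPdist_le => e e0; near=> k.
rewrite -RintgB; [|exact: sqint_mul|exact: sqint_mul].
have -> : \int[mu]_x (z x * f x - w k x * f x) = - \int[mu]_x ((w k x - z x) * f x).
  rewrite -mulN1r -RintgZ; last by apply: sqint_mul => //; exact: sqintB.
  by apply: eq_Rintegral => x _; rewrite mulN1r mulrBl opprB.
rewrite normrN -(ler_pXn2r (n := 2))// ?nnegrE// ?(ltW e0)//.
rewrite real_normK ?num_real//.
apply: (le_trans (cauchy_schwarz (sqintB (sw k) sz) sf)).
rewrite -/F (@le_trans _ _ (e ^+ 2 / (1 + F) * (1 + F)))//; last first.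
  by rewrite divfK// gt_eqF// ltr_pwDl.
apply: ler_pM => //; last by rewrite lerDr.
  by apply: Rintegral_ge0 => x _; exact: sqr_ge0.
near: k.
have d0 : 0 < e ^+ 2 / (1 + F) by rewrite divr_gt0 ?exprn_gt0// ltr_pwDl.
have /cvgr0_norm_le/(_ _ d0) := wz.
by apply: filterS => k; apply: le_trans; exact: ler_norm.
Unshelve. all: by end_near. Qed.

Lemma measurable_Rintegral_param d1 d2 (T1 : measurableType d1) (T2 : measurableType d2)
    (R : realType) (m : {sigma_finite_measure set T2 -> \bar R}) (h : T1 * T2 -> R) :
  measurable_fun setT h -> measurable_fun setT (fun x => \int[m]_y h (x, y)).
Proof.
move=> mh; have mE : measurable_fun setT (EFin \o h) by exact/measurable_EFinP.
have mp := @measurable_fun_fubini_tonelli_F _ _ _ _ _ m _ (measurable_funepos mE) (funepos_ge0 _).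
have mn := @measurable_fun_fubini_tonelli_F _ _ _ _ _ m _ (measurable_funeneg mE) (funeneg_ge0 _).
rewrite (_ : (fun x => _) = fine \o (fun x => fubini_F m ((EFin \o h)^\+)%E x -
   fubini_F m ((EFin \o h)^\-)%E x)%E).
  by apply: measurableT_comp => //; exact: emeasurable_funB.
apply/funext => x; rewrite /Rintegral integralE /=; congr fine; congr (_ - _)%E.
  by apply: eq_integral => y _; rewrite !funeposE.
by apply: eq_integral => y _; rewrite !funenegE.
Qed.

Section kernels.
Variables (R : realType) (n : nat).
Notation X := 'rV[R]_n.
Notation leb := (lebesgue_rV R n).

Lemma lebesgue_hbox (a b : 'I_n -> R) : (forall i, a i <= b i) ->
  leb (hbox a b) = (\prod_i (b i - a i))%:E.
Proof.
move=> ab.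
rewrite (_ : hbox a b = [set x : X | forall i, `]a i, b i]%classic (x ord0 i)]).
  rewrite (lebesgue_rV_box (A := fun i => `]a i, b i]%classic))//.
  rewrite -prodEFin; apply: eq_bigr => i _.
  rewrite lebesgue_measure_itv/= lte_fin; case: ifPn => // /negbTE h.
  have := ab i; rewrite le_eqVlt h orbF => /eqP ->; by rewrite subrr.
apply/seteqP; split => x /= h i; first by rewrite /= in_itv/=; exact: h.
by have := h i; rewrite /= in_itv/=.
Qed.

Definition cell (h : R) (x : X) : set X :=
  hbox (fun i => x ord0 i) (fun i => x ord0 i + h).

Lemma lebesgue_cell h x : 0 <= h -> leb (cell h x) = (h ^+ n)%:E.
Proof.
move=> h0; rewrite lebesgue_hbox; last by move=> i; rewrite lerDl.
congr EFin; under eq_bigr do rewrite addrAC subrr add0r.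
by rewrite prodr_const card_ord.
Qed.

Lemma lebesgue_cell_sym h y : 0 <= h ->
  leb [set x | cell h x y] = (h ^+ n)%:E.
Proof.
move=> h0.
rewrite (_ : [set x | _] = [set x : X | forall i, `[y ord0 i - h, y ord0 i[%classic (x ord0 i)]).
  rewrite (lebesgue_rV_box (A := fun i => `[y ord0 i - h, y ord0 i[%classic))//.
  transitivity (\prod_(i < n) h%:E)%E.
    apply: eq_bigr => i _; rewrite lebesgue_measure_itv/= lte_fin.
    rewrite ltrBlDr ltrDl; case: ifPn => [_|]; first by rewrite -EFinB subKr.
    by rewrite -leNgt => h0'; congr EFin; apply/eqP; rewrite eq_le h0 h0'.
  by rewrite prodEFin prodr_const card_ord.
apply/seteqP; split => x /= H i.
  by rewrite /= in_itv/= lerBlDr; have /andP[-> ->] := H i.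
by have := H i; rewrite /= in_itv/= lerBlDr => /andP[-> ->].
Qed.

Lemma measurable_cell h : measurable [set z : X * X | cell h z.1 z.2].
Proof.
rewrite (_ : [set z | _] = \bigcap_(i in [set: 'I_n])
   ((fun z : X * X => z.2 ord0 i - z.1 ord0 i) @^-1` `]0, h]%classic)).
  apply: fin_bigcap_measurable => // i _; rewrite -[Y in measurable Y]setTI.
  apply: measurable_funB => //.
    by apply: (measurableT_comp (measurable_coord i)); exact: measurable_snd.
  by apply: (measurableT_comp (measurable_coord i)); exact: measurable_fst.
apply/seteqP; split => -[x y] /= H i.
  move=> _; have /andP[h1 h2] := H i.
  by rewrite /= in_itv/= subr_gt0 h1 lerBlDl.
by have := H i I; rewrite /= in_itv/= subr_gt0 lerBlDl.
Qed.

Variables (g : X -> R) (kappa : X -> X -> R) (A h : R).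
Hypothesis sg : sqint leb g.
Hypothesis A0 : 0 <= A.
Hypothesis h0 : 0 <= h.
Hypothesis mkappa : measurable_fun setT (fun z : X * X => kappa z.1 z.2).
Hypothesis kappa_le : forall x y, `|kappa x y| <= A * \1_(cell h x) y.

Let G : R := \int[leb]_y (g y ^+ 2).
Let W x : R := \int[leb]_y (g y ^+ 2 * \1_(cell h x) y).
Let v x : R := \int[leb]_y (g y * kappa x y).

Let mg : measurable_fun setT g. Proof. exact: sqint_measurable sg. Qed.

Let G0 : 0 <= G. Proof. by apply: Rintegral_ge0 => y _; exact: sqr_ge0. Qed.

Let mcell x : measurable (cell h x). Proof. exact: measurable_hbox. Qed.

Let Iind x : intg leb (\1_(cell h x) : X -> R).
Proof. by apply: intg_indic => //; rewrite lebesgue_cell// ltry. Qed.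

Let ind01 (x y : X) : 0 <= (\1_(cell h x) y : R) <= 1.
Proof. by rewrite indicE; case: (_ \in _); rewrite ler01 lexx. Qed.

Let IW x : intg leb (fun y => g y ^+ 2 * \1_(cell h x) y).
Proof.
apply: (@intg_le _ _ _ _ _ (fun y => g y ^+ 2)).
- by apply: measurable_funM; [exact: measurable_funX|exact: measurable_indic].
- exact: sqint_sqr.
- move=> y; have /andP[i0 i1] := ind01 x y.
  rewrite ger0_norm; first by apply: ler_piMr => //; exact: sqr_ge0.
  by apply: mulr_ge0 => //; exact: sqr_ge0.
Qed.

Let W_ge0 x : 0 <= W x.
Proof.
by apply: Rintegral_ge0 => y _; have /andP[i0 i1] := ind01 x y; rewrite mulr_ge0 ?sqr_ge0.
Qed.

Let W_le x : W x <= G.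
Proof.
apply: Rintg_le; [exact: IW|exact: sqint_sqr|].
by move=> y; have /andP[i0 i1] := ind01 x y; rewrite ler_piMr ?sqr_ge0.
Qed.

Let mF : measurable_fun setT (fun z : X * X => (g z.2 ^+ 2 * \1_(cell h z.1) z.2)%:E).
Proof.
apply/measurable_EFinP; apply: measurable_funM.
  by apply: measurable_funX; apply: (measurableT_comp mg); exact: measurable_snd.
rewrite (_ : (fun z => _) = \1_[set z : X * X | cell h z.1 z.2]).
  by apply: measurable_indic; exact: measurable_cell.
by apply/funext => -[x y] /=; rewrite !indicE; congr (_ : bool)%:R; apply/idP/idP => /set_mem H; apply/mem_set.
Qed.

Let F0 (z : X * X) : (0 <= (g z.2 ^+ 2 * \1_(cell h z.1) z.2)%:E)%E.
Proof.
by rewrite lee_fin; have /andP[i0 i1] := ind01 z.1 z.2; rewrite mulr_ge0 ?sqr_ge0.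
Qed.

Let mW : measurable_fun setT W.
Proof.
apply: measurableT_comp => //.
exact: (measurable_fun_fubini_tonelli_F _ mF F0).
Qed.

Let int_W : (\int[leb]_x (W x)%:E = (h ^+ n * G)%:E)%E.
Proof.
transitivity (\int[leb]_x \int[leb]_y (g y ^+ 2 * \1_(cell h x) y)%:E)%E.
  by apply: eq_integral => x _; rewrite intgE//; exact: IW.
rewrite (@fubini_tonelli _ _ _ _ _ leb leb _ mF F0)/=.
transitivity (\int[leb]_y ((h ^+ n)%:E * (g y ^+ 2)%:E))%E.
  apply: eq_integral => y _.
  transitivity (\int[leb]_x ((g y ^+ 2)%:E * (\1_[set x | cell h x y] x)%:E))%E.
    apply: eq_integral => x _; rewrite -EFinM.
    suff -> : \1_(cell h x) y = \1_[set x | cell h x y] x :> R by [].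
    by rewrite !indicE; congr (_ : bool)%:R; apply/idP/idP => /set_mem H; apply/mem_set.
  have mS : measurable [set x | cell h x y].
    rewrite (_ : [set x | _] = ysection [set z : X * X | cell h z.1 z.2] y).
      by apply: measurable_ysection; exact: measurable_cell.
    by apply/seteqP; split => x /=; rewrite /ysection /= inE.
  rewrite ge0_integralZl_EFin//; last 2 first.
  - by apply/measurable_EFinP; exact: measurable_indic.
  - exact: sqr_ge0.
  transitivity ((g y ^+ 2)%:E * leb [set x | cell h x y])%E.
    by rewrite integral_indic// setIT.
  by rewrite (lebesgue_cell_sym y h0) muleC.
rewrite ge0_integralZl_EFin ?exprn_ge0//; last 2 first.
- by move=> y _; rewrite lee_fin sqr_ge0.
- by apply/measurable_EFinP; exact: measurable_funX.
by rewrite intgE//; exact: sqint_sqr.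
Qed.

Lemma kernel_measurable : measurable_fun setT v.
Proof.
apply: (@measurable_Rintegral_param _ _ _ _ _ leb (fun z : X * X => g z.2 * kappa z.1 z.2)).
by apply: measurable_funM => //; apply: (measurableT_comp mg); exact: measurable_snd.
Qed.

Lemma kernel_sqint x : sqint leb (kappa x).
Proof.
have mk : measurable_fun setT (kappa x).
  apply: (@measurableT_comp _ _ _ _ _ _ (fun z : X * X => kappa z.1 z.2) _ (fun y => (x, y))) => //.
  by apply: measurable_fun_pair => //; exact: measurable_id.
apply/sqintP; split => //.
apply: (intg_le _ (intgZ (A ^+ 2) (Iind x))); first exact: measurable_funX.
move=> y; rewrite normrX (le_trans (_ : _ <= (A * \1_(cell h x) y) ^+ 2))//.
  by rewrite lerXn2r ?nnegrE// (le_trans _ (kappa_le x y)).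
rewrite exprMn ler_wpM2l ?sqr_ge0//.
by have /andP[i0 i1] := ind01 x y; rewrite expr2 ler_piMr.
Qed.

Lemma kernel_sqr_le x : v x ^+ 2 <= A ^+ 2 * h ^+ n * W x.
Proof.
have sgi : sqint leb (fun y => g y * \1_(cell h x) y).
  apply: (sqint_le _ sg).
    by apply: measurable_funM => //; exact: measurable_indic.
  move=> y; have /andP[i0 i1] := ind01 x y.
  by rewrite normrM ler_piMr// ger0_norm.
have -> : v x = \int[leb]_y ((g y * \1_(cell h x) y) * kappa x y).
  apply: eq_Rintegral => y _; rewrite -mulrA; congr (_ * _).
  have := kappa_le x y; rewrite indicE; case: (_ \in _); first by rewrite mul1r.
  by rewrite mulr0 normr_le0 => /eqP ->; rewrite mulr0.
apply: (le_trans (cauchy_schwarz sgi (kernel_sqint x))).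
rewrite mulrC; apply: ler_pM.
- by apply: Rintegral_ge0 => y _; exact: sqr_ge0.
- by apply: Rintegral_ge0 => y _; exact: sqr_ge0.
- have -> : A ^+ 2 * h ^+ n = \int[leb]_y (A ^+ 2 * \1_(cell h x) y).
    rewrite RintgZ//; congr (_ * _); rewrite /Rintegral integral_indic// setIT.
    by transitivity (fine (h ^+ n)%:E) => //; congr fine; rewrite -(lebesgue_cell x h0).
  apply: Rintg_le; [exact: sqint_sqr (kernel_sqint x)|exact: intgZ|move=> y].
  rewrite -[leLHS]real_normK ?num_real//.
  rewrite (le_trans (_ : _ <= (A * \1_(cell h x) y) ^+ 2))//.
    by rewrite lerXn2r ?nnegrE// (le_trans _ (kappa_le x y)).
  rewrite exprMn ler_wpM2l ?sqr_ge0//.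
  by have /andP[i0 i1] := ind01 x y; rewrite expr2 ler_piMr.
- apply: Rintg_le; [exact: sqint_sqr|exact: IW|move=> y].
  have /andP[i0 i1] := ind01 x y; rewrite exprMn ler_wpM2l ?sqr_ge0//.
  by rewrite expr2 ler_piMr.
Qed.

(** By Cauchy-Schwarz v^2 is at most a constant times W, the integral of g^2 over the
    cell at x.  Then W^(p/2) <= G^(p/2 - 1) W, and the integral of W is h^n G. *)
Lemma kernel_powR p : 2 <= p ->
  (\int[leb]_x (`|v x| `^ p)%:E <=
   ((A ^+ 2 * h ^+ n) `^ (p / 2) * h ^+ n * G `^ (p / 2))%:E)%E.
Proof.
move=> p2; have p0 : 0 < p by lra.
have c0 : 0 <= A ^+ 2 * h ^+ n by rewrite mulr_ge0 ?exprn_ge0.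
have q0 : 0 < p / 2 by rewrite divr_gt0.
have q1 : 0 <= p / 2 - 1 by rewrite subr_ge0 ler_pdivlMr// mul1r.
have split_pow y : 0 <= y -> y `^ (p / 2) = y `^ (p / 2 - 1) * y.
  move=> y0; rewrite -{3}(powRr1 y0) -powRD ?subrK//.
  by rewrite gt_eqF.
pose c := (A ^+ 2 * h ^+ n) `^ (p / 2) * G `^ (p / 2 - 1).
have c_ge0 : 0 <= c by rewrite mulr_ge0 ?powR_ge0.
apply: (@le_trans _ _ (\int[leb]_x (c%:E * (W x)%:E))%E).
  apply: ge0_le_integral => //.
  - apply/measurable_EFinP; apply: (measurableT_comp (measurable_powR p)).
    by apply: measurableT_comp => //; exact: kernel_measurable.
  - by apply/measurable_EFinP; apply: measurable_funM.
  - move=> x _; rewrite -EFinM lee_fin.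
    have -> : `|v x| `^ p = (v x ^+ 2) `^ (p / 2).
      rewrite -[v x ^+ 2]real_normK ?num_real// -powR_mulrn// -powRrM.
      by congr (_ `^ _); field.
    apply: (@le_trans _ _ ((A ^+ 2 * h ^+ n * W x) `^ (p / 2))).
      apply: ge0_ler_powR; rewrite ?nnegrE ?sqr_ge0//; first exact: ltW.
        by rewrite mulr_ge0.
      exact: kernel_sqr_le.
    rewrite (powRM _ c0 (W_ge0 x)) (split_pow _ (W_ge0 x)) mulrA.
    apply: (ler_wpM2r (W_ge0 x)); apply: ler_wpM2l; first exact: powR_ge0.
    by apply: ge0_ler_powR; rewrite ?nnegrE.
rewrite ge0_integralZl_EFin//; last 2 first.
- by move=> x _; rewrite lee_fin.
- exact/measurable_EFinP.
rewrite int_W -EFinM lee_fin /c [G `^ (p / 2) in leRHS]split_pow//.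
by rewrite le_eqVlt; apply/orP; left; apply/eqP; ring.
Qed.

End kernels.

(** * Almost everywhere limits and L^p bounds *)

Lemma prod_telescope (R : comNzRingType) n (a b : 'I_n -> R) :
  \prod_i a i - \prod_i b i =
  \sum_(i < n) \prod_(j < n) (if (j < i)%N then a j else if j == i then a i - b i else b j).
Proof.
pose P m := \prod_(j < n) (if (j < m)%N then a j else b j).
have -> : \prod_i a i = P n by apply: eq_bigr => j _; rewrite ltn_ord.
have -> : \prod_i b i = P 0%N by [].
rewrite -(telescope_sumr _ (leq0n n)) big_mkord; apply: eq_bigr => i _.
rewrite /P (bigD1 i)//= [X in _ - X](bigD1 i)//= [RHS](bigD1 i)//=.
rewrite !ltnSn !ltnn eqxx.
have E : \prod_(j < n | j != i) (if (j < i.+1)%N then a j else b j) =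
    \prod_(j < n | j != i) (if (j < i)%N then a j else b j).
  by apply: eq_bigr => j ji; rewrite ltnS leq_eqVlt (inj_eq val_inj) (negbTE ji).
rewrite E -mulrBl; congr (_ * _); apply: eq_bigr => j ji.
by rewrite (negbTE ji).
Qed.

Section Lp_limit.
Context d (T : measurableType d) (R : realType) (mu : {measure set T -> \bar R}).

(** With q the square root of r, the functions t_k = q^-k |w_(k+1) - w_k|^p and |w_0|^p have
    a sum S whose integral is at most a multiple of B.  Where S is finite the
    increments are at most l^k S^(1/p) with l = q^(1/p) < 1, so a geometric series
    bounds |z|^p by a multiple of S. *)
Lemma Lp_limit (p r : R) : 0 < p -> 0 < r < 1 -> exists2 C : R, 0 <= C &
  forall (w : nat -> T -> R) (z : T -> R) (B : R),
  (forall k, measurable_fun setT (w k)) -> measurable_fun setT z ->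
  {ae mu, forall x, (fun k => w k x) @ \oo --> z x} ->
  (\int[mu]_x (`|w 0%N x| `^ p)%:E <= B%:E)%E ->
  (forall k, \int[mu]_x (`|w k.+1 x - w k x| `^ p)%:E <= (B * r ^+ k)%:E)%E ->
  (\int[mu]_x (`|z x| `^ p)%:E <= (C * B)%:E)%E.
Proof.
move=> p0 /andP[r0 r1].
pose q := Num.sqrt r; pose l := q `^ p^-1.
have q0 : 0 < q by rewrite sqrtr_gt0.
have qq : q * q = r by rewrite -expr2 sqr_sqrtr// ltW.
have q1 : q < 1 by rewrite -[ltRHS]sqrtr1 ltr_sqrt.
have l0 : 0 < l by rewrite powR_gt0.
have l1 : l < 1.
  have := @gt0_ltr_powR R p^-1; rewrite invr_gt0 => /(_ p0 q 1).
  by rewrite powR1; apply; rewrite ?nnegrE// ltW.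
have lk k : (l ^+ k) `^ p = q ^+ k.
  rewrite -powR_mulrn; last exact: ltW.
  rewrite -powRrM mulrC powRrM /l -[(q `^ _) `^ p]powRrM mulVf ?gt_eqF// powRr1; last exact: ltW.
  by rewrite powR_mulrn// ltW.
have pq0 (x : R) := powR_ge0 x p.
pose c := 1 + (1 - l)^-1; pose c' := 1 + (1 - q)^-1.
have c0 : 0 <= c by rewrite addr_ge0// invr_ge0 subr_ge0 ltW.
have c'0 : 0 <= c' by rewrite addr_ge0// invr_ge0 subr_ge0 ltW.
exists (c `^ p * c'); first by rewrite mulr_ge0// powR_ge0.
move=> w z B mw mz wz w0 wB.
pose t k x : R := (q ^+ k)^-1 * `|w k.+1 x - w k x| `^ p.
have t0 k x : 0 <= t k x by rewrite mulr_ge0// invr_ge0 exprn_ge0// ltW.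
have mpow (f : T -> R) : measurable_fun setT f -> measurable_fun setT (fun x => `|f x| `^ p).
  by move=> mf; apply: (measurableT_comp (measurable_powR p)); exact: measurableT_comp.
have mt k : measurable_fun setT (EFin \o t k).
  by apply/measurable_EFinP; apply: measurable_funM => //; apply: mpow; exact: measurable_funB.
pose S x : \bar R := ((`|w 0%N x| `^ p)%:E + \sum_(k <oo) (t k x)%:E)%E.
have sS x : (0 <= \sum_(k <oo) (t k x)%:E)%E by apply: nneseries_ge0 => k _ _; rewrite lee_fin.
have mS : measurable_fun setT (fun x => \sum_(k <oo) (t k x)%:E)%E.
  by apply: ge0_emeasurable_sum => [k x _ _|k _]; [rewrite lee_fin|exact: mt].
have S0 x : (0 <= S x)%E by rewrite adde_ge0.
have mSS : measurable_fun setT S.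
  by apply: emeasurable_funD => //; apply/measurable_EFinP; exact: mpow.
have B0 : 0 <= B by rewrite -lee_fin (le_trans _ w0)// integral_ge0.
have IS : (\int[mu]_x S x <= (c' * B)%:E)%E.
  rewrite ge0_integralD//; last by apply/measurable_EFinP; exact: mpow.
  rewrite /c' mulrDl mul1r EFinD leeD//.
  rewrite integral_nneseries//; last by move=> k x _; rewrite lee_fin.
  apply: (@le_trans _ _ (\sum_(k <oo) ((geometric B q) k)%:E)%E).
    apply: lee_nneseries => [k _ _|k _]; first by rewrite integral_ge0// => x _; rewrite lee_fin.
    under eq_integral do rewrite /t EFinM.
    rewrite ge0_integralZl_EFin//; last 2 first.
    - by apply/measurable_EFinP; apply: mpow; exact: measurable_funB.
    - by rewrite invr_ge0 exprn_ge0// ltW.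
    apply: (@le_trans _ _ ((q ^+ k)^-1%:E * (B * r ^+ k)%:E)%E).
      by apply: lee_wpmul2l; rewrite ?lee_fin ?invr_ge0 ?exprn_ge0// ltW.
    rewrite -EFinM lee_fin -qq exprMn /geometric/=.
    by rewrite mulrCA mulKf// expf_neq0// gt_eqF.
  rewrite (_ : (\sum_(_ <oo) _)%E = (B / (1 - q))%:E); first by rewrite mulrC.
  apply/cvg_lim => //; rewrite -[Y in Y @ _](_ : EFin \o series (geometric B q) = _).
    apply: cvg_EFin; first exact: nearW.
    by apply: cvg_geometric_series; rewrite gtr0_norm.
  by apply/funext => k /=; rewrite sumEFin.
apply: (@le_trans _ _ (\int[mu]_x ((c `^ p)%:E * S x))%E); last first.
  rewrite ge0_integralZl_EFin ?powR_ge0//.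
  by rewrite -mulrA EFinM lee_wpmul2l// lee_fin powR_ge0.
apply: ae_ge0_le_integral => //.
- by apply/measurable_EFinP; exact: mpow.
- by move=> x _; rewrite mule_ge0// lee_fin powR_ge0.
- by apply: emeasurable_funM.
apply: filterS wz => x wzx _.
have [Sfin|/negP] := pselect (S x \is a fin_num); last first.
  rewrite ge0_fin_numE// -leNgt leye_eq => /eqP ->.
  rewrite gt0_muley ?leey// lte_fin powR_gt0// ltr_pwDl// invr_ge0 subr_ge0 ltW//.
pose s := fine (S x).
have sE : S x = s%:E by rewrite fineK.
have s0 : 0 <= s by rewrite fine_ge0.
have step k : `|w k.+1 x - w k x| <= l ^+ k * s `^ p^-1.
  have h : t k x <= s.
    rewrite -lee_fin -sE; apply: (@le_trans _ _ (\sum_(k <oo) (t k x)%:E)%E).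
      apply: (@le_trans _ _ (\sum_(0 <= i < k.+1) (t i x)%:E)%E).
        by rewrite big_nat_recr//= leeDr// sume_ge0// => i _; rewrite lee_fin.
      by apply: nneseries_lim_ge => i _; rewrite lee_fin.
    by rewrite leeDr// lee_fin.
  have h2 : `|w k.+1 x - w k x| `^ p <= q ^+ k * s.
    by rewrite -ler_pdivrMl ?exprn_gt0.
  have -> : l ^+ k * s `^ p^-1 = (q ^+ k * s) `^ p^-1.
    have qk0 : 0 <= q ^+ k by rewrite exprn_ge0// ltW.
    rewrite (powRM _ qk0 s0) -lk -powRrM mulfV ?gt_eqF// powRr1//.
    by rewrite exprn_ge0// ltW.
  have := @ge0_ler_powR R p^-1 _ _ _ _ _ h2.
  rewrite -powRrM mulfV ?gt_eqF// powRr1//; apply.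
  - by rewrite invr_ge0 ltW.
  - by rewrite nnegrE.
  - by rewrite nnegrE mulr_ge0 ?exprn_ge0// ltW.
have w0s : `|w 0%N x| <= s `^ p^-1.
  have h2 : `|w 0%N x| `^ p <= s by rewrite -lee_fin -sE leeDl.
  have := @ge0_ler_powR R p^-1 _ _ _ _ _ h2.
  rewrite -powRrM mulfV ?gt_eqF// powRr1//; apply; rewrite ?nnegrE//.
  by rewrite invr_ge0 ltW.
have wk k : `|w k x| <= c * s `^ p^-1.
  have h : `|w k x| <= s `^ p^-1 + \sum_(0 <= i < k) l ^+ i * s `^ p^-1.
    elim: k => [|k IHk]; first by rewrite big_geq// addr0.
    rewrite big_nat_recr//= addrA -[w k.+1 x](subrK (w k x)) addrC.
    by rewrite (le_trans (ler_normD _ _))// lerD.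
  rewrite (le_trans h)// /c mulrDl mul1r lerD2l -mulr_suml ler_wpM2r ?powR_ge0//.
  have -> : \sum_(0 <= i < k) l ^+ i = (1 - l ^+ k) / (1 - l).
    have := geometric_seriesE (1 : R); move=> /(_ l); rewrite lt_eqF// => /(_ isT) H.
    have := congr1 (fun f => f k) H; rewrite /series /geometric /=.
    by under eq_bigr do rewrite mul1r; move=> ->; rewrite mul1r.
  by rewrite ler_pdivrMr ?subr_gt0// mulVf ?gt_eqF ?subr_gt0// lerBlDr lerDl exprn_ge0// ltW.
have zx : `|z x| <= c * s `^ p^-1.
  apply: (closed_cvg (fun y => y <= c * s `^ p^-1)) (cvg_norm wzx).
    exact: closed_le.
  exact: nearW.
rewrite sE -EFinM lee_fin.
have -> : c `^ p * s = (c * s `^ p^-1) `^ p.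
  by rewrite powRM ?powR_ge0// -powRrM mulVf ?gt_eqF// powRr1.
apply: ge0_ler_powR; rewrite ?nnegrE ?mulr_ge0 ?powR_ge0//; exact: ltW.
Qed.

End Lp_limit.

(** * Mollification by one-sided kernels *)

Section kern.
Variable R : realType.
Implicit Types (a b c s t M : R).

(** A bump of mass 1 in t, supported in [s, s + 1/c]. *)
Definition kern c s t : R := c * bell (c * (t - s)).

Lemma up_derive c s (t : R) : is_derive t 1 (up c s) (kern c s t).
Proof.
have H := @is_derive_affine _ _ _ c (- (c * s)) t (@bell_derive R).
have E : (fun t => step (c * t + - (c * s))) = up c s.
  by apply/funext => y; rewrite /up mulrBr.
by rewrite E in H; apply: (is_derive_eq H); rewrite /kern mulrBr.
Qed.

Lemma derive1_up c s : derive1 (up c s) = kern c s.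
Proof. by apply: is_derive_derive1; exact: up_derive. Qed.

Lemma Cinf_kern c s : Cinf (kern c s).
Proof. by rewrite -derive1_up; apply: Cinf_derive1; exact: Cinf_up. Qed.

Lemma kern_ge0 c s t : 0 <= c -> 0 <= kern c s t.
Proof. by move=> c0; rewrite mulr_ge0// bell_ge0. Qed.

Lemma kern_eq0 c s t : 0 < c -> ~~ (s < t < s + c^-1) -> kern c s t = 0.
Proof.
move=> c0 h; rewrite /kern bell_eq0 ?mulr0//; apply: contra h => /andP[h1 h2].
rewrite pmulr_rgt0// subr_gt0 in h1; rewrite h1/=.
by rewrite -ltrBlDl -(ltr_pM2l c0) mulfV ?gt_eqF.
Qed.

Lemma kern_le M c s t : 0 <= c -> (forall x : R, bell x <= M) -> kern c s t <= M * c.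
Proof. by move=> c0 hM; rewrite mulrC /kern ler_wpM2l. Qed.

(** In s, the kernel is minus the derivative of up c s t, so averaging it over ]a, b]
    gives a ramp. *)
Lemma integral_kern c a b t : a <= b ->
  (\int[lebesgue_measure]_s (kern c s t * \1_(`]a, b]) s)%:E = (ramp c a b t)%:E)%E.
Proof.
rewrite le_eqVlt => /predU1P[->|ab].
  rewrite /ramp subrr set_itv_ge ?bnd_simp ?ltxx//.
  under eq_integral do rewrite indic0 mulr0; exact: integral0.
pose F (s : R) := - step (c * (t - s)).
have dF (s : R) : is_derive s 1 F (kern c s t).
  have H := @is_derive_affine _ _ _ (- c) (c * t) s (@bell_derive R).
  have := is_deriveN H.
  have E : - (fun s => step (- c * s + c * t)) = F.
    apply/funext => y; change (- step (- c * y + c * t) = F y).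
    by rewrite /F mulrBr mulNr addrC.
  by rewrite E => H'; apply: (is_derive_eq H'); rewrite /kern mulNr opprK mulrBr mulNr addrC.
have ck : continuous (kern c ^~ t).
  have -> : kern c ^~ t = (fun s => c * bell (- c * s + c * t)).
    by apply/funext => s; rewrite /kern mulrBr mulNr addrC.
  apply: Cinf_continuous => k; apply: CkZ; apply: Ck_affine; exact: Cinf_bell.
transitivity (\int[lebesgue_measure]_(s in `[a, b]) (kern c s t)%:E)%E.
  rewrite -integral_itv_obnd_cbnd; last first.
    by apply/measurable_EFinP/measurable_funTS; exact: continuous_measurable_fun.
  rewrite [RHS]integral_mkcond; apply: eq_integral => s _.
  by rewrite patchE indicE; case: ifP; rewrite ?mulr1 ?mulr0.
have cF (s : R) : {for s, continuous F}.
  by apply/differentiable_continuous/derivable1_diffP; case: (dF s).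
rewrite (@continuous_FTC2 _ _ F)//.
- by rewrite -EFinB /F /ramp opprK addrC.
- exact: continuous_subspaceT.
- split.
  + by move=> s _; case: (dF s).
  + exact/cvg_at_right_filter/cF.
  + exact/cvg_at_left_filter/cF.
- by move=> s _; rewrite derive1E; apply: derive_val.
Qed.

End kern.

Section mollify.
Variables (R : realType) (n : nat).
Notation X := 'rV[R]_n.
Notation leb := (lebesgue_rV R n).
Implicit Types (x y : X) (k : nat) (i j : 'I_n).

Definition mker k x : X -> R := tensor (fun i => kern (2 ^+ k) (x ord0 i)).

(** The coordinates below i carry the kernel of the finer scale and those above i the
    kernel of the coarser one.  At i stands a primitive of the difference of the two
    kernels; it has compact support because both have mass 1. *)
Definition dker_factor k i j (s : R) : R -> R :=
  if (j < i)%N then kern (2 ^+ k.+1) s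
  else if j == i then (fun t => up (2 ^+ k.+1) s t - up (2 ^+ k) s t)
  else kern (2 ^+ k) s.

Definition dker k i x : X -> R := tensor (fun j => dker_factor k i j (x ord0 j)).

Lemma Cinf_dker_factor k i j s : Cinf (dker_factor k i j s).
Proof.
rewrite /dker_factor; case: ifP => _; first exact: Cinf_kern.
by case: ifP => _; [move=> m; apply: CkB; exact: Cinf_up|exact: Cinf_kern].
Qed.

Lemma pow2_gt0 k : (0 : R) < 2 ^+ k. Proof. exact: exprn_gt0. Qed.
Hint Resolve pow2_gt0 : core.

Lemma dker_factor_eq0 k i j s t : ~~ (s < t < s + 2 ^- k) -> dker_factor k i j s t = 0.
Proof.
move=> h; rewrite /dker_factor.
have h' : ~~ (s < t < s + (2 ^+ k.+1)^-1).
  apply: contra h => /andP[-> h1]/=; apply: lt_le_trans h1 _.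
  by rewrite lerD2l lef_pV2 ?posrE// exprS ler_peMl ?ler1n// ltW.
case: ifP => _; first exact: kern_eq0.
case: ifP => _; last exact: kern_eq0.
move: h h'; rewrite !negb_and -!leNgt => /orP[ts|h1] => [_|/orP[ts|h2]].
- by rewrite !up_eq0// subrr.
- by rewrite !up_eq0// subrr.
- by rewrite !up_eq1// subrr.
Qed.

Lemma test_dker k i x : test_function (dker k i x).
Proof.
apply: (test_tensor (a := fun j => x ord0 j) (c := fun j => x ord0 j + 2 ^- k)) => j.
  exact: Cinf_dker_factor.
move=> t h; apply: dker_factor_eq0; apply: contra h => /andP[h1 h2].
by rewrite !ltW.
Qed.

Definition ddker_factor k i j (s t : R) : R :=
  if (j < i)%N then kern (2 ^+ k.+1) s t
  else if j == i then kern (2 ^+ k.+1) s t - kern (2 ^+ k) s t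
  else kern (2 ^+ k) s t.

Lemma partial_dker k i x :
  partial i (dker k i x) = tensor (fun j => ddker_factor k i j (x ord0 j)).
Proof.
rewrite /dker partial_tensor; last by move=> t; apply: Cinf_derivable; exact: Cinf_dker_factor.
congr tensor; apply/funext => j; rewrite /upd /dker_factor /ddker_factor.
case: (eqVneq j i) => [->|ji]; last by case: (j < i)%N.
rewrite ltnn eqxx; apply: is_derive_derive1 => t.
by apply: is_deriveB; exact: up_derive.
Qed.

(** Passing from one scale to the next is a divergence, by exchanging the factors of the
    product one coordinate at a time. *)
Lemma mker_diff k x y : mker k.+1 x y - mker k x y = \sum_i partial i (dker k i x) y.
Proof.
rewrite /mker /tensor prod_telescope; apply: eq_bigr => i _.
rewrite partial_dker; apply: eq_bigr => j _; rewrite /ddker_factor.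
by case: (eqVneq j i) => [->|].
Qed.

Lemma measurable_mker_joint (phi : 'I_n -> R -> R -> R) :
  (forall j, measurable_fun setT (fun z : R * R => phi j z.1 z.2)) ->
  measurable_fun setT (fun z : X * X => tensor (fun j => phi j (z.1 ord0 j)) z.2).
Proof.
move=> mphi; apply: measurable_prod => j _.
apply: (@measurableT_comp _ _ _ _ _ _ (fun z : R * R => phi j z.1 z.2) _
  (fun z : X * X => (z.1 ord0 j, z.2 ord0 j))) => //.
apply: measurable_fun_pair.
  by apply: (measurableT_comp (measurable_coord j)); exact: measurable_fst.
by apply: (measurableT_comp (measurable_coord j)); exact: measurable_snd.
Qed.

Lemma measurable_shift_joint (f : R -> R) (c : R) : measurable_fun setT f ->
  measurable_fun setT (fun z : R * R => f (c * (z.2 - z.1))).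
Proof.
move=> mf; apply: (measurableT_comp mf); apply: measurable_funM => //.
by apply: measurable_funB; [exact: measurable_snd|exact: measurable_fst].
Qed.

Lemma measurable_up_joint (c : R) : measurable_fun setT (fun z : R * R => up c z.1 z.2).
Proof. by apply: measurable_shift_joint; apply: measurable_Cinf; exact: Cinf_step. Qed.

Lemma measurable_kern_joint (c : R) : measurable_fun setT (fun z : R * R => kern c z.1 z.2).
Proof.
apply: measurable_funM => //.
by apply: measurable_shift_joint; apply: measurable_Cinf; exact: Cinf_bell.
Qed.

Lemma measurable_mker k : measurable_fun setT (fun z : X * X => mker k z.1 z.2).
Proof.
apply: (measurable_mker_joint (phi := fun=> kern (2 ^+ k))) => j.
exact: measurable_kern_joint.
Qed.

Lemma measurable_dker k i : measurable_fun setT (fun z : X * X => dker k i z.1 z.2).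
Proof.
apply: (measurable_mker_joint (phi := fun j => dker_factor k i j)) => j.
rewrite /dker_factor; case: (j < i)%N; first exact: measurable_kern_joint.
case: (j == i); last exact: measurable_kern_joint.
by apply: measurable_funB; exact: measurable_up_joint.
Qed.

Lemma measurable_ddker k i :
  measurable_fun setT (fun z : X * X => tensor (fun j => ddker_factor k i j (z.1 ord0 j)) z.2).
Proof.
apply: (measurable_mker_joint (phi := ddker_factor k i)) => j.
rewrite /ddker_factor; case: (j < i)%N; first exact: measurable_kern_joint.
case: (j == i); last exact: measurable_kern_joint.
by apply: measurable_funB; exact: measurable_kern_joint.
Qed.

Lemma tensor_cell_bound (b : 'I_n -> R -> R) (A : 'I_n -> R) x (h : R) :
  (forall j t, `|b j t| <= A j) ->
  (forall j t, ~~ (x ord0 j < t <= x ord0 j + h) -> b j t = 0) ->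
  forall y, `|tensor b y| <= (\prod_j A j) * \1_(cell h x) y.
Proof.
move=> bA b0 y; rewrite indicE; have [yC|yC] := boolP (y \in _).
  by rewrite mulr1 /tensor normr_prod; apply: ler_prod => j _; rewrite normr_ge0 bA.
have [j] : exists j, ~~ (x ord0 j < y ord0 j <= x ord0 j + h).
  apply/existsP; rewrite -negb_forall; apply: contra yC => /forallP H.
  exact/mem_set.
by move=> /b0 bj; rewrite /tensor (bigD1 j)//= bj mul0r normr0 mulr0.
Qed.

Lemma not_oc_oo (s t h : R) : ~~ (s < t <= s + h) -> ~~ (s < t < s + h).
Proof. by apply: contra => /andP[-> /ltW]. Qed.

Lemma pow2_ge0 k : (0 : R) <= 2 ^+ k. Proof. exact: ltW. Qed.
Hint Resolve pow2_ge0 : core.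

Lemma kern_norm_le M k (s t : R) : (forall t : R, bell t <= M) ->
  `|kern (2 ^+ k) s t| <= M * 2 ^+ k.
Proof. by move=> hM; rewrite ger0_norm; [exact: kern_le|exact: kern_ge0]. Qed.

Lemma mker_bound M k x y : (forall t : R, bell t <= M) ->
  `|mker k x y| <= (M * 2 ^+ k) ^+ n * \1_(cell (2 ^- k) x) y.
Proof.
move=> hM; have -> : (M * 2 ^+ k) ^+ n = \prod_(j < n) (M * 2 ^+ k).
  by rewrite prodr_const card_ord.
apply: tensor_cell_bound => j t; last by move=> /not_oc_oo; exact: kern_eq0.
exact: kern_norm_le.
Qed.

Lemma dker_bound M k i x y : 1 <= M -> (forall t : R, bell t <= M) ->
  `|dker k i x y| <= (M * 2 ^+ k.+1) ^+ n.-1 * \1_(cell (2 ^- k) x) y.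
Proof.
move=> M1 hM; have M0 : 0 <= M by rewrite (le_trans ler01).
have -> : (M * 2 ^+ k.+1) ^+ n.-1 = \prod_(j < n) (if j == i then 1 else M * 2 ^+ k.+1).
  rewrite (bigD1 i)//= eqxx mul1r (eq_bigr (fun=> M * 2 ^+ k.+1)); last first.
    by move=> j /negbTE ->.
  by rewrite prodr_const cardC1 card_ord.
apply: tensor_cell_bound => j t; last by move=> /not_oc_oo; exact: dker_factor_eq0.
rewrite /dker_factor; case: ifPn => [ji|_].
  by rewrite -val_eqE /= ltn_eqF//; exact: kern_norm_le.
case: ifP => _.
  rewrite ler_norml /up; have := step_ge0 (2 ^+ k.+1 * (t - x ord0 j)).
  have := step_ge0 (2 ^+ k * (t - x ord0 j)).
  have := step_le1 (2 ^+ k.+1 * (t - x ord0 j)).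
  have := step_le1 (2 ^+ k * (t - x ord0 j)) => *; apply/andP; split; lra.
apply: (le_trans (kern_norm_le _ _ _ hM)).
by rewrite ler_wpM2l// exprS ler_peMl ?ler1n.
Qed.

Let diff01 (a b m : R) : 0 <= a <= m -> 0 <= b <= m -> `|a - b| <= m.
Proof.
by move=> /andP[? ?] /andP[? ?]; rewrite ler_norml; apply/andP; split; lra.
Qed.

Lemma ddker_bound M k i x y : 1 <= M -> (forall t : R, bell t <= M) ->
  `|tensor (fun j => ddker_factor k i j (x ord0 j)) y| <=
  (M * 2 ^+ k.+1) ^+ n * \1_(cell (2 ^- k) x) y.
Proof.
move=> M1 hM; have M0 : 0 <= M by rewrite (le_trans ler01).
have -> : (M * 2 ^+ k.+1) ^+ n = \prod_(j < n) (M * 2 ^+ k.+1).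
  by rewrite prodr_const card_ord.
have b1 (s t : R) : 0 <= kern (2 ^+ k.+1) s t <= M * 2 ^+ k.+1.
  by rewrite kern_ge0//=; exact: kern_le.
have b2 (s t : R) : 0 <= kern (2 ^+ k) s t <= M * 2 ^+ k.+1.
  rewrite kern_ge0//=; apply: (le_trans (kern_le _ _ _ hM)) => //.
  by rewrite ler_wpM2l// exprS ler_peMl ?ler1n.
apply: tensor_cell_bound => j t.
  have {}b1 := b1 (x ord0 j) t; have {}b2 := b2 (x ord0 j) t.
  rewrite /ddker_factor; case: (j < i)%N; first by case/andP: b1 => h; rewrite ger0_norm.
  by case: (j == i); [exact: diff01|case/andP: b2 => h; rewrite ger0_norm].
move=> /not_oc_oo h; rewrite /ddker_factor.
have h' : ~~ (x ord0 j < t < x ord0 j + (2 ^+ k.+1)^-1).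
  apply: contra h => /andP[-> h1]/=; apply: lt_le_trans h1 _.
  by rewrite lerD2l lef_pV2 ?posrE// exprS ler_peMl ?ler1n// ltW.
by rewrite !kern_eq0// subrr !if_same.
Qed.

Definition mollify (u : X -> R) k x : R := \int[leb]_y (u y * mker k x y).

(** Successive mollifications of u differ by integrals of the weak gradient against
    kernels of size 2^(k (n - 1)) instead of 2^(k n). *)
Lemma mollify_diff (u : X -> R) (g : 'I_n -> X -> R) k x : sqint leb u ->
  (forall i, sqint leb (g i) /\ weak_partial i u (g i)) ->
  mollify u k.+1 x - mollify u k x = - \sum_i \int[leb]_y (g i y * dker k i x y).
Proof.
have [M M1 hM] := bell_bounded R.
have M0 : 0 <= M by rewrite (le_trans ler01).
have A0 m l : 0 <= (M * 2 ^+ m) ^+ l by rewrite exprn_ge0// mulr_ge0// ltW.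
have h0 : (0 : R) <= 2 ^- k by rewrite invr_ge0 ltW.
move=> su sg.
have h0' m : (0 : R) <= 2 ^- m by rewrite invr_ge0 ltW.
have sm m : sqint leb (mker m x).
  exact: (kernel_sqint (h0' m) (measurable_mker m) (fun x y => mker_bound m x y hM)).
rewrite /mollify -RintgB; [|exact: sqint_mul|exact: sqint_mul].
transitivity (\int[leb]_y (\sum_i u y * partial i (dker k i x) y)).
  by apply: eq_Rintegral => y _; rewrite -mulrBr mker_diff mulr_sumr.
have sp i : sqint leb (partial i (dker k i x)).
  rewrite partial_dker.
  exact: (kernel_sqint (h0' k) (measurable_ddker k i) (fun x y => ddker_bound k i x y M1 hM)).
rewrite Rintg_sum; last by move=> i; exact: sqint_mul.
by rewrite -sumrN; apply: eq_bigr => i _; have [_ /(_ _ (test_dker k i x))] := sg i.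
Qed.

End mollify.

(** * The Sobolev inequality below the critical exponent *)

Section sobolev_embedding.
Variables (R : realType) (n : nat).
Notation X := 'rV[R]_n.
Notation leb := (lebesgue_rV R n).
Implicit Types (x y : X) (k : nat) (i j : 'I_n) (u w z : X -> R).

Let pow2V_ge0 k : (0 : R) <= 2 ^- k.
Proof. by rewrite invr_ge0 exprn_ge0. Qed.

Lemma powR_sum_le p (a : 'I_n -> R) : 0 < p ->
  `|\sum_i a i| `^ p <= n%:R `^ p * \sum_i `|a i| `^ p.
Proof.
move=> p0; set S := \sum_i `|a i| `^ p.
have S0 : 0 <= S by apply: sumr_ge0 => i _; exact: powR_ge0.
have ai i : `|a i| <= S `^ p^-1.
  rewrite -[leLHS](@powRr1 R)// -(mulfV (lt0r_neq0 p0)) powRrM.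
  apply: ge0_ler_powR; rewrite ?nnegrE ?powR_ge0 ?invr_ge0 ?(ltW p0)//.
  by rewrite /S (bigD1 i)//= lerDl; apply: sumr_ge0 => j _; exact: powR_ge0.
have -> : n%:R `^ p * S = (n%:R * S `^ p^-1) `^ p.
  by rewrite powRM ?powR_ge0// -powRrM mulVf ?gt_eqF// powRr1.
apply: ge0_ler_powR; rewrite ?nnegrE ?mulr_ge0 ?powR_ge0//; first exact: ltW.
apply: (le_trans (ler_norm_sum _ _ _)).
apply: (@le_trans _ _ (\sum_(i < n) S `^ p^-1)); first exact: ler_sum.
by rewrite sumr_const card_ord -[leLHS]mulr_natl.
Qed.

(** The integrals of |w_(k+1) - w_k|^p, for the mollifications w_k, are bounded by the
    terms of a geometric series with this ratio, which is less than 1 exactly for p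
    below the critical exponent. *)
Definition lacunary_ratio (p : R) : R := 2 `^ ((n%:R - 2) * (p / 2) - n%:R).

Lemma scaling M k p : (2 <= n)%N -> 0 <= M ->
  (((M * 2 ^+ k.+1) ^+ n.-1) ^+ 2 * (2 ^- k) ^+ n) `^ (p / 2) * (2 ^- k) ^+ n =
  (((M * 2) ^+ n.-1) ^+ 2) `^ (p / 2) * lacunary_ratio p ^+ k.
Proof.
rewrite /lacunary_ratio; case: n => [//|[//|m]] _ M0 /=.
have E : ((M * 2 ^+ k.+1) ^+ m.+1) ^+ 2 * (2 ^- k) ^+ m.+2 = ((M * 2) ^+ m.+1) ^+ 2 * (2 ^+ (k * m)).
  have : (2 ^+ k : R) != 0 by rewrite expf_neq0.
  rewrite exprM [2 ^+ k.+1]exprS; move: (2 ^+ k : R) => a a0.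
  rewrite mulrA [(M * 2 * a) ^+ _]exprMn exprMn -mulrA; congr (_ * _).
  rewrite exprVn -exprM muln2 -addnn addSn -addnS exprD mulfK ?expf_neq0//.
rewrite E powRM ?exprn_ge0 ?mulr_ge0// -mulrA; congr (_ * _).
have -> : (2 ^+ (k * m)) `^ (p / 2) = (2 `^ (m%:R * (p / 2))) ^+ k :> R.
  rewrite -(powR_mulrn (k * m) (ler0n R 2)) -(powR_mulrn k (powR_ge0 2 _)).
  rewrite -(powRrM 2 (k * m)%:R) -(powRrM 2 _ k%:R) natrM; by rewrite [k%:R * _]mulrC mulrAC.
have -> : (2 ^- k) ^+ m.+2 = (2 `^ (- m.+2%:R)) ^+ k :> R.
  by rewrite powRN powR_mulrn// exprVn -exprM mulnC exprM exprVn.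
rewrite -exprMn -powRD; last by apply/implyP => _; rewrite pnatr_eq0.
by congr ((_ `^ _) ^+ _); rewrite -!natr1; ring.
Qed.

Lemma lacunary_ratio_lt1 p : p * (n%:R - 2) < 2 * n%:R -> 0 < lacunary_ratio p < 1.
Proof.
move=> pn; rewrite powR_gt0//= /lacunary_ratio /powR pnatr_eq0/= expR_lt1.
by rewrite pmulr_llt0 ?ln_gt0 ?ltr1n//; lra.
Qed.

Variables (u : X -> R) (g : 'I_n -> X -> R).
Variable M : R.
Hypothesis M1 : 1 <= M.
Hypothesis hM : forall t : R, bell t <= M.
Hypothesis n2 : (2 <= n)%N.
Hypothesis su : sqint leb u.
Hypothesis sg : forall i, sqint leb (g i) /\ weak_partial i u (g i).

Let M0 : 0 <= M. Proof. by rewrite (le_trans ler01). Qed.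

Let S := \int[leb]_x (u x ^+ 2) + \sum_i \int[leb]_x (g i x ^+ 2).

Let U0 : 0 <= \int[leb]_x (u x ^+ 2).
Proof. by apply: Rintegral_ge0 => x _; exact: sqr_ge0. Qed.

Let G0 i : 0 <= \int[leb]_x (g i x ^+ 2).
Proof. by apply: Rintegral_ge0 => x _; exact: sqr_ge0. Qed.

Let S0 : 0 <= S. Proof. by rewrite addr_ge0// sumr_ge0. Qed.

Let GS i : \int[leb]_x (g i x ^+ 2) <= S.
Proof.
by rewrite /S (bigD1 i)//= addrCA lerDl addr_ge0// sumr_ge0.
Qed.

Let US : \int[leb]_x (u x ^+ 2) <= S.
Proof. by rewrite lerDl sumr_ge0. Qed.

Lemma mollify_sqint k : sqint leb (mollify u k).
Proof.
have A0 : 0 <= (M * 2 ^+ k) ^+ n by rewrite exprn_ge0// mulr_ge0// exprn_ge0.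
have H := kernel_powR su A0 (pow2V_ge0 k) (measurable_mker k)
  (fun x y => mker_bound k x y hM) (lexx 2).
have mv := kernel_measurable su (measurable_mker k).
apply/sqintP; split; first exact: mv.
apply/integrableP; split; first by apply/measurable_EFinP; exact: measurable_funX.
apply: (le_lt_trans _ (le_lt_trans H (ltry _))).
rewrite le_eqVlt; apply/orP; left; apply/eqP; apply: eq_integral => x _.
by rewrite /= powR_mulrn// real_normK ?num_real// ger0_norm// sqr_ge0.
Qed.


Lemma mollify_measurable k : measurable_fun setT (mollify u k).
Proof. exact: sqint_measurable (mollify_sqint k). Qed.

Definition diff_bound p := n%:R `^ p * (n%:R * (((M * 2) ^+ n.-1) ^+ 2) `^ (p / 2)).

Lemma mollify_diff_powR p k : 2 <= p ->
  (\int[leb]_x (`|mollify u k.+1 x - mollify u k x| `^ p)%:E <=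
   (diff_bound p * S `^ (p / 2) * lacunary_ratio p ^+ k)%:E)%E.
Proof.
move=> p2; have p0 : 0 < p by lra.
pose m := (((M * 2) ^+ n.-1) ^+ 2) `^ (p / 2).
rewrite /diff_bound -/m; pose D i x := \int[leb]_y (g i y * dker k i x y).
have A0 : 0 <= (M * 2 ^+ k.+1) ^+ n.-1 by rewrite exprn_ge0// mulr_ge0// exprn_ge0.
have mD i : measurable_fun setT (D i) := kernel_measurable (sg i).1 (measurable_dker k i).
have mDp i : measurable_fun setT (fun x => (`|D i x| `^ p)%:E).
  apply/measurable_EFinP; apply: (measurableT_comp (measurable_powR p)).
  exact: measurableT_comp.
have msum : measurable_fun setT (fun x => (\sum_i `|D i x| `^ p)%:E).
  by under eq_fun do rewrite -sumEFin; exact: emeasurable_sum.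
have HD i : (\int[leb]_x (`|D i x| `^ p)%:E <= (m * lacunary_ratio p ^+ k * S `^ (p / 2))%:E)%E.
  apply: (le_trans (kernel_powR (sg i).1 A0 (pow2V_ge0 k) (measurable_dker k i)
    (fun x y => dker_bound k i x y M1 hM) p2)).
  rewrite scaling// lee_fin ler_wpM2l//; first by rewrite mulr_ge0 ?powR_ge0// exprn_ge0// powR_ge0.
  by apply: ge0_ler_powR; rewrite ?nnegrE// divr_ge0// ltW.
apply: (@le_trans _ _ (\int[leb]_x ((n%:R `^ p)%:E * (\sum_i `|D i x| `^ p)%:E))%E).
  apply: ge0_le_integral => //.
  - apply/measurable_EFinP; apply: (measurableT_comp (measurable_powR p)).
    by apply: measurableT_comp => //; apply: measurable_funB; exact: mollify_measurable.
  - exact: emeasurable_funM.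
  - move=> x _; rewrite -EFinM lee_fin (mollify_diff k x su sg) normrN.
    exact: powR_sum_le.
rewrite ge0_integralZl_EFin ?powR_ge0//; last first.
  by move=> x _; rewrite lee_fin; apply: sumr_ge0 => i _; exact: powR_ge0.
rewrite -!mulrA EFinM; apply: lee_wpmul2l; first by rewrite lee_fin powR_ge0.
under eq_integral do rewrite -sumEFin.
rewrite ge0_integral_sum//.
apply: (@le_trans _ _ (\sum_(i < n) (m * lacunary_ratio p ^+ k * S `^ (p / 2))%:E)%E).
  by apply: lee_sum => i _; exact: HD.
rewrite sumEFin lee_fin sumr_const card_ord -[leLHS]mulr_natl.
by rewrite ler_wpM2l// -mulrA ler_wpM2l ?powR_ge0// mulrC.
Qed.

Definition init_bound p :=
  (((M * 2 ^+ 0) ^+ n) ^+ 2 * (2 ^- 0) ^+ n) `^ (p / 2) * (2 ^- 0) ^+ n.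

Lemma mollify0_powR p : 2 <= p ->
  (\int[leb]_x (`|mollify u 0 x| `^ p)%:E <= (init_bound p * S `^ (p / 2))%:E)%E.
Proof.
move=> p2; have A0 : 0 <= (M * 2 ^+ 0) ^+ n by rewrite exprn_ge0// mulr_ge0// exprn_ge0.
apply: (le_trans (kernel_powR su A0 (pow2V_ge0 0) (measurable_mker 0)
    (fun x y => mker_bound 0 x y hM) p2)).
rewrite lee_fin ler_wpM2l//; first by rewrite mulr_ge0 ?powR_ge0 ?exprn_ge0.
by apply: ge0_ler_powR; rewrite ?nnegrE// divr_ge0//; lra.
Qed.

Lemma integral_mker k (a b : 'I_n -> R) y : (forall i, a i <= b i) ->
  (\int[leb]_x (mker k x y * \1_(hbox a b) x)%:E)%E = (boxramp k a b y)%:E.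
Proof.
move=> ab; rewrite /boxramp /tensor -prodEFin.
transitivity (\int[leb]_x (\prod_i (fun i t => kern (2 ^+ k) t (y ord0 i) * \1_(`]a i, b i]) t) i (x ord0 i))%:E)%E.
  apply: eq_integral => x _; rewrite big_split; congr (_ * _)%:E.
  rewrite indicE; have [xB|xB] := boolP (x \in _).
    rewrite big1// => i _; rewrite indicE mem_set//= in_itv/=.
    by move: xB => /set_mem/(_ i).
  have [i xi] : exists i, ~~ (a i < x ord0 i <= b i).
    apply/existsP; rewrite -negb_forall; apply: contra xB => /forallP H.
    exact/mem_set.
  rewrite (bigD1 i)//= indicE memNset ?mul0r//= in_itv/=; exact/negP.
rewrite (integral_tensor (b := fun i t => kern (2 ^+ k) t (y ord0 i) * \1_(`]a i, b i]) t)).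
- by apply: eq_bigr => i _; exact: integral_kern.
- move=> i; apply: measurable_funM; last exact: measurable_indic.
  apply: (@measurableT_comp _ _ _ _ _ _ (fun z : R * R => kern (2 ^+ k) z.1 z.2) _
    (fun t => (t, y ord0 i))); first exact: measurable_kern_joint.
  exact: measurable_fun_pair.
- by move=> i t; rewrite mulr_ge0 ?kern_ge0// exprn_ge0.
Qed.

Lemma mollify_hbox k (a b : 'I_n -> R) : (forall i, a i <= b i) ->
  \int[leb]_x (mollify u k x * \1_(hbox a b) x) = \int[leb]_x (u x * boxramp k a b x).
Proof.
move=> ab; have mu_ := sqint_measurable su.
pose F (z : X * X) := ((u z.2 * mker k z.1 z.2) * \1_(hbox a b) z.1)%:E.
have mB := @measurable_hbox R n a b.
have mF : measurable_fun setT F.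
  apply/measurable_EFinP; apply: measurable_funM; last first.
    by apply: measurableT_comp; [exact: measurable_indic|exact: measurable_fst].
  apply: measurable_funM; last exact: measurable_mker.
  by apply: (measurableT_comp mu_); exact: measurable_snd.
have mker0 x y : 0 <= mker k x y.
  by apply: prodr_ge0 => i _; rewrite kern_ge0// exprn_ge0.
have ind0 (x : X) : 0 <= (\1_(hbox a b) x : R) by rewrite indicE.
have mk y : measurable_fun setT (fun x => (mker k x y * \1_(hbox a b) x)%:E).
  apply/measurable_EFinP; apply: measurable_funM; last exact: measurable_indic.
  apply: (@measurableT_comp _ _ _ _ _ _ (fun z : X * X => mker k z.1 z.2) _ (fun x => (x, y))).
    exact: measurable_mker.
  exact: measurable_fun_pair.
have Ik y : intg leb (fun x => mker k x y * \1_(hbox a b) x).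
  apply/integrableP; split; first exact: mk.
  under eq_integral do rewrite /= ger0_norm ?mulr_ge0//.
  by rewrite integral_mker// ltry.
have iF : (leb \x leb)%E.-integrable setT F.
  apply/(integrable21ltyP _ _ mF).
  under eq_integral => y _.
    under eq_integral => x _.
      rewrite /F /= -mulrA normrM [`|_ * \1__ _|]ger0_norm ?mulr_ge0// EFinM; over.
    rewrite ge0_integralZl_EFin//; last by move=> x _; rewrite lee_fin mulr_ge0.
    rewrite integral_mker// -EFinM; over.
  have /integrableP[_] := sqint_indic_intg a (fun i => b i + 1) su.
  apply: le_lt_trans; apply: ge0_le_integral => //.
  - by move=> y _; rewrite lee_fin mulr_ge0// -lee_fin -integral_mker// integral_ge0// => x _; rewrite lee_fin mulr_ge0.
  - apply/measurable_EFinP; apply: measurable_funM; first exact: measurableT_comp.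
    exact: measurable_boxramp.
  - apply/measurable_EFinP; apply: measurableT_comp => //; apply: measurable_funM.
      exact: measurableT_comp.
    by apply: measurable_indic; exact: measurable_hbox.
  - move=> y _; rewrite lee_fin [leRHS]ger0_norm ?mulr_ge0//.
    apply: ler_wpM2l => //; apply: (le_trans (ler_norm _)); exact: boxramp_bound.
have := Fubini iF; rewrite /F /= => E.
have E1 : (\int[leb]_x \int[leb]_y (u y * mker k x y * \1_(hbox a b) x)%:E =
  \int[leb]_x (mollify u k x * \1_(hbox a b) x)%:E)%E.
  apply: eq_integral => x _.
  have Iu : intg leb (fun y => u y * mker k x y).
    exact: (sqint_mul su (kernel_sqint (pow2V_ge0 k) (measurable_mker k)
      (fun x y => mker_bound k x y hM) x)).
  transitivity ((\1_(hbox a b) x)%:E * \int[leb]_y (u y * mker k x y)%:E)%E.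
    rewrite -(integralZl measurableT Iu).
    by apply: eq_integral => y _; rewrite mulrC.
  by rewrite (intgE Iu) mulrC.
have E2 : (\int[leb]_y \int[leb]_x (u y * mker k x y * \1_(hbox a b) x)%:E =
  \int[leb]_y (u y * boxramp k a b y)%:E)%E.
  apply: eq_integral => y _.
  transitivity ((u y)%:E * \int[leb]_x (mker k x y * \1_(hbox a b) x)%:E)%E.
    rewrite -(integralZl measurableT (Ik y)).
    by apply: eq_integral => x _; rewrite -mulrA.
  by rewrite integral_mker.
by rewrite /Rintegral -E1 -E2 E.
Qed.

(** For p = 2 the ratio is 1/4, so the mollifications converge in L^2 and almost
    everywhere.  Their integrals over a box are integrals of u against the product of
    ramps, which tend to the integral of u over the box: the limit is u. *)
Lemma mollify_limit : exists2 z, sqint leb z &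
  {ae leb, forall x, (fun k => mollify u k x) @ \oo --> z x} /\ z = u %[ae leb].
Proof.
have mu_ := sqint_measurable su.
pose K := diff_bound 2.
have HK k : (\int[leb]_x (`|mollify u k.+1 x - mollify u k x| `^ 2)%:E <=
   (K * S `^ (2 / 2) * lacunary_ratio 2 ^+ k)%:E)%E := mollify_diff_powR k (lexx 2).
have r2 : lacunary_ratio 2 = 4^-1 :> R.
  rewrite /lacunary_ratio mulfV ?pnatr_eq0// mulr1 addrAC subrr add0r.
  by rewrite powRN powR_mulrn// -natrX.
have HK2 k : \int[leb]_x ((mollify u k.+1 x - mollify u k x) ^+ 2) <= K * S / 4 ^+ k.
  rewrite -lee_fin -intgE; last first.
    by apply: sqint_sqr; apply: sqintB; exact: mollify_sqint.
  have := HK k; rewrite r2 mulfV ?pnatr_eq0// powRr1// exprVn.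
  apply: le_trans; rewrite le_eqVlt; apply/orP; left; apply/eqP; apply: eq_integral => x _.
  by rewrite powR_mulrn// real_normK ?num_real.
have [z [sz z2 zae]] := riesz_fischer mollify_sqint HK2.
exists z => //; split => //.
have szu : sqint leb (fun x => z x - u x) by exact: sqintB.
suff : (fun x => z x - u x) = cst 0 %[ae leb].
  by apply: filterS => x /= h /h /eqP; rewrite subr_eq0 => /eqP.
apply: ae_eq0_hbox => [||a b]; first exact: sqint_measurable szu.
  by move=> a b; apply: sqint_mul => //; exact: sqint_indic.
have [ab|->] := hbox_case a b; last first.
  by under eq_Rintegral do rewrite indic0 mulr0; rewrite /Rintegral integral0.
have -> : \int[leb]_x ((z x - u x) * \1_(hbox a b) x) =
    \int[leb]_x (z x * \1_(hbox a b) x) - \int[leb]_x (u x * \1_(hbox a b) x).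
  under eq_Rintegral do rewrite mulrBl.
  by rewrite RintgB//; apply: sqint_mul => //; exact: sqint_indic.
apply/eqP; rewrite subr_eq0; apply/eqP.
have cu : (fun k => \int[leb]_x (mollify u k x * \1_(hbox a b) x)) @ \oo -->
    \int[leb]_x (u x * \1_(hbox a b) x).
  rewrite (_ : (fun k => _) = (fun k => \int[leb]_x (u x * boxramp k a b x))).
    exact: boxramp_integral_cvg.
  by apply/funext => k; rewrite mollify_hbox.
suff cz : (fun k => \int[leb]_x (mollify u k x * \1_(hbox a b) x)) @ \oo -->
    \int[leb]_x (z x * \1_(hbox a b) x).
  by rewrite -(cvg_lim _ cu)// -(cvg_lim _ cz).
exact: (Rintg_mul_cvg mollify_sqint sz (sqint_indic a b) z2).
Qed.

End sobolev_embedding.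

(** The L^p bound on w_0 and the geometric bounds on the increments pass to the limit. *)
Lemma sobolev (R : realType) n (p : R) : (2 < n)%N -> 2 <= p -> p * (n%:R - 2) < 2 * n%:R ->
  exists2 C : R, 0 <= C & forall (u : 'rV[R]_n -> R) (g : 'I_n -> 'rV[R]_n -> R),
    sqint (lebesgue_rV R n) u ->
    (forall i, sqint (lebesgue_rV R n) (g i) /\ weak_partial i u (g i)) ->
    (\int[lebesgue_rV R n]_x (`|u x| `^ p)%:E <=
     (C * (\int[lebesgue_rV R n]_x (u x ^+ 2) +
       \sum_i \int[lebesgue_rV R n]_x (g i x ^+ 2)) `^ (p / 2))%:E)%E.
Proof.
move=> n3 p2 pn; have p0 : 0 < p by lra.
have [M M1 hM] := bell_bounded R.
have [C C0 HC] := Lp_limit (lebesgue_rV R n) p0 (lacunary_ratio_lt1 pn).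
have D0 : 0 <= diff_bound n M p by rewrite !mulr_ge0 ?powR_ge0.
have I0 : 0 <= init_bound n M p by rewrite mulr_ge0 ?powR_ge0 ?exprn_ge0.
exists (C * (diff_bound n M p + init_bound n M p)).
  by rewrite mulr_ge0// addr_ge0.
move=> u g su sg.
have n2 := ltnW n3.
have [z sz [zae zu]] := mollify_limit M1 hM n2 su sg.
set S := \int[_]_x (u x ^+ 2) + _.
have Sp : 0 <= S `^ (p / 2) by exact: powR_ge0.
have mz := sqint_measurable sz.
have mu_ := sqint_measurable su.
rewrite -mulrA.
rewrite (_ : (\int[_]_x _)%E = (\int[lebesgue_rV R n]_x (`|z x| `^ p)%:E)%E); last first.
  apply: ae_eq_integral => //.
  - apply/measurable_EFinP; apply: (measurableT_comp (measurable_powR p)).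
    exact: measurableT_comp.
  - apply/measurable_EFinP; apply: (measurableT_comp (measurable_powR p)).
    exact: measurableT_comp.
  - by apply: filterS zu => x /= h /h ->.
apply: (HC (mollify u)) => //.
- by move=> k; exact: (mollify_measurable M1 hM su).
- apply: (le_trans (mollify0_powR g M1 hM su p2)).
  by rewrite lee_fin ler_wpM2r// lerDr.
- move=> k; apply: (le_trans (mollify_diff_powR M1 hM n2 su sg k p2)).
  have /andP[r0 _] := lacunary_ratio_lt1 pn.
  by rewrite lee_fin ler_wpM2r ?exprn_ge0 ?(ltW r0)// ler_wpM2r// lerDl.
Qed.

(** * The space H^1 *)

Section test_functions.
Variables (R : realType) (n : nat).
Notation X := 'rV[R]_n.
Notation leb := (lebesgue_rV R n).
Implicit Types (phi : X -> R) (i : 'I_n).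

Lemma compact_le_norm (f : X -> R) (K : set X) : continuous f -> compact K ->
  exists B : R, forall x, K x -> `|f x| <= B.
Proof.
move=> cf cK.
have : compact (f @` K) by apply: continuous_compact => //; exact: continuous_subspaceT.
move=> /compact_bounded[M [_ hM]]; exists (M + 1) => x Kx.
by apply: (hM (M + 1)); [rewrite ltrDl|exists x].
Qed.

Lemma sqint_compact_support phi : continuous phi -> compact (closure [set x | phi x != 0]) ->
  sqint leb phi.
Proof.
move=> cphi cK; have [B hB] := compact_le_norm cphi cK.
have /choice[A hA] : forall i, exists A : R, forall x, closure [set x | phi x != 0] x -> `|x ord0 i| <= A.
  by move=> i; apply: (compact_le_norm _ cK); exact: coord_continuous.
pose b i := A i; pose a i := - A i - 1.
apply: (@sqint_le _ _ _ _ _ (fun x => B * \1_(hbox a b) x)).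
- exact: measurable_rV_continuous.
- by apply: sqintZ; exact: sqint_indic.
move=> x; have [->|px] := eqVneq (phi x) 0; first by rewrite normr0.
have Kx : closure [set x | phi x != 0] x by exact: subset_closure.
rewrite indicE mem_set ?mulr1; first by rewrite (le_trans (hB x Kx)) ?ler_norm.
move=> i; have := hA i x Kx; rewrite ler_norml /a /b => /andP[h1 h2].
by rewrite h2 andbT; lra.
Qed.

Lemma test_continuous phi : test_function phi -> continuous phi.
Proof. by case=> sm _ x; exact/differentiable_continuous/(sm [::]). Qed.

Lemma test_sqint phi : test_function phi -> sqint leb phi.
Proof. by move=> tp; apply: sqint_compact_support; [exact: test_continuous|case: tp]. Qed.

Lemma test_partial i phi : test_function phi -> test_function (partial i phi).
Proof.
move=> [sm cK]; split.
  by move=> s x; have := sm (rcons s i) x; rewrite -cats1 foldr_cat.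
apply: (subclosed_compact _ cK); first exact: closed_closure.
rewrite [Y in _ `<=` Y](closure_id _).1; last exact: closed_closure.
apply: closureS => x /=; apply: contraPP => xK; apply/negP; rewrite negbK; apply/eqP.
have ox : nbhs x (~` closure [set x | phi x != 0]).
  by apply: open_nbhs_nbhs; split => //; apply: closed_openC; exact: closed_closure.
rewrite /partial (_ : 'D__ _ _ = 'D_(delta_mx 0 i) (cst (0 : R)) x).
  by rewrite derive_cst.
apply: near_eq_derive.
apply: filterS ox => y /= yK; apply/eqP; apply: contrapT => /negP yn.
by apply: yK; exact: subset_closure.
Qed.

Lemma weak_partial_unique i (u g h : X -> R) : sqint leb g -> sqint leb h ->
  weak_partial i u g -> weak_partial i u h -> g = h %[ae leb].
Proof.
move=> sg sh wg wh.
suff : (fun x => g x - h x) = cst 0 %[ae leb].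
  by apply: filterS => x /= H /H /eqP; rewrite subr_eq0 => /eqP.
apply: weak_eq0; first exact: sqintB.
move=> phi tp; have sp := test_sqint tp.
rewrite /L2dot; under eq_Rintegral do rewrite mulrBl.
rewrite RintgB; [|exact: sqint_mul|exact: sqint_mul].
by have := wg _ tp; rewrite (wh _ tp) => /oppr_inj; rewrite /L2dot => ->; rewrite subrr.
Qed.

Lemma weak_partial_lin i a (u v g h : X -> R) : sqint leb u -> sqint leb v ->
  sqint leb g -> sqint leb h -> weak_partial i u g -> weak_partial i v h ->
  weak_partial i (fun x => a * u x + v x) (fun x => a * g x + h x).
Proof.
move=> su sv sg sh wg wh phi tp.
have sp := test_sqint tp; have sd := test_sqint (test_partial i tp).
have L (f k p : X -> R) : sqint leb f -> sqint leb k -> sqint leb p ->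
    L2dot (fun x => a * f x + k x) p = a * L2dot f p + L2dot k p.
  move=> sf sk sp'; rewrite /L2dot -RintgZ; last exact: sqint_mul.
  rewrite -RintgD; [|by apply: intgZ; exact: sqint_mul|exact: sqint_mul].
  by apply: eq_Rintegral => x _; rewrite mulrDl mulrA.
by rewrite !L// wg// wh// mulrN -opprD.
Qed.

End test_functions.

Section h1.
Variables (R : realType) (n : nat).
Notation X := 'rV[R]_n.
Notation leb := (lebesgue_rV R n).
Implicit Types (u v w : X -> R) (i : 'I_n) (W : X -> R).

Lemma H1P u : H1 u -> sqint leb u /\
  forall i, sqint leb (wpartial i u) /\ weak_partial i u (wpartial i u).
Proof.
move=> [su gu]; split => // i; have [g sg wg] := gu i.
exact: (@xgetPex _ (cst 0) [set g | L2 g /\ weak_partial i u g] (ex_intro _ g (conj sg wg))).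
Qed.

Lemma H1_sqint u : H1 u -> sqint leb u. Proof. by case. Qed.

Lemma wpartial_sqint u i : H1 u -> sqint leb (wpartial i u).
Proof. by move=> /H1P[_ /(_ i)[]]. Qed.

Lemma wpartial_eq u g i : H1 u -> sqint leb g -> weak_partial i u g ->
  wpartial i u = g %[ae leb].
Proof.
by move=> /H1P[_ /(_ i)[sw ww]] sg wg; exact: weak_partial_unique ww wg.
Qed.

Lemma H1_lin a u v : H1 u -> H1 v -> H1 (fun x => a * u x + v x).
Proof.
move=> /H1P[su gu] /H1P[sv gv]; split; first exact: sqint_lin.
move=> i; exists (fun x => a * wpartial i u x + wpartial i v x).
  by apply: sqint_lin; [exact: (gu i).1|exact: (gv i).1].
by have [s1 w1] := gu i; have [s2 w2] := gv i; exact: weak_partial_lin.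
Qed.

Lemma wpartial_lin a u v i : H1 u -> H1 v ->
  wpartial i (fun x => a * u x + v x) =
  (fun x => a * wpartial i u x + wpartial i v x) %[ae leb].
Proof.
move=> hu hv; have [su /(_ i)[s1 w1]] := H1P hu; have [sv /(_ i)[s2 w2]] := H1P hv.
apply: wpartial_eq; first exact: H1_lin.
  exact: sqint_lin.
exact: weak_partial_lin.
Qed.

Definition gradient_form u v : R := \sum_i L2dot (wpartial i u) (wpartial i v).

Definition weight_form W u v : R := \int[leb]_x (W x * (u x * v x)).

(** The symmetric bilinear form of Q for W = V, and the inner product of H^1 for W = 1. *)
Definition dirichlet W u v : R := gradient_form u v + weight_form W u v.

Definition bounded_weight W := measurable_fun setT W /\ exists K, forall x, `|W x| <= K.

Lemma bounded_weight_intg W u v : bounded_weight W -> sqint leb u -> sqint leb v ->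
  intg leb (fun x => W x * (u x * v x)).
Proof.
move=> [mW [K hK]] su sv.
have [mu_ mv_] := (sqint_measurable su, sqint_measurable sv).
apply: (@intg_le _ _ _ _ _ (fun x => K * `|u x * v x|)).
- by apply: measurable_funM => //; exact: measurable_funM.
- by apply: intgZ; apply: intg_norm; exact: sqint_mul.
- by move=> x; rewrite normrM ler_wpM2r.
Qed.

Lemma L2dotC (f g : X -> R) : L2dot f g = L2dot g f.
Proof. by apply: eq_Rintegral => x _; rewrite mulrC. Qed.

Lemma gradient_formC u v : gradient_form u v = gradient_form v u.
Proof. by apply: eq_bigr => i _; exact: L2dotC. Qed.

Lemma weight_formC W u v : weight_form W u v = weight_form W v u.
Proof. by apply: eq_Rintegral => x _; rewrite [u x * _]mulrC. Qed.

Lemma dirichletC W u v : dirichlet W u v = dirichlet W v u.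
Proof. by rewrite /dirichlet gradient_formC weight_formC. Qed.

Lemma L2dot_wpartial_lin i a u v w : H1 u -> H1 v -> H1 w ->
  L2dot (wpartial i (fun x => a * u x + v x)) (wpartial i w) =
  a * L2dot (wpartial i u) (wpartial i w) + L2dot (wpartial i v) (wpartial i w).
Proof.
move=> hu hv hw; rewrite /L2dot.
have [s1 [s2 s3]] := (wpartial_sqint i hu, (wpartial_sqint i hv, wpartial_sqint i hw)).
have m3 := sqint_measurable s3.
rewrite -RintgZ; last exact: sqint_mul.
rewrite -RintgD; [|by apply: intgZ; exact: sqint_mul|exact: sqint_mul].
apply: Rintg_ae.
- by apply: measurable_funM => //; apply: sqint_measurable; apply: wpartial_sqint; exact: H1_lin.
- by apply: (@intg_measurable _ _ _ leb); apply: intgD; [apply: intgZ; exact: sqint_mul|exact: sqint_mul].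
by apply: filterS (wpartial_lin a i hu hv) => x /= h /h ->; rewrite mulrDl mulrA.
Qed.

Lemma sum_lin (A B C : 'I_n -> R) (a : R) : (forall i, A i = a * B i + C i) ->
  \sum_i A i = a * \sum_i B i + \sum_i C i.
Proof. by move=> E; rewrite mulr_sumr -big_split; apply: eq_bigr => i _. Qed.

Lemma gradient_form_lin a u v w : H1 u -> H1 v -> H1 w ->
  gradient_form (fun x => a * u x + v x) w = a * gradient_form u w + gradient_form v w.
Proof. by move=> hu hv hw; apply: sum_lin => i; exact: L2dot_wpartial_lin. Qed.

Lemma weight_form_lin W a u v w : bounded_weight W -> H1 u -> H1 v -> H1 w ->
  weight_form W (fun x => a * u x + v x) w = a * weight_form W u w + weight_form W v w.
Proof.
move=> bW /H1_sqint su /H1_sqint sv /H1_sqint sw; rewrite /weight_form.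
rewrite -RintgZ; last exact: bounded_weight_intg.
rewrite -RintgD; [|apply: intgZ; exact: bounded_weight_intg|exact: bounded_weight_intg].
by apply: eq_Rintegral => x _; ring.
Qed.

Lemma dirichlet_lin W a u v w : bounded_weight W -> H1 u -> H1 v -> H1 w ->
  dirichlet W (fun x => a * u x + v x) w = a * dirichlet W u w + dirichlet W v w.
Proof.
move=> bW hu hv hw; rewrite /dirichlet gradient_form_lin// weight_form_lin//.
move: (gradient_form u w) (weight_form W u w) (gradient_form v w) (weight_form W v w).
by move=> p q r s; rewrite mulrDr addrACA.
Qed.

Lemma dirichlet_energy u V : bounded_weight V -> H1 u ->
  \int[leb]_x (sqgrad u x + V x * u x ^+ 2) = dirichlet V u u.
Proof.
move=> bV hu; have su := H1_sqint hu.
have Ig i : intg leb (fun x => wpartial i u x ^+ 2) by apply: sqint_sqr; exact: wpartial_sqint.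
rewrite RintgD; [|exact: intg_sum|exact: (bounded_weight_intg bV su su)].
rewrite /dirichlet /sqgrad Rintg_sum//.
Qed.

Lemma L2dot_ge0 (f : X -> R) : 0 <= L2dot f f.
Proof. by apply: Rintegral_ge0 => x _; rewrite -expr2 sqr_ge0. Qed.

Lemma weight_form1 u v : weight_form (cst 1) u v = L2dot u v.
Proof. by apply: eq_Rintegral => x _; rewrite mul1r. Qed.

Lemma gradient_form_ge0 u : 0 <= gradient_form u u.
Proof. by apply: sumr_ge0 => i _; exact: L2dot_ge0. Qed.

Lemma bounded_weight1 : bounded_weight (cst 1).
Proof. by split => //; exists 1 => x; rewrite normr1. Qed.
Hint Resolve bounded_weight1 : core.

Lemma dirichlet1_ge0 u : 0 <= dirichlet (cst 1) u u.
Proof.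
by rewrite /dirichlet weight_form1 addr_ge0 ?gradient_form_ge0 ?L2dot_ge0.
Qed.

Lemma H1norm_sqr u : H1 u -> H1norm u ^+ 2 = dirichlet (cst 1) u u.
Proof.
move=> hu; rewrite -dirichlet_energy// /H1norm sqr_sqrtr.
  by apply: eq_Rintegral => x _; rewrite mul1r.
apply: Rintegral_ge0 => x _; rewrite addr_ge0 ?sqr_ge0//.
by apply: sumr_ge0 => i _; exact: sqr_ge0.
Qed.

Lemma H1norm_ge0 u : 0 <= H1norm u. Proof. exact: sqrtr_ge0. Qed.
Hint Resolve H1norm_ge0 : core.

Lemma dirichlet_linr W a u v w : bounded_weight W -> H1 u -> H1 v -> H1 w ->
  dirichlet W w (fun x => a * u x + v x) = a * dirichlet W w u + dirichlet W w v.
Proof. by move=> *; rewrite dirichletC dirichlet_lin// !(dirichletC _ w). Qed.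

Lemma dirichlet_sqr_lin W a u v : bounded_weight W -> H1 u -> H1 v ->
  dirichlet W (fun x => a * u x + v x) (fun x => a * u x + v x) =
  a ^+ 2 * dirichlet W u u + 2 * a * dirichlet W u v + dirichlet W v v.
Proof.
move=> bW hu hv; rewrite dirichlet_lin ?dirichlet_linr//; [|exact: H1_lin].
by rewrite (dirichletC W v u); ring.
Qed.

Lemma H1_0 : H1 (cst 0 : X -> R).
Proof.
split; first exact: sqint0.
move=> i; exists (cst 0); first exact: sqint0.
move=> phi _; rewrite /L2dot.
have E (f : X -> R) : \int[leb]_x (cst 0 x * f x) = 0.
  by under eq_Rintegral do rewrite mul0r; rewrite /Rintegral integral0.
by rewrite !E oppr0.
Qed.

Lemma H1Z a u : H1 u -> H1 (fun x => a * u x).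
Proof.
move=> hu; have := H1_lin a hu H1_0.
by rewrite (_ : (fun x => _) = (fun x => a * u x))//; apply/funext => x; rewrite /cst addr0.
Qed.

Lemma dirichlet0 W w : bounded_weight W -> H1 w -> dirichlet W (cst 0) w = 0.
Proof.
move=> bW hw; have := dirichlet_lin (- 1) bW H1_0 H1_0 hw.
rewrite (_ : (fun x => _) = (cst 0 : X -> R)); last by apply/funext => x; rewrite /cst mulr0 addr0.
by rewrite mulN1r addNr.
Qed.

Lemma dirichletZ W a u w : bounded_weight W -> H1 u -> H1 w ->
  dirichlet W (fun x => a * u x) w = a * dirichlet W u w.
Proof.
move=> bW hu hw; have := dirichlet_lin a bW hu H1_0 hw.
rewrite dirichlet0// addr0 => <-.
by rewrite (_ : (fun x => _ + _) = (fun x => a * u x))//; apply/funext => x; rewrite /cst addr0.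
Qed.

Lemma H1normZ a u : H1 u -> H1norm (fun x => a * u x) = `|a| * H1norm u.
Proof.
move=> hu; apply/eqP; rewrite -(@eqrXn2 _ 2)// ?mulr_ge0// exprMn real_normK ?num_real//.
rewrite !H1norm_sqr//; last exact: H1Z.
by rewrite dirichletZ// ?(dirichletC _ u) ?dirichletZ//; [rewrite mulrA -expr2|exact: H1Z].
Qed.

Lemma H1_cauchy_schwarz u v : H1 u -> H1 v ->
  `|dirichlet (cst 1) u v| <= H1norm u * H1norm v.
Proof.
move=> hu hv; rewrite -(ler_pXn2r (n := 2))// ?nnegrE ?mulr_ge0//.
rewrite real_normK ?num_real// exprMn !H1norm_sqr//.
apply: discriminant_le; first exact: dirichlet1_ge0.
move=> t; have := dirichlet1_ge0 (fun x => t * u x + v x).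
by rewrite dirichlet_sqr_lin// mulrC [2 * t * _]mulrAC.
Qed.

Lemma H1normD u v : H1 u -> H1 v -> H1norm (fun x => u x + v x) <= H1norm u + H1norm v.
Proof.
move=> hu hv.
have -> : (fun x => u x + v x) = (fun x => 1 * u x + v x) by apply/funext => x; rewrite mul1r.
rewrite -(ler_pXn2r (n := 2))// ?nnegrE ?addr_ge0// H1norm_sqr; last exact: H1_lin.
rewrite dirichlet_sqr_lin// sqrrD -!H1norm_sqr// expr1n mul1r mulr1 lerD2r lerD2l.
rewrite mulr_natl lerMn2r/=; apply: (le_trans (ler_norm _)); exact: H1_cauchy_schwarz.
Qed.

Lemma wpartial_le i u : H1 u -> \int[leb]_x (wpartial i u x ^+ 2) <= H1norm u ^+ 2.
Proof.
move=> hu; rewrite H1norm_sqr// /dirichlet weight_form1.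
have -> : \int[leb]_x (wpartial i u x ^+ 2) = L2dot (wpartial i u) (wpartial i u).
  by apply: eq_Rintegral => x _; rewrite expr2.
rewrite /gradient_form (bigD1 i)//= -addrA lerDl addr_ge0 ?L2dot_ge0//.
by apply: sumr_ge0 => j _; exact: L2dot_ge0.
Qed.

Lemma L2_le u : H1 u -> \int[leb]_x (u x ^+ 2) <= H1norm u ^+ 2.
Proof.
move=> hu; rewrite H1norm_sqr// /dirichlet weight_form1.
have -> : \int[leb]_x (u x ^+ 2) = L2dot u u.
  by apply: eq_Rintegral => x _; rewrite expr2.
by rewrite lerDr gradient_form_ge0.
Qed.

Lemma L2dot_le (f g : X -> R) (a b : R) : 0 <= a -> 0 <= b -> sqint leb f -> sqint leb g ->
  \int[leb]_x (f x ^+ 2) <= a ^+ 2 -> \int[leb]_x (g x ^+ 2) <= b ^+ 2 ->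
  `|L2dot f g| <= a * b.
Proof.
move=> a0 b0 sf sg fa gb; rewrite -(ler_pXn2r (n := 2))// ?nnegrE ?mulr_ge0//.
rewrite real_normK ?num_real// exprMn.
apply: (le_trans (cauchy_schwarz sf sg)); apply: ler_pM => //;
  by apply: Rintegral_ge0 => x _; exact: sqr_ge0.
Qed.

Lemma dirichlet_bound W : bounded_weight W -> exists2 C, 0 < C & forall u v, H1 u -> H1 v ->
  `|dirichlet W u v| <= C * (H1norm u * H1norm v).
Proof.
move=> bW; have [mW [K hK]] := bW.
have K0 : 0 <= K by rewrite (le_trans _ (hK 0)).
exists (n%:R + (K + 1)); first by rewrite ltr_wpDl// ltr_wpDl.
move=> u v hu hv; have [su sv] := (H1_sqint hu, H1_sqint hv).
have P0 : 0 <= H1norm u * H1norm v by exact: mulr_ge0.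
rewrite mulrDl; apply: (le_trans (ler_normD _ _)); apply: lerD.
  apply: (le_trans (ler_norm_sum _ _ _)).
  apply: (@le_trans _ _ (\sum_(i < n) H1norm u * H1norm v)).
    by apply: ler_sum => i _; apply: L2dot_le => //; [exact: wpartial_sqint|exact: wpartial_sqint|
      exact: wpartial_le|exact: wpartial_le].
  by rewrite sumr_const card_ord -[leLHS]mulr_natl.
apply: (le_trans (Rintg_norm (bounded_weight_intg bW su sv))).
apply: (@le_trans _ _ (\int[leb]_x (K * (`|u x| * `|v x|)))).
  apply: Rintg_le.
  - by apply: intg_norm; exact: bounded_weight_intg.
  - by apply: intgZ; under eq_fun do rewrite -normrM; apply: intg_norm; exact: sqint_mul.
  - by move=> x; rewrite !normrM ler_wpM2r// mulr_ge0.
have sn (f : X -> R) : sqint leb f -> sqint leb (fun x => `|f x|).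
  move=> sf; apply: (sqint_le _ sf) => [|x]; last by rewrite normr_id.
  by apply: measurableT_comp => //; exact: sqint_measurable sf.
have [snu snv] := (sn u su, sn v sv).
rewrite RintgZ; last exact: sqint_mul.
rewrite mulrDl mul1r; apply: (@le_trans _ _ (K * (H1norm u * H1norm v))); last by rewrite lerDl.
apply: ler_wpM2l => //; apply: (le_trans (ler_norm _)); apply: L2dot_le => //.
  by under eq_Rintegral do rewrite real_normK ?num_real//; exact: L2_le.
by under eq_Rintegral do rewrite real_normK ?num_real//; exact: L2_le.
Qed.

Lemma H1norm_sqrE u : H1 u ->
  H1norm u ^+ 2 = \int[leb]_x (u x ^+ 2) + \sum_i \int[leb]_x (wpartial i u x ^+ 2).
Proof. by move=> hu; rewrite H1norm_sqr// /dirichlet weight_form1 addrC. Qed.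

Lemma H1norm_ae u (g : 'I_n -> X -> R) (z : X -> R) : H1 u -> sqint leb z ->
  (forall i, sqint leb (g i)) -> u = z %[ae leb] ->
  (forall i, wpartial i u = g i %[ae leb]) ->
  H1norm u ^+ 2 = \int[leb]_x (z x ^+ 2) + \sum_i \int[leb]_x (g i x ^+ 2).
Proof.
move=> hu sz sg uz ug; rewrite H1norm_sqrE//.
have E (f h : X -> R) : sqint leb f -> sqint leb h -> f = h %[ae leb] ->
    \int[leb]_x (f x ^+ 2) = \int[leb]_x (h x ^+ 2).
  move=> /sqint_measurable mf /sqint_measurable mh fh.
  apply: Rintg_ae; [exact: measurable_funX|exact: measurable_funX|].
  by apply: filterS fh => x /= H /H ->.
rewrite (E u z (H1_sqint hu) sz uz).
by under eq_bigr => i _ do rewrite (E _ _ (wpartial_sqint i hu) (sg i) (ug i)).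
Qed.

Lemma H1_sub u v : H1 u -> H1 v -> H1 (u - v).
Proof.
move=> hu hv; have := H1_lin (- 1) hv hu.
by rewrite (_ : (fun x => _) = u - v)//; apply/funext => x; rewrite mulN1r addrC.
Qed.

Lemma wpartial_sub i u v : H1 u -> H1 v ->
  wpartial i (u - v) = (fun x => wpartial i u x - wpartial i v x) %[ae leb].
Proof.
move=> hu hv; have := wpartial_lin (- 1) i hv hu.
rewrite (_ : (fun x => - 1 * v x + u x) = u - v); last by apply/funext => x; rewrite mulN1r addrC.
by apply: filterS => x /= h /h ->; rewrite mulN1r addrC.
Qed.

Lemma H1norm_sub u v : H1 u -> H1 v -> H1norm (u - v) ^+ 2 =
  \int[leb]_x ((u x - v x) ^+ 2) + \sum_i \int[leb]_x ((wpartial i u x - wpartial i v x) ^+ 2).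
Proof.
move=> hu hv; apply: H1norm_ae.
- exact: H1_sub.
- by apply: sqintB; exact: H1_sqint.
- by move=> i; apply: sqintB; exact: wpartial_sqint.
- exact: aeW.
- by move=> i; exact: wpartial_sub.
Qed.

(** The sequence and each of its weak derivatives converge in L^2, and the identities
    defining weak derivatives are preserved in the limit. *)
Lemma H1_complete (w : nat -> X -> R) (C : R) : (forall k, H1 (w k)) ->
  (forall k, H1norm (w k.+1 - w k) <= C / 2 ^+ k) ->
  exists2 z, H1 z & (fun k => H1norm (w k - z)) @ \oo --> (0 : R).
Proof.
move=> hw wC.
have sqC k : H1norm (w k.+1 - w k) ^+ 2 <= C ^+ 2 / 4 ^+ k.
  have -> : C ^+ 2 / 4 ^+ k = (C / 2 ^+ k) ^+ 2.
    have four : (4 : R) = 2 ^+ 2 by rewrite -natrX.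
    by rewrite four expr_div_n -!exprM mulnC.
  by rewrite lerXn2r ?nnegrE// (le_trans _ (wC k)).
have I0 (f : X -> R) : 0 <= \int[leb]_x (f x ^+ 2) by apply: Rintegral_ge0 => x _; exact: sqr_ge0.
have [z [sz zw _]] : exists z, [/\ sqint leb z,
    (fun k => \int[leb]_x ((w k x - z x) ^+ 2)) @ \oo --> (0 : R) &
    {ae leb, forall x, (fun k => w k x) @ \oo --> z x}].
  apply: (@riesz_fischer _ _ _ leb w (C ^+ 2)) => [k|k]; first exact: H1_sqint.
  apply: le_trans (sqC k); rewrite (H1norm_sub (hw k.+1) (hw k)) lerDl.
  exact: sumr_ge0.
have /choice[g gP] : forall i, exists g, sqint leb g /\
    (fun k => \int[leb]_x ((wpartial i (w k) x - g x) ^+ 2)) @ \oo --> (0 : R).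
  move=> i; have [g [sg gw _]] : exists z, [/\ sqint leb z,
      (fun k => \int[leb]_x ((wpartial i (w k) x - z x) ^+ 2)) @ \oo --> (0 : R) &
      {ae leb, forall x, (fun k => wpartial i (w k) x) @ \oo --> z x}].
    apply: (@riesz_fischer _ _ _ leb (fun k => wpartial i (w k)) (C ^+ 2)) => [k|k].
      exact: wpartial_sqint.
    apply: le_trans (sqC k); rewrite (H1norm_sub (hw k.+1) (hw k)) (bigD1 i)//= addrCA lerDl.
    by rewrite addr_ge0// sumr_ge0.
  by exists g.
have wg i : weak_partial i z (g i).
  move=> phi tp; have [sg gw] := gP i.
  have c1 := Rintg_mul_cvg (fun k => H1_sqint (hw k)) sz (test_sqint (test_partial i tp)) zw.
  have c2 := Rintg_mul_cvg (fun k => wpartial_sqint i (hw k)) sg (test_sqint tp) gw.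
  rewrite /L2dot -(cvg_lim _ c1)//.
  rewrite (_ : (fun k => _) = (fun k => - \int[leb]_x (wpartial i (w k) x * phi x))).
    by apply: cvg_lim => //; exact: cvgN.
  apply/funext => k; have [_ /(_ i)[_]] := H1P (hw k).
  exact.
have hz : H1 z by split => // i; exists (g i) => //; exact: (gP i).1.
exists z => //.
have sq0 : (fun k => H1norm (w k - z) ^+ 2) @ \oo --> (0 : R).
  rewrite (_ : (fun k => _) = (fun k => \int[leb]_x ((w k x - z x) ^+ 2) +
      \sum_i \int[leb]_x ((wpartial i (w k) x - g i x) ^+ 2))).
    rewrite -[X in _ --> X]addr0; apply: cvgD => //.
    rewrite [X in _ --> X](_ : 0 = \sum_(i < n) (0 : R)); last by rewrite big1.
    apply: cvg_big => [|i _]; first exact: add_continuous.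
    exact: (gP i).2.
  apply/funext => k; apply: H1norm_ae.
  - exact: H1_sub.
  - by apply: sqintB => //; exact: H1_sqint.
  - by move=> i; apply: sqintB; [exact: wpartial_sqint|exact: (gP i).1].
  - exact: aeW.
  - move=> i; have := wpartial_sub i (hw k) hz.
    have := wpartial_eq hz (gP i).1 (wg i).
    by apply: filterS2 => x /= h1 h2 _; rewrite h2// h1.
have -> : (fun k => H1norm (w k - z)) = (fun k => Num.sqrt (H1norm (w k - z) ^+ 2)).
  by apply/funext => k; rewrite sqrtr_sqr ger0_norm.
rewrite -[X in _ --> X](sqrtr0 R).
exact: (cvg_comp _ _ sq0 (@sqrt_continuous R 0)).
Qed.

Lemma H1norm_eq0 u : H1 u -> H1norm u = 0 -> u = cst 0 %[ae leb].
Proof.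
move=> hu nu0; have I0 : \int[leb]_x (u x ^+ 2) = 0.
  apply/eqP; rewrite eq_le (le_trans (L2_le hu)) ?nu0 ?expr0n//=.
  by apply: Rintegral_ge0 => x _; exact: sqr_ge0.
have := Rintg_eq0_ae (sqint_sqr (H1_sqint hu)) (fun x => sqr_ge0 (u x)) I0.
by apply: filterS => x /= h /h /eqP; rewrite sqrf_eq0 => /eqP.
Qed.

Lemma H1_sobolev p : (2 < n)%N -> 2 <= p -> p * (n%:R - 2) < 2 * n%:R ->
  exists2 C : R, 0 <= C & forall u, H1 u -> intg leb (fun x => `|u x| `^ p) /\
    \int[leb]_x (`|u x| `^ p) <= C * H1norm u `^ p.
Proof.
move=> n3 p2 pn; have [C C0 hC] := sobolev n3 p2 pn; exists C => // u hu.
have [su gu] := H1P hu; have H := hC u (fun i => wpartial i u) su gu.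
have I : intg leb (fun x => `|u x| `^ p).
  apply/integrableP; split.
    apply/measurable_EFinP; apply: (measurableT_comp (measurable_powR p)).
    by apply: measurableT_comp => //; exact: sqint_measurable su.
  under eq_integral do rewrite /= ger0_norm ?powR_ge0//.
  exact: le_lt_trans H (ltry _).
split => //; rewrite -lee_fin -intgE//; apply: (le_trans H).
rewrite -H1norm_sqrE// lee_fin -[_ ^+ 2]powR_mulrn// -powRrM.
by have -> : 2%:R * (p / 2) = p by field.
Qed.

End h1.

(** * Periodic weights and powers of H^1 functions *)

Section periodic.
Variables (R : realType) (n : nat) (V : 'rV[R]_n -> R).
Hypothesis cV : continuous V.
Hypothesis perV : forall i x, V (x + delta_mx 0 i) = V x.

Let perVn i x m : V (x + m%:R *: delta_mx 0 i) = V x.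
Proof.
elim: m => [|m IHm]; first by rewrite scale0r addr0.
by rewrite -natr1 scalerDl scale1r addrA perV.
Qed.

Let perVz i x (m : int) : V (x + m%:~R *: delta_mx 0 i) = V x.
Proof.
case: m => m; first exact: perVn.
rewrite NegzE -[LHS](perVn i _ m.+1) -addrA -scalerDl.
by rewrite mulrNz addNr scale0r addr0.
Qed.

Let perVs x (c : 'I_n -> int) (s : seq 'I_n) :
  V (x + \sum_(i <- s) (c i)%:~R *: delta_mx 0 i) = V x.
Proof.
elim: s x => [|i s IHs] x; first by rewrite big_nil addr0.
by rewrite big_cons addrA IHs perVz.
Qed.

(** Subtracting the integer parts of the coordinates moves a point into the unit cube. *)
Lemma periodic_bounded : exists K, forall x, `|V x| <= K.
Proof.
pose Q := [set y : 'rV[R]_n | forall i, `[0, 1]%classic (y ord0 i)].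
have cQ : compact Q.
  by apply: (@rV_compact R n (fun=> `[0, 1]%classic)) => i; exact: segment_compact.
have [K hK] := compact_le_norm cV cQ; exists K => x.
pose c i : int := - Num.floor (x ord0 i).
rewrite -(perVs x c (index_enum _)); apply: hK => j.
rewrite mxE summxE (bigD1 j)//= big1 => [|i ij]; last first.
  by rewrite !mxE eqxx eq_sym (negbTE ij) mulr0.
rewrite !mxE !eqxx mulr1 addr0 in_itv/= /c mulrNz subr_ge0 floor_le/=.
by rewrite lerBlDl ltW// -[_ + 1]intrD1 floorD1_gt.
Qed.

End periodic.

Section powers.
Variable R : realType.
Implicit Types (a b q r : R).

Lemma powR_mixed_le q a b : 0 <= q -> 0 <= a -> 0 <= b ->
  a `^ q * b ^+ 2 <= a `^ (q + 2) + b `^ (q + 2).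
Proof.
move=> q0 a0 b0.
have E c : 0 <= c -> c `^ (q + 2) = c `^ q * c ^+ 2.
  move=> c0; rewrite powRD ?powR_mulrn//; apply/implyP => h.
  by move: h; rewrite (gt_eqF (_ : 0 < q + 2))// ltr_wpDl.
rewrite !E//; have [ab|ba] := leP a b.
  rewrite ler_wpDl ?mulr_ge0 ?powR_ge0 ?sqr_ge0// ler_wpM2r ?sqr_ge0//.
  by apply: ge0_ler_powR; rewrite ?nnegrE.
rewrite ler_wpDr ?mulr_ge0 ?powR_ge0 ?sqr_ge0// ler_wpM2l ?powR_ge0//.
by rewrite lerXn2r ?nnegrE// ltW.
Qed.

Lemma powRD_le q a b : 0 <= q -> 0 <= a -> 0 <= b ->
  (a + b) `^ q <= 2 `^ q * (a `^ q + b `^ q).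
Proof.
move=> q0 a0 b0; rewrite mulrDr -!powRM//.
have [ab|ba] := leP a b.
  by rewrite ler_wpDl ?powR_ge0//; apply: ge0_ler_powR; rewrite ?nnegrE ?mulr_ge0 ?addr_ge0//; lra.
by rewrite ler_wpDr ?powR_ge0//; apply: ge0_ler_powR; rewrite ?nnegrE ?mulr_ge0 ?addr_ge0//; lra.
Qed.

End powers.

Section nemytskii.
Variables (R : realType) (n : nat) (q : R).
Notation X := 'rV[R]_n.
Notation leb := (lebesgue_rV R n).
Implicit Types (u v : X -> R).
Hypothesis n3 : (2 < n)%N.
Hypothesis q0 : 0 <= q.
Hypothesis qn : (q + 2) * (n%:R - 2) < 2 * n%:R.

Let q2 : 2 <= q + 2. Proof. by rewrite lerDr. Qed.

Let mpow u s : measurable_fun setT u -> measurable_fun setT (fun x => `|u x| `^ s).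
Proof.
move=> mu_; apply: (measurableT_comp (measurable_powR s)).
exact: measurableT_comp.
Qed.

Lemma mixed_intg u v : H1 u -> H1 v -> intg leb (fun x => `|u x| `^ q * v x ^+ 2).
Proof.
have [C C0 hC] := H1_sobolev n3 q2 qn.
move=> hu hv; have [Iu _] := hC u hu; have [Iv _] := hC v hv.
have [mu_ mv_] := (sqint_measurable (H1_sqint hu), sqint_measurable (H1_sqint hv)).
apply: (intg_le _ (intgD Iu Iv)).
  by apply: measurable_funM; [exact: mpow|exact: measurable_funX].
move=> x; rewrite [leLHS]ger0_norm; last by apply: mulr_ge0; rewrite ?powR_ge0 ?sqr_ge0.
by rewrite -[v x ^+ 2]real_normK ?num_real//; exact: powR_mixed_le.
Qed.

(** The integrand is at most |u|^(q+2) + |v|^(q+2), but this bound is not quadratic in v;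
    it becomes so after v is rescaled to norm r. *)
Lemma mixed_bound r : 0 < r -> exists2 K, 0 <= K & forall u v, H1 u -> H1 v ->
  H1norm u <= r -> \int[leb]_x (`|u x| `^ q * v x ^+ 2) <= K * H1norm v ^+ 2.
Proof.
move=> r0; have p0 : 0 < q + 2 by rewrite ltr_wpDl.
have [C C0 hC] := H1_sobolev n3 q2 qn.
exists (C * 2 * r `^ (q + 2) / r ^+ 2).
  by rewrite divr_ge0 ?sqr_ge0// !mulr_ge0 ?powR_ge0.
move=> u v hu hv ur.
have [mu_ mv_] := (sqint_measurable (H1_sqint hu), sqint_measurable (H1_sqint hv)).
have := H1norm_ge0 v; rewrite le_eqVlt => /predU1P[v0|v0].
  have ae0 := H1norm_eq0 hv (esym v0).
  have -> : \int[leb]_x (`|u x| `^ q * v x ^+ 2) = \int[leb]_x (cst 0 x).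
    apply: Rintg_ae => //.
      by apply: measurable_funM; [exact: mpow|exact: measurable_funX].
    by apply: filterS ae0 => x /= h /h ->; rewrite expr0n mulr0.
  by rewrite /Rintegral integral0 -v0 expr0n mulr0.
set N := H1norm v; pose l := r / N.
have l0 : 0 < l by rewrite divr_gt0.
pose w x := l * v x; have hw : H1 w by exact: H1Z.
have wr : H1norm w = r by rewrite H1normZ// gtr0_norm// divfK// gt_eqF.
have [Iu Ju] := hC u hu; have [Iw Jw] := hC w hw.
have -> : \int[leb]_x (`|u x| `^ q * v x ^+ 2) = (l ^+ 2)^-1 * \int[leb]_x (`|u x| `^ q * w x ^+ 2).
  rewrite -RintgZ; last exact: mixed_intg.
  apply: eq_Rintegral => x _; rewrite /w [(l * v x) ^+ 2]exprMn [X in _ = _ * X]mulrCA mulKf//.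
  by rewrite expf_neq0// gt_eqF.
have -> : C * 2 * r `^ (q + 2) / r ^+ 2 * N ^+ 2 = (l ^+ 2)^-1 * (C * r `^ (q + 2) + C * r `^ (q + 2)).
  rewrite /l; move: (r `^ _) => rp; field.
  by rewrite !gt_eqF.
rewrite ler_wpM2l ?invr_ge0 ?sqr_ge0//.
apply: (@le_trans _ _ (\int[leb]_x (`|u x| `^ (q + 2) + `|w x| `^ (q + 2)))).
  apply: Rintg_le; [exact: mixed_intg|exact: intgD|move=> x].
  by rewrite -[w x ^+ 2]real_normK ?num_real//; exact: powR_mixed_le.
rewrite RintgD//; apply: lerD.
  apply: (le_trans Ju); rewrite ler_wpM2l//; apply: ge0_ler_powR; rewrite ?nnegrE ?H1norm_ge0//; exact: ltW.
by rewrite -[in leRHS]wr.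
Qed.

Lemma mixedD_intg u v : H1 u -> H1 v ->
  intg leb (fun x => (`|u x| + `|v x|) `^ q * v x ^+ 2).
Proof.
move=> hu hv.
have [mu_ mv_] := (sqint_measurable (H1_sqint hu), sqint_measurable (H1_sqint hv)).
apply: (intg_le _ (intgZ (2 `^ q) (intgD (mixed_intg hu hv) (mixed_intg hv hv)))).
  apply: measurable_funM; last exact: measurable_funX.
  apply: (measurableT_comp (measurable_powR q)).
  by apply: measurable_funD; exact: measurableT_comp.
move=> x; rewrite [leLHS]ger0_norm; last by apply: mulr_ge0; rewrite ?powR_ge0 ?sqr_ge0.
by rewrite -mulrDl mulrA ler_wpM2r ?sqr_ge0//; exact: powRD_le.
Qed.

Lemma mixedD_bound r : 0 < r -> exists2 K, 0 <= K & forall u v, H1 u -> H1 v ->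
  H1norm u <= r -> H1norm v <= r ->
  \int[leb]_x ((`|u x| + `|v x|) `^ q * v x ^+ 2) <= K * H1norm v ^+ 2.
Proof.
move=> /mixed_bound[K K0 hK]; exists (2 `^ q * (K + K)); first by rewrite mulr_ge0 ?powR_ge0 ?addr_ge0.
move=> u v hu hv ur vr.
apply: (@le_trans _ _ (\int[leb]_x (2 `^ q * (`|u x| `^ q * v x ^+ 2 + `|v x| `^ q * v x ^+ 2)))).
  apply: Rintg_le; [exact: mixedD_intg|by apply: intgZ; apply: intgD; exact: mixed_intg|move=> x].
  by rewrite -mulrDl mulrA ler_wpM2r ?sqr_ge0//; exact: powRD_le.
rewrite RintgZ; last by apply: intgD; exact: mixed_intg.
rewrite RintgD; [|exact: mixed_intg|exact: mixed_intg].
rewrite -mulrA ler_wpM2l ?powR_ge0// mulrDl.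
by apply: lerD; exact: hK.
Qed.

End nemytskii.

(** * The energy functional *)

Section functional.
Variables (R : realType) (n : nat) (V : 'rV[R]_n -> R) (f : 'rV[R]_n -> R -> R) (C q : R).
Notation X := 'rV[R]_n.
Notation leb := (lebesgue_rV R n).
Implicit Types (u v w : X -> R) (x : X) (s t : R).
Hypothesis n3 : (2 < n)%N.
Hypothesis q0 : 0 <= q.
Hypothesis qn : (q + 2) * (n%:R - 2) < 2 * n%:R.
Hypothesis bV : bounded_weight V.
Hypothesis f_cont : forall s, continuous (f ^~ s).
Hypothesis f_derivable : forall x s, derivable (f x) s 1.
Hypothesis C0 : 0 < C.
Hypothesis df_growth : forall x s, `|derive1 (f x) s| <= C * (1 + `|s| `^ q).
Hypothesis f_small : SW3 f.
Hypothesis f_ratio : SW5 f.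

Let F := primitive f.

Let half_add_le0 (d i : R) : d <= 0 -> i <= 0 -> 2^-1 * d + i <= 0.
Proof. by move=> *; lra. Qed.

Let half_add_ge0 (d i : R) : d <= 0 -> 0 = 2^-1 * d + i -> - i <= 0.
Proof. by move=> *; lra. Qed.

Let f_contr x : continuous (f x).
Proof. by move=> s; apply/differentiable_continuous/derivable1_diffP. Qed.

Let F_derive x s : is_derive s 1 (F x) (f x s).
Proof. exact: is_derive_oriented_integral. Qed.

Let F_contr x : continuous (F x).
Proof. by move=> s; apply/differentiable_continuous/derivable1_diffP; case: (F_derive x s). Qed.

Let F0 x : F x 0 = 0.
Proof. by rewrite /F /primitive lexx set_itv1 Rintegral_set1. Qed.

Let f_small_at x (e : R) : 0 < e -> exists2 d : R, 0 < d &
  forall s, `|s| < d -> `|f x s| <= e * `|s|.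
Proof. by move=> /f_small[d d0 h]; exists d => // s; exact: h. Qed.

Let f_growth x s : `|f x s| <= C * (1 + `|s| `^ q) * `|s|.
Proof. exact: (nonlin_growth (@f_derivable x) C0 q0 (df_growth x) (f_small_at x)). Qed.

Let F_taylor x s (r : R) :
  0 <= F x (s + r) - F x s - f x s * r <= C * (1 + (`|s| + `|r|) `^ q) * r ^+ 2.
Proof.
exact: (primitive_taylor (@f_derivable x) C0 q0 (df_growth x) (f_small_at x)
  (f_ratio x) (F_derive x)).
Qed.

Let F_bounds x s : 0 <= F x s <= C * (1 + `|s| `^ q) * s ^+ 2.
Proof.
exact: (primitive_bounds (@f_derivable x) C0 q0 (df_growth x) (f_small_at x)
  (f_ratio x) (F_derive x) (F0 x)).
Qed.

Lemma measurable_nonlinearity u : measurable_fun setT u -> measurable_fun setT (fun x => f x (u x)).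
Proof.
move=> mu_; apply: (@measurable_caratheodory _ _ _ _ _ f (fun x : X => x)) => //.
by move=> s; apply: measurable_rV_continuous; exact: f_cont.
Qed.

Lemma measurable_primitive u : measurable_fun setT u -> measurable_fun setT (fun x => F x (u x)).
Proof.
move=> mu_; apply: (@measurable_caratheodory _ _ _ _ _ F (fun x : X => x)) => // s.
have mf2 : measurable_fun setT (fun z : X * R => f z.1 z.2).
  apply: (@measurable_caratheodory _ _ _ _ _ f fst snd) => //.
  by move=> t; apply: measurable_rV_continuous; exact: f_cont.
have mI (a b : R) : measurable_fun setT (fun x : X => \int[lebesgue_measure]_(t in `[a, b]) f x t).
  rewrite (_ : (fun x => _) = (fun x : X => \int[lebesgue_measure]_t (f x t * \1_(`[a, b]) t))).
    apply: (@measurable_Rintegral_param _ _ _ _ _ lebesgue_measure (fun z : X * R => f z.1 z.2 * \1_(`[a, b]) z.2)).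
    apply: measurable_funM => //.
    by apply: measurableT_comp; [exact: measurable_indic|exact: measurable_snd].
  apply/funext => x; rewrite /Rintegral integral_mkcond; congr fine; apply: eq_integral => t _.
  by rewrite patchE indicE; case: ifP; rewrite ?mulr1 ?mulr0.
rewrite /F /primitive; case: (0 <= s); first exact: mI.
by apply: measurableT_comp => //; exact: mI.
Qed.

Let mH u : H1 u -> measurable_fun setT u.
Proof. by move=> hu; exact: sqint_measurable (H1_sqint hu). Qed.

Let Iq u v : H1 u -> H1 v -> intg leb (fun x => C * (v x ^+ 2 + `|u x| `^ q * v x ^+ 2)).
Proof.
by move=> hu hv; apply: intgZ; apply: intgD; [exact: sqint_sqr (H1_sqint hv)|exact: mixed_intg].
Qed.

Let IqD u v : H1 u -> H1 v ->
  intg leb (fun x => C * (v x ^+ 2 + (`|u x| + `|v x|) `^ q * v x ^+ 2)).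
Proof.
by move=> hu hv; apply: intgZ; apply: intgD; [exact: sqint_sqr (H1_sqint hv)|exact: mixedD_intg].
Qed.

Lemma primitive_intg u : H1 u -> intg leb (fun x => F x (u x)).
Proof.
move=> hu; apply: (intg_le _ (Iq hu hu)); first by apply: measurable_primitive; exact: mH.
move=> x; have /andP[h1 h2] := F_bounds x (u x).
by rewrite ger0_norm// (le_trans h2)// -mulrA mulrDl mul1r.
Qed.

Let f_young x s (r : R) : `|f x s * r| <= C * (s ^+ 2 + `|s| `^ q * s ^+ 2) + C * (r ^+ 2 + `|s| `^ q * r ^+ 2).
Proof.
rewrite normrM; apply: (le_trans (ler_wpM2r (normr_ge0 r) (f_growth x s))).
rewrite -mulrDr -!mulrA ler_pM2l// -[s ^+ 2]real_normK ?num_real// -[r ^+ 2]real_normK ?num_real//.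
have := powR_ge0 `|s| q; move: (`|s| `^ q) => a a0.
move: `|s| `|r| (normr_ge0 s) (normr_ge0 r) => b c b0 c0.
have -> : b ^+ 2 + a * b ^+ 2 + (c ^+ 2 + a * c ^+ 2) = (1 + a) * (b ^+ 2 + c ^+ 2) by ring.
rewrite ler_wpM2l ?addr_ge0//.
have h : 0 <= (b - c) ^+ 2 by exact: sqr_ge0.
have h2 : 0 <= b * c by exact: mulr_ge0.
rewrite sqrrB in h; lra.
Qed.

Lemma nonlinearity_intg u v : H1 u -> H1 v -> intg leb (fun x => f x (u x) * v x).
Proof.
move=> hu hv; apply: (intg_le _ (intgD (Iq hu hu) (Iq hu hv))).
  by apply: measurable_funM; [apply: measurable_nonlinearity; exact: mH|exact: mH].
by move=> x; exact: f_young.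
Qed.

Definition denergy u v : R := dirichlet V u v - \int[leb]_x (f x (u x) * v x).

Lemma denergy_lin u a v w : H1 u -> H1 v -> H1 w ->
  denergy u (fun x => a * v x + w x) = a * denergy u v + denergy u w.
Proof.
move=> hu hv hw; rewrite /denergy dirichlet_linr//.
have -> : \int[leb]_x (f x (u x) * (a * v x + w x)) =
    a * \int[leb]_x (f x (u x) * v x) + \int[leb]_x (f x (u x) * w x).
  rewrite -RintgZ; last exact: nonlinearity_intg.
  rewrite -RintgD; [|by apply: intgZ; exact: nonlinearity_intg|exact: nonlinearity_intg].
  by apply: eq_Rintegral => x _; ring.
move: (dirichlet V u v) (dirichlet V u w) => d1 d2; ring.
Qed.

Lemma energyE u : H1 u -> energy V f u = 2^-1 * dirichlet V u u - \int[leb]_x F x (u x).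
Proof. by move=> hu; rewrite /energy /Q dirichlet_energy. Qed.

Lemma energy_expand u v : H1 u -> H1 v ->
  energy V f (fun x => u x + v x) - energy V f u - denergy u v =
  2^-1 * dirichlet V v v - \int[leb]_x (F x (u x + v x) - F x (u x) - f x (u x) * v x).
Proof.
move=> hu hv.
have huv : H1 (fun x => 1 * u x + v x) by exact: H1_lin.
have E : (fun x => u x + v x) = (fun x => 1 * u x + v x) by apply/funext => x; rewrite mul1r.
have huv' : H1 (fun x => u x + v x) by rewrite E.
have Iuv := primitive_intg huv'; have Iu := primitive_intg hu.
rewrite RintgB; [|exact: (intgB Iuv Iu)|exact: nonlinearity_intg].
rewrite (RintgB Iuv Iu).
rewrite !energyE//.
have -> : dirichlet V (fun x => u x + v x) (fun x => u x + v x) =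
    dirichlet V u u + 2 * dirichlet V u v + dirichlet V v v.
  by rewrite E dirichlet_sqr_lin// expr1n mul1r mulr1.
rewrite /denergy; move: (dirichlet V u u) (dirichlet V u v) (dirichlet V v v) => d1 d2 d3.
by move: (\int[_]_x _) (\int[_]_x _) (\int[_]_x _) => i1 i2 i3; field.
Qed.

Lemma energy_taylor r : exists2 K, 0 < K & forall u v, H1 u -> H1 v ->
  H1norm u <= r -> H1norm v <= r ->
  `|energy V f (fun x => u x + v x) - energy V f u - denergy u v| <= K * H1norm v ^+ 2.
Proof.
have [D D0 hD] := dirichlet_bound bV.
have r0 : 0 < `|r| + 1 by rewrite ltr_wpDl.
have [K K0 hK] := mixedD_bound n3 q0 qn r0.
exists (2^-1 * D + C * (1 + K)).
  by rewrite ltr_pwDl ?mulr_gt0// mulr_ge0 ?addr_ge0// ltW.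
move=> u v hu hv ur vr; rewrite energy_expand//.
have rr : r <= `|r| + 1 by rewrite (le_trans (ler_norm r))// lerDl.
have := hK u v hu hv (le_trans ur rr) (le_trans vr rr) => hK'.
have hD' := hD v v hv hv; rewrite mulrDl.
apply: (le_trans (ler_normB _ _)); apply: lerD.
  by rewrite normrM gtr0_norm ?invr_gt0// -mulrA ler_wpM2l ?invr_ge0// expr2.
have mG : measurable_fun setT (fun x => F x (u x + v x) - F x (u x) - f x (u x) * v x).
  apply: measurable_funB; last by apply: measurable_funM; [apply: measurable_nonlinearity; exact: mH|exact: mH].
  apply: measurable_funB; apply: measurable_primitive; last exact: mH.
  by apply: measurable_funD; exact: mH.
have leG x : `|F x (u x + v x) - F x (u x) - f x (u x) * v x| <=
    C * (v x ^+ 2 + (`|u x| + `|v x|) `^ q * v x ^+ 2).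
  have /andP[h1 h2] := F_taylor x (u x) (v x).
  by rewrite ger0_norm// (le_trans h2)// -mulrA mulrDl mul1r.
have IG := intg_le mG (IqD hu hv) leG.
apply: (le_trans (Rintg_norm IG)).
apply: (le_trans (Rintg_le (intg_norm IG) (IqD hu hv) leG)).
have I2 := sqint_sqr (H1_sqint hv); have Im := mixedD_intg n3 q0 qn hu hv.
rewrite RintgZ; last exact: intgD.
rewrite RintgD// -mulrA ler_pM2l// mulrDl mul1r; apply: lerD => //.
exact: L2_le.
Qed.

(** Young's inequality bounds the integral of f(x, u) t v by a quadratic polynomial in t,
    for every real t; the linear bound in v is the sign of its discriminant. *)
Lemma denergy_bound r : exists2 K, 0 < K & forall u v, H1 u -> H1 v ->
  H1norm u <= r -> `|denergy u v| <= K * H1norm v.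
Proof.
have [D D0 hD] := dirichlet_bound bV.
pose r' : R := `|r| + 1.
have r0 : 0 < r' by rewrite ltr_wpDl.
have [K K0 hK] := mixed_bound n3 q0 qn r0.
pose A := C * (1 + K).
have A0 : 0 <= A by rewrite mulr_ge0 ?addr_ge0// ltW.
exists (D * r' + 2 * A * r'); first by rewrite ltr_pwDl ?mulr_gt0//; apply: mulr_ge0; [exact: mulr_ge0|exact: ltW].
move=> u v hu hv ur.
have {}ur : H1norm u <= r' by rewrite (le_trans ur)// (le_trans (ler_norm r))// lerDl.
have nv := H1norm_ge0 v.
rewrite mulrDl; apply: (le_trans (ler_normB _ _)); apply: lerD.
  by apply: (le_trans (hD u v hu hv)); rewrite -mulrA ler_pM2l// ler_wpM2r.
have IqK w : H1 w -> \int[leb]_x (C * (w x ^+ 2 + `|u x| `^ q * w x ^+ 2)) <= A * H1norm w ^+ 2.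
  move=> hw; have I2 := sqint_sqr (H1_sqint hw); have Im := mixed_intg n3 q0 qn hu hw.
  rewrite RintgZ; last exact: intgD.
  rewrite RintgD// -mulrA ler_pM2l// mulrDl mul1r; apply: lerD; first exact: L2_le.
  exact: hK.
set L := \int[leb]_x _.
have LA : (L / 2) ^+ 2 <= (A * H1norm v ^+ 2) * (A * r' ^+ 2).
  apply: discriminant_le; first by rewrite mulr_ge0 ?sqr_ge0.
  move=> t; rewrite [2 * (L / 2)]mulrC divfK ?pnatr_eq0//.
  have htv : H1 (fun x => t * v x) by exact: H1Z.
  have h : - (t * L) <= \int[leb]_x (C * (u x ^+ 2 + `|u x| `^ q * u x ^+ 2) +
      C * ((t * v x) ^+ 2 + `|u x| `^ q * (t * v x) ^+ 2)).
    rewrite -mulNr -RintgZ; last exact: nonlinearity_intg.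
    apply: Rintg_le.
    - by apply: intgZ; exact: nonlinearity_intg.
    - by apply: intgD; [exact: Iq|exact: (Iq hu htv)].
    - move=> x; apply: le_trans (f_young x (u x) (t * v x)).
      by rewrite mulNr mulrCA -mulrN (le_trans (ler_norm _))// mulrN normrN.
  rewrite (RintgD (Iq hu hu) (Iq hu htv)) in h.
  have h1 := IqK u hu; have h2 := IqK _ htv.
  rewrite H1normZ// exprMn real_normK ?num_real// in h2.
  have h3 : A * H1norm u ^+ 2 <= A * r' ^+ 2.
    by rewrite ler_wpM2l// lerXn2r ?nnegrE ?H1norm_ge0// ltW.
  by move: h h1 h2 h3; rewrite mulrCA; move: (\int[_]_x _) (\int[_]_x _) => i1 i2; lra.
have r'0 := ltW r0.
rewrite -(ler_pXn2r (n := 2)) ?nnegrE//; last by rewrite mulr_ge0// mulr_ge0// mulr_ge0.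
rewrite real_normK ?num_real//.
have -> : (2 * A * r' * H1norm v) ^+ 2 = 2 ^+ 2 * (A * H1norm v ^+ 2 * (A * r' ^+ 2)) by ring.
by move: LA; rewrite expr_div_n ler_pdivrMr// [_ * 2 ^+ 2]mulrC.
Qed.

Lemma denergy_derivative u : H1 u -> H1_derivative (energy V f) u (denergy u).
Proof.
move=> hu; split.
- by move=> a v w hv hw; exact: denergy_lin.
- by have [K _ hK] := denergy_bound (H1norm u); exists K => v hv; exact: hK.
move=> e e0; have [K K0 hK] := energy_taylor (H1norm u + 1).
exists (Num.min 1 (e / K)); first by rewrite lt_min ltr01 divr_gt0.
move=> v hv; rewrite lt_min => /andP[v1 vK].
have nu := H1norm_ge0 u; have nv := H1norm_ge0 v.
apply: (le_trans (hK u v hu hv _ _)).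
- by rewrite lerDl.
- by rewrite (le_trans (ltW v1))// lerDr.
by rewrite expr2 mulrA ler_wpM2r// mulrC -ler_pdivlMr// ltW.
Qed.

(** The quadratic part obeys the parallelogram identity and the primitive is convex. *)
Lemma energy_midpoint a b : H1 a -> H1 b ->
  2^-1 * (energy V f a + energy V f b) - energy V f (fun x => 2^-1 * (a x + b x)) <=
  8^-1 * dirichlet V (fun x => a x - b x) (fun x => a x - b x).
Proof.
move=> ha hb.
have hab : H1 (fun x => a x + b x).
  by have := H1_lin 1 ha hb; under eq_fun do rewrite mul1r.
have hm : H1 (fun x => 2^-1 * (a x + b x)) by exact: H1Z.
have [Ia [Ib Im]] := (primitive_intg ha, (primitive_intg hb, primitive_intg hm)).
have E1 : dirichlet V (fun x => 2^-1 * (a x + b x)) (fun x => 2^-1 * (a x + b x)) =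
    4^-1 * (dirichlet V a a + 2 * dirichlet V a b + dirichlet V b b).
  rewrite dirichletZ// dirichletC dirichletZ//.
  have -> : (fun x => a x + b x) = (fun x => 1 * a x + b x) by apply/funext => x; rewrite mul1r.
  rewrite dirichlet_sqr_lin//.
  move: (dirichlet V a a) (dirichlet V a b) (dirichlet V b b) => d1 d2 d3; by field.
have E2 : dirichlet V (fun x => a x - b x) (fun x => a x - b x) =
    dirichlet V a a - 2 * dirichlet V a b + dirichlet V b b.
  have -> : (fun x => a x - b x) = (fun x => - 1 * b x + a x).
    by apply/funext => x; rewrite mulN1r addrC.
  rewrite dirichlet_sqr_lin// (dirichletC V b a).
  move: (dirichlet V a a) (dirichlet V a b) (dirichlet V b b) => d1 d2 d3; ring.
have conv : \int[leb]_x F x (2^-1 * (a x + b x)) <=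
    2^-1 * (\int[leb]_x F x (a x) + \int[leb]_x F x (b x)).
  rewrite -RintgD// -RintgZ; last exact: intgD.
  apply: Rintg_le => //; first by apply: intgZ; exact: intgD.
  move=> x; exact: (primitive_convex (@f_derivable x) C0 q0 (df_growth x) (@f_small_at x)
    (f_ratio x) (F_derive x)).
rewrite !energyE// E1 E2; move: conv.
move: (dirichlet V a a) (dirichlet V a b) (dirichlet V b b) => d1 d2 d3.
move: (\int[_]_x _) (\int[_]_x _) (\int[_]_x _) => i1 i2 i3; lra.
Qed.

(** The integrand left in I(t u + w) - I(u) - Q(w) / 2 after Q(u) and the bilinear form
    at (u, w) are replaced by integrals of f(x, u), as fibre_energy does. *)
Definition fibre u w t x :=
  f x (u x) * (t * (t * u x + w x) - (t ^+ 2 + 1) / 2 * u x) + F x (u x) - F x (t * u x + w x).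

Lemma fibre_energy u w t : H1 u -> H1 w -> denergy u u = 0 -> denergy u w = 0 ->
  intg leb (fibre u w t) /\
  energy V f (fun x => t * u x + w x) - energy V f u =
  2^-1 * dirichlet V w w + \int[leb]_x fibre u w t x.
Proof.
move=> hu hw u0 w0; have hz : H1 (fun x => t * u x + w x) by exact: H1_lin.
have [Iu [Iz [Iuu Iuw]]] := (primitive_intg hu, (primitive_intg hz,
  (nonlinearity_intg hu hu, nonlinearity_intg hu hw))).
pose c : R := (t ^+ 2 - 1) / 2.
have E x : fibre u w t x = c * (f x (u x) * u x) + t * (f x (u x) * w x) +
    (F x (u x) - F x (t * u x + w x)).
  rewrite /fibre /c; move: (f x (u x)) (u x) (w x) (F x (u x)) (F x (t * u x + w x)) => a b d e g.
  by field.
have I1 := intgZ c Iuu; have I2 := intgZ t Iuw; have I3 := intgB Iu Iz.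
split.
  by apply: eq_intg (intgD (intgD I1 I2) I3) => x; rewrite E.
rewrite (eq_Rintegral _ _ (g := fun x => c * (f x (u x) * u x) + t * (f x (u x) * w x) +
    (F x (u x) - F x (t * u x + w x)))); last by move=> x _; exact: E.
rewrite (RintgD (intgD I1 I2) I3) (RintgD I1 I2) (RintgB Iu Iz) !RintgZ//.
rewrite !energyE// dirichlet_sqr_lin//.
move: u0 w0; rewrite /denergy => /eqP; rewrite subr_eq0 => /eqP -> /eqP; rewrite subr_eq0 => /eqP ->.
rewrite /c; move: (dirichlet V w w) => d.
move: (\int[_]_x _) (\int[_]_x _) (\int[_]_x _) (\int[_]_x _) => i1 i2 i3 i4; by field.
Qed.

Lemma fibre_fun_le0 u w t x : 0 < t -> fibre u w t x <= 0.
Proof.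
move=> t0; exact: (fibre_le (@f_derivable x) C0 q0 (df_growth x) (@f_small_at x)
    (f_ratio x) (F_derive x) (F0 x) _ _ t0).
Qed.

Lemma fibre_fun_lt0 u w t x : 0 < t -> t != 1 -> u x != 0 -> fibre u w t x < 0.
Proof.
move=> t0 t1 ux; exact: (fibre_lt (@f_derivable x) C0 q0 (df_growth x) (@f_small_at x)
    (f_ratio x) (F_derive x) (F0 x) _ ux t0 t1).
Qed.

Lemma energy_fibre_le u w t : H1 u -> H1 w -> denergy u u = 0 -> denergy u w = 0 ->
  dirichlet V w w <= 0 -> 0 < t -> energy V f (fun x => t * u x + w x) <= energy V f u.
Proof.
move=> hu hw u0 w0 ww t0; have [If E] := fibre_energy t hu hw u0 w0.
rewrite -subr_le0 E; apply: half_add_le0 => //.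
apply: (@le_trans _ _ (\int[leb]_x (cst 0 x))); last by rewrite /Rintegral integral0.
apply: Rintg_le => //; first exact: integrable0.
by move=> x; exact: fibre_fun_le0.
Qed.

Lemma energy_fibre_lt u w t : H1 u -> H1 w -> denergy u u = 0 -> denergy u w = 0 ->
  dirichlet V w w <= 0 -> 0 < t -> t != 1 -> ~ (u = cst 0 %[ae leb]) ->
  energy V f (fun x => t * u x + w x) < energy V f u.
Proof.
move=> hu hw u0 w0 ww t0 t1 un0.
rewrite lt_neqAle energy_fibre_le// andbT; apply/eqP => Ee; apply: un0.
have [If E] := fibre_energy t hu hw u0 w0; rewrite Ee subrr in E.
have le0 : \int[leb]_x (- fibre u w t x) <= 0.
  have -> : \int[leb]_x (- fibre u w t x) = - \int[leb]_x (fibre u w t x).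
    transitivity (\int[leb]_x (- 1 * fibre u w t x)).
      by apply: eq_Rintegral => x _; rewrite mulN1r.
    by rewrite (RintgZ _ If) mulN1r.
  exact: half_add_ge0 ww E.
have f0 x : 0 <= - fibre u w t x by rewrite oppr_ge0 fibre_fun_le0.
have I' : intg leb (fun x => - fibre u w t x).
  by apply: eq_intg (intgZ (- 1) If) => x; rewrite mulN1r.
have : (fun x => - fibre u w t x) = cst 0 %[ae leb].
  apply: (Rintg_eq0_ae I' f0); apply/eqP; rewrite eq_le le0/=.
  by apply: Rintegral_ge0 => x _; exact: f0.
apply: filterS => x /= h /h /eqP; rewrite oppr_eq0 => /eqP h0.
apply/eqP; apply: contrapT => /negP ux.
by have := fibre_fun_lt0 w t0 t1 ux; rewrite h0 ltxx.
Qed.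

End functional.

(** * Minimisers on the Nehari-Pankov manifold *)

Section h1_zero.
Variables (R : realType) (n : nat).
Notation leb := (lebesgue_rV R n).
Implicit Types (u v w : 'rV[R]_n -> R).

Lemma H1norm_ae0 u : H1 u -> u = cst 0 %[ae leb] -> H1norm u = 0.
Proof.
move=> hu u0; apply/eqP; rewrite -sqrf_eq0.
have I0 : \int[leb]_x ((cst 0 : 'rV[R]_n -> R) x ^+ 2) = 0.
  by rewrite /Rintegral; under eq_integral do rewrite expr0n; rewrite integral0.
rewrite (@H1norm_ae _ _ u (fun=> cst 0) (cst 0)) ?I0 ?big1 ?addr0//; [exact: sqint0|by move=> _; exact: sqint0|].
move=> i; apply: wpartial_eq => //; first exact: sqint0.
move=> phi tp; rewrite /L2dot.
have E (g : 'rV[R]_n -> R) : \int[leb]_x (cst 0 x * g x) = 0.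
  by under eq_Rintegral do rewrite mul0r; rewrite /Rintegral integral0.
rewrite E oppr0 -(E (partial i phi)); have sp := test_sqint (test_partial i tp).
apply: Rintg_ae.
- by apply: measurable_funM; [exact: sqint_measurable (H1_sqint hu)|exact: sqint_measurable sp].
- by apply: measurable_funM => //; exact: sqint_measurable sp.
by apply: filterS u0 => x /= h /h ->.
Qed.

(** The two linear maps differ by o(t) on t v, hence by 0 on v. *)
Lemma H1_derivative_unique (J : ('rV[R]_n -> R) -> R) u L L' :
  H1_derivative J u L -> H1_derivative J u L' -> forall v, H1 v -> L v = L' v.
Proof.
move=> [lin _ fr] [lin' _ fr'] v hv.
have h0 := H1_0 R n.
have Z (M : ('rV[R]_n -> R) -> R) (t : R) : (forall a v w, H1 v -> H1 w ->
    M (fun x => a * v x + w x) = a * M v + M w) -> M (fun x => t * v x) = t * M v.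
  move=> linM; have M0 : M (cst 0) = 0.
    have := linM (- 1) _ _ h0 h0.
    rewrite (_ : (fun x => _) = cst 0); last by apply/funext => x; rewrite /cst mulr0 addr0.
    by rewrite mulN1r addNr.
  by rewrite -[RHS]addr0 -M0 -linM//; congr M; apply/funext => x; rewrite /cst addr0.
apply/eqP; rewrite -subr_eq0 -normr_le0; apply/ler_addgt0Pl => e e0; rewrite addr0.
pose N := H1norm v; have N0 : 0 <= N := H1norm_ge0 v.
have N1 : 0 < N + 1 by rewrite ltr_wpDl.
pose c := e / (2 * (N + 1)); have c0 : 0 < c by rewrite divr_gt0// mulr_gt0.
have [d d0 hd] := fr c c0; have [d' d'0 hd'] := fr' c c0.
pose t := Num.min d d' / (N + 1).
have t0 : 0 < t by rewrite divr_gt0// lt_min d0.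
have htv : H1 (fun x => t * v x) by exact: H1Z.
have tN : H1norm (fun x => t * v x) = t * N by rewrite H1normZ// gtr0_norm.
have tNm : t * N < Num.min d d'.
  by rewrite mulrAC ltr_pdivrMr// ltr_pM2l ?ltrDl// lt_min d0.
move: tNm; rewrite lt_min => /andP[td td'].
have := hd _ htv; rewrite tN => /(_ td) b1.
have := hd' _ htv; rewrite tN => /(_ td') b2.
rewrite (Z L)// in b1; rewrite (Z L')// in b2.
have : t * `|L v - L' v| <= c * (t * N) + c * (t * N).
  rewrite -[t in leLHS]gtr0_norm// -normrM mulrBr.
  set A := J _ - J _ in b1 b2.
  have -> : t * L v - t * L' v = (A - t * L' v) - (A - t * L v) by ring.
  by apply: (le_trans (ler_normB _ _)); exact: lerD.
have -> : c * (t * N) + c * (t * N) = t * (c * (2 * N)) by ring.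
rewrite ler_pM2l// => /le_trans; apply.
rewrite /c mulrAC ler_pdivrMr ?mulr_gt0// ler_wpM2l ?(ltW e0)// ler_pM2l// lerDl//.
Qed.

Lemma closed_subspace_complete (E : set ('rV[R]_n -> R)) (w : nat -> 'rV[R]_n -> R) (C : R) :
  H1_closed_subspace E -> (forall k, E (w k)) ->
  (forall k, H1norm (w k.+1 - w k) <= C / 2 ^+ k) ->
  exists2 z, E z & (fun k => H1norm (w k - z)) @ \oo --> (0 : R).
Proof.
move=> [EH _ _ Ecl] Ew wC; have [z hz wz] := H1_complete (fun k => EH _ (Ew k)) wC.
by exists z => //; exact: Ecl wz.
Qed.

(** Take the positive component equal to 0 in the identity for Q. *)
Lemma splitting_coercive (V : 'rV[R]_n -> R) Ep Em : bounded_weight V ->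
  spectral_splitting V Ep Em ->
  exists2 k, 0 < k & forall w, Em w -> dirichlet V w w <= - (k * H1norm w ^+ 2).
Proof.
move=> bV [_ [_ Ep0 _ _] [EmH _ _ _] _ _ _ _ [nrm [_ nZ [c [D [c0 _ hc]]]] nQ]].
exists (c ^+ 2); first by rewrite exprn_gt0.
move=> w Ew; have hw := EmH _ Ew.
have nrm0 : nrm (cst 0) = 0.
  have := nZ 0 (cst 0) (H1_0 R n); rewrite normr0 mul0r.
  by rewrite (_ : (fun x => _) = cst 0)//; apply/funext => x; rewrite mul0r.
have := nQ _ _ Ep0 Ew; rewrite nrm0 expr0n/= sub0r.
rewrite (_ : cst 0 + w = w); last by apply/funext => x; exact: add0r.
rewrite /Q dirichlet_energy// => ->; rewrite lerN2 -exprMn.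
have /andP[cw _] := hc w hw.
by rewrite lerXn2r ?nnegrE ?(le_trans _ cw) ?mulr_ge0 ?H1norm_ge0// ltW.
Qed.

End h1_zero.

Theorem theoremA2 (R : realType) (N : nat) (V : 'rV[R]_N -> R)
    (f : 'rV[R]_N -> R -> R) (Ep Em : set ('rV[R]_N -> R)) (u0 : 'rV[R]_N -> R) :
  (3 <= N)%N ->
  SW1 V -> SW2 f -> SW3 f -> SW4 f -> SW5 f ->
  spectral_splitting V Ep Em ->
  nehari_pankov V f Em u0 ->
  (energy V f u0)%:E = ereal_inf [set (energy V f u)%:E | u in nehari_pankov V f Em] ->
  weak_solution V f u0.
Proof.
have half_arith (a b c : R) : 2^-1 * (a + b + (a + c)) = a + 2^-1 * (b + c).
  by field.
have concave_arith (d1 d2 d3 d4 d5 : R) : d4 <= - d5 -> d1 - d2 <= 8^-1 * d4 ->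
    d1 + 8^-1 * d5 <= d2 by move=> *; lra.
move=> n3 [cV perV _] [f_cont f_der _ [C [p [C0 /andP[p2 pc] df_growth]]]] f_small _ f_ratio.
move=> split_V [hu0 u0n0 Qu0 [L dL L0]] infE.
pose q := p - 2.
have q0 : 0 <= q by rewrite subr_ge0 ltW.
have N2 : (0 : R) < N%:R - 2 by rewrite subr_gt0 (ltr_nat R 2 N).
have qn : (q + 2) * (N%:R - 2) < 2 * N%:R by rewrite /q subrK -ltr_pdivlMr.
have bV : bounded_weight V.
  split; first exact: measurable_rV_continuous.
  exact: periodic_bounded.
have [k k0 Vneg] := splitting_coercive bV split_V.
have clEm := splitting_closedm split_V; have [EmH Em0 Em_lin _] := clEm.
have Vle0 w : Em w -> dirichlet V w w <= 0.
  by move=> /Vneg/le_trans; apply; rewrite oppr_le0 mulr_ge0 ?sqr_ge0// ltW.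
have dE u : H1 u -> H1_derivative (energy V f) u (denergy V f u).
  exact: (denergy_derivative n3 q0 qn bV f_cont f_der C0 df_growth f_small f_ratio).
have u0E := H1_derivative_unique dL (dE _ hu0).
have du0u0 : denergy V f u0 u0 = 0.
  by apply/eqP; rewrite subr_eq0 -Qu0 /Q dirichlet_energy.
have du0w w : Em w -> denergy V f u0 w = 0.
  by move=> Ew; rewrite -u0E ?L0//; exact: EmH.
have N0 : 0 < H1norm u0.
  rewrite lt_neqAle H1norm_ge0 andbT eq_sym; apply/eqP => h.
  by apply: u0n0; exact: H1norm_eq0.
have [lin_du0 _ _] := dE _ hu0.
(* It suffices to exclude I'(u0) v < 0: apply this to v and to - v. *)
suff du0_ge0 v : H1 v -> 0 <= denergy V f u0 v.
  have du00 v : H1 v -> denergy V f u0 v = 0.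
    move=> hv; apply/eqP; rewrite eq_le du0_ge0// andbT -oppr_ge0.
    have := du0_ge0 _ (H1_lin (- 1) hv (H1_0 R N)).
    rewrite lin_du0//; last exact: H1_0.
    have := lin_du0 (-1) _ _ (H1_0 R N) (H1_0 R N).
    rewrite (_ : (fun x => _) = cst 0); last by apply/funext => x; rewrite /cst mulr0 addr0.
    by rewrite mulN1r addNr => ->; rewrite addr0 mulN1r.
  split=> //; have [_ _ fr] := dE _ hu0; split.
  - by move=> a v w _ _; rewrite /cst mulr0 addr0.
  - by exists 0 => v _; rewrite /cst normr0 mul0r.
  - by move=> e /fr[d d0 hd]; exists d => // v hv vd; have := hd v hv vd; rewrite du00.
move=> hv; rewrite leNgt; apply/negP => dv.
have [m [hm mu0 dmm dmw Em_lt]] : exists m, [/\ H1 m, H1norm (m - u0) <= H1norm u0 / 2,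
    denergy V f m m = 0, forall w, Em w -> denergy V f m w = 0 & energy V f m < energy V f u0].
  have tay := energy_taylor n3 q0 qn bV f_cont f_der C0 df_growth f_small f_ratio.
  have bnd := denergy_bound n3 q0 qn bV f_cont f_der C0 df_growth f_small.
  have lin (u : 'rV[R]_N -> R^o) : H1 u -> forall a (v w : 'rV[R]_N -> R^o), H1 v -> H1 w ->
      denergy V f u (a *: v + w) = a * denergy V f u v + denergy V f u w.
    by move=> hu; have [] := dE u hu.
  have conc : exists2 k, 0 < k & forall y w1 w2 : 'rV[R]_N -> R^o, H1 y -> Em w1 -> Em w2 ->
      2^-1 * (energy V f (y + w1) + energy V f (y + w2)) + k * H1norm (w1 - w2) ^+ 2
      <= energy V f (y + 2^-1 *: (w1 + w2)).
    exists (8^-1 * k); first by rewrite mulr_gt0.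
    move=> y w1 w2 hy E1 E2; have [h1 h2] := (EmH _ E1, EmH _ E2).
    have hD w : H1 w -> H1 (fun x => y x + w x).
      by move=> hw; have := H1_lin 1 hy hw; under eq_fun do rewrite mul1r.
    have := energy_midpoint n3 q0 qn bV f_cont f_der C0 df_growth f_small f_ratio (hD _ h1) (hD _ h2).
    have E12 : Em (w1 - w2).
      have := Em_lin (- 1) _ _ E2 E1.
      by rewrite (_ : (fun x => _) = w1 - w2)//; apply/funext => x; rewrite mulN1r addrC.
    have -> : (fun x => y x + w1 x - (y x + w2 x)) = w1 - w2.
      by apply/funext => x; rewrite opprD addrACA subrr add0r.
    have -> : (fun x => 2^-1 * (y x + w1 x + (y x + w2 x))) = (fun x => y x + 2^-1 * (w1 x + w2 x)).
      by apply/funext => x; exact: half_arith.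
    by rewrite -[8^-1 * k * _]mulrA; exact: concave_arith (Vneg _ E12).
  have le1 (t : R) (w : 'rV[R]_N -> R^o) : 0 < t -> Em w ->
      energy V f (t *: (u0 : 'rV[R]_N -> R^o) + w) <= energy V f u0.
    move=> t0 Ew; exact: (energy_fibre_le n3 q0 qn bV f_cont f_der C0 df_growth f_small f_ratio
      hu0 (EmH _ Ew) du0u0 (du0w _ Ew) (Vle0 _ Ew) t0).
  have lt1 (t : R) (w : 'rV[R]_N -> R^o) : 0 < t -> t != 1 -> Em w ->
      energy V f (t *: (u0 : 'rV[R]_N -> R^o) + w) < energy V f u0.
    move=> t0 t1 Ew; exact: (energy_fibre_lt n3 q0 qn bV f_cont f_der C0 df_growth f_small f_ratio
      hu0 (EmH _ Ew) du0u0 (du0w _ Ew) (Vle0 _ Ew) t0 t1 u0n0).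
  have cpl (w : nat -> 'rV[R]_N -> R^o) (D : R) : (forall k, Em (w k)) ->
      (forall k, H1norm (w k.+1 - w k) <= D / 2 ^+ k) ->
      exists2 z : 'rV[R]_N -> R^o, Em z & (fun k => H1norm (w k - z)) @ \oo --> (0 : R).
    exact: closed_subspace_complete.
  have N20 : 0 < H1norm u0 / 2 by rewrite divr_gt0.
  exact: (@natural_constraint R ('rV[R]_N -> R^o) (@H1 R N) Em (@H1norm R N) (energy V f)
    (denergy V f) (@H1_lin R N) EmH Em0 Em_lin (@H1norm_ge0 R N) (@H1normZ R N) (@H1normD R N)
    cpl lin tay bnd conc u0 v _ hu0 hv N20 le1 lt1 dv).
have mN : nehari_pankov V f Em m.
  split=> //.
  - move=> m0; have hmu := H1_sub hm hu0.
    have := H1normD (H1Z (- 1) hmu) hm.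
    rewrite (H1norm_ae0 hm m0) addr0 H1normZ// normrN1 mul1r.
    rewrite (_ : (fun x => _) = u0); last by apply/funext => x; rewrite mulN1r opprB subrK.
    by move=> h; have := le_trans h mu0; rewrite leNgt ltr_pdivrMr// ltr_pMr// ltr1n.
  - by rewrite /Q dirichlet_energy//; apply/eqP; rewrite -subr_eq0; apply/eqP.
  - by exists (denergy V f m) => //; exact: dE.
have := ereal_inf_lbound (imageP (fun u => (energy V f u)%:E) mN).
by rewrite -infE lee_fin leNgt Em_lt.
Qed.
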